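(* Suppose $|v_{ij}(x)|\lesssim\langle x\rangle^{-2-\epsilon}$ for some $\epsilon>0$ and all $i,j$. Suppose $(H-mI)\psi=0$ (in the sense of distributions) for some $\psi=c(1,0)^T+\Gamma_1+\Gamma_2$ with $c\in\mathbb C$, $\Gamma_1\in L^p\times L^p(\mathbb R^2)$ for some $2<p<\infty$, and $\Gamma_2\in L^2\times L^2(\mathbb R^2)$. Then $\phi:=Uv\psi\in S_1(L^2\times L^2)$. Moreover, $\psi=c(1,0)^T-\mathcal G_0v^*\phi$ and $c=c_0$, where $c_0=\langle(a,c)^T,T\phi\rangle/\|(a,c)^T\|_2^2$ (here $(a,c)^T$ is the first column of $v$). Furthermore, $\Gamma_1,\Gamma_2\in L^p\times L^p$ for all $p\in(2,\infty]$.
   Context: Let $m>0$ and let $V:\mathbb R^2\to\mathbb C^{2\times2}$ be self-adjoint-matrix valued; $H=D_m+V$ with $D_m=-i\alpha\cdot\nabla+m\beta=-i\alpha_1\partial_1-i\alpha_2\partial_2+m\beta$ on $\mathbb C^2$-valued functions on $\mathbb R^2$, $\beta=\begin{pmatrix}1&0\\0&-1\end{pmatrix}$, $\alpha_1=\begin{pmatrix}0&1\\1&0\end{pmatrix}$, $\alpha_2=\begin{pmatrix}0&-i\\i&0\end{pmatrix}$; $\langle x\rangle=(1+|x|^2)^{1/2}$. Write $V=B^*\,\mathrm{diag}(\lambda_1,\lambda_2)\,B$ pointwise with $B(x)$ unitary and $\lambda_j(x)$ real, $\eta_j=|\lambda_j|^{1/2}$, $U=\mathrm{diag}(\mathrm{sign}\lambda_1,\mathrm{sign}\lambda_2)$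 (convention $\mathrm{sign}(0)=1$), $v=\mathrm{diag}(\eta_1,\eta_2)B=\begin{pmatrix}a&b\\c&d\end{pmatrix}$, so $V=v^*Uv$. (The function $c$ in $v$ is unrelated to the constant $c$ in the expansion of $\psi$.) The first column $(a,c)^T$ is taken to be not identically zero, so that $P$ and $c_0$ are defined. Let $I_1=\mathrm{diag}(1,0)$, $G_0f(x)=-\frac1{2\pi}\int_{\mathbb R^2}\log|x-y|f(y)\,dy$, $\mathcal G_0=-i\alpha\cdot\nabla G_0+2mG_0I_1$, $T=U+v\mathcal G_0v^*$; $P$ is the orthogonal projection in $L^2\times L^2$ onto the span of $(a,c)^T$, $Q=1-P$. $S_1$ is the (orthogonal) Riesz projection onto the kernel of $QTQ$ as an operator on $Q(L^2\times L^2)$. The inner product in $c_0$ is linear in the second slot: $\langle(a,c)^T,T\phi\rangle=\int(\overline a\,(T\phi)_1+\overline c\,(T\phi)_2)\,dx$.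
   Formalization: The last claim fails for the given Γ_1, Γ_2 (ψ=0, c=0, Γ_1=g=−Γ_2, g unbounded in L^2∩L^p); proved instead: Γ_1+Γ_2 is in L^q×L^q for all q in (2,∞], and some decomposition Γ_1', Γ_2' with Γ_2' in L^2×L^2 has both parts in all these spaces. *)

(* Defs.v *)
From HB Require Import structures.
From mathcomp Require Import all_boot all_order all_algebra.
From mathcomp Require Import all_classical all_reals all_analysis.
From mathcomp Require Import complex.

Set Implicit Arguments.
Unset Strict Implicit.
Unset Printing Implicit Defensive.

Import Order.TTheory GRing.Theory Num.Theory.
Import numFieldNormedType.Exports.

Local Open Scope classical_set_scope.
Local Open Scope complex_scope.
Local Open Scope ring_scope.
Local Open Scope sesquilinear_scope.

Notation plane R := (R * R)%type.

(* 'cV[R[i]]_2 is C^2; index 0 is the first component, index 1 the second. *)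
Notation spinor R := ('cV[R[i]]_2).

(* The plane with its Borel sigma-algebra; this type is convertible to R * R. *)
Notation mplane R := (measurableTypeR R * measurableTypeR R)%type.

Definition mu2 (R : realType) : {measure set (mplane R) -> \bar R} :=
  (@lebesgue_measure R \x @lebesgue_measure R)%E.

(* Euclidean: the library norm on R * R is the sup norm. *)
Definition enorm (R : realType) (x : plane R) : R :=
  Num.sqrt (x.1 ^+ 2 + x.2 ^+ 2).

Definition japanese (R : realType) (x : plane R) : R :=
  Num.sqrt (1 + enorm x ^+ 2).

Definition cmod (R : realType) (z : R[i]) : R := ComplexField.Normc.normc z.

Definition cmeasurable (R : realType) (f : plane R -> R[i]) : Prop :=
  measurable_fun (setT : set (mplane R)) (fun x => complex.Re (f x)) /\
  measurable_fun (setT : set (mplane R)) (fun x => complex.Im (f x)).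

Definition cint (R : realType) (f : plane R -> R[i]) : R[i] :=
  (\int[mu2 R]_x complex.Re (f x)) +i* (\int[mu2 R]_x complex.Im (f x)).

Definition cLp (R : realType) (p : \bar R) (f : plane R -> R[i]) : Prop :=
  cmeasurable f /\ finite_norm (mu2 R) p (fun x => cmod (f x)).

Definition Lp2 (R : realType) (p : \bar R) (f : plane R -> spinor R) : Prop :=
  forall k, cLp p (fun x => f x k 0).

Definition ae_eq2 (R : realType) (f g : plane R -> spinor R) : Prop :=
  {ae mu2 R, forall x, f x = g x}.

Definition inner (R : realType) (f g : plane R -> spinor R) : R[i] :=
  cint (fun x => \sum_k (f x k 0)^* * g x k 0).

Definition L2norm (R : realType) (f : plane R -> spinor R) : R :=
  Num.sqrt (\int[mu2 R]_x (\sum_k cmod (f x k 0) ^+ 2)).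

(* Orthogonal projection in L^2 x L^2 onto the subspace N; determined up to a
   null set, and 0 by convention where there is no best approximation. *)
Definition orthproj (R : realType) (N : set (plane R -> spinor R))
    (f : plane R -> spinor R) : plane R -> spinor R :=
  xget (fun=> 0) [set g | N g /\ forall h, N h -> inner h (fun x => f x - g x) = 0].

Definition evec (R : realType) (j : 'I_2) : plane R :=
  if j == 0 then (1, 0) else (0, 1).

Definition pd (R : realType) (j : 'I_2) (chi : plane R -> R) : plane R -> R :=
  fun x => 'D_(evec R j) (chi : _ -> R^o) x.

Definition smooth (R : realType) (chi : plane R -> R) : Prop :=
  forall (s : seq 'I_2) (x : plane R),
    differentiable (foldr (@pd R) chi s : plane R -> R^o) x.

Definition test_fun (R : realType) (chi : plane R -> R) : Prop :=
  smooth chi /\ compact (closure [set x | chi x != 0]).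

Definition loc_int (R : realType) (f : plane R -> R[i]) : Prop :=
  cmeasurable f /\ forall K : set (plane R), compact K ->
    (mu2 R).-integrable K (EFin \o (fun x => cmod (f x))).

(* C-valued and C^2-valued distributions are given by their values on real
   test functions (to which complex ones reduce by linearity). *)
Definition dist (R : realType) (f : plane R -> R[i]) (chi : plane R -> R) :
  R[i] := cint (fun x => f x * (chi x)%:C).

Definition dist2 (R : realType) (f : plane R -> spinor R) (chi : plane R -> R) :
  spinor R := \col_k dist (fun x => f x k 0) chi.

Definition ddist (R : realType) (E : zmodType) (j : 'I_2)
  (F : (plane R -> R) -> E) (chi : plane R -> R) : E := - F (pd j chi).

(* The distributional partial derivative of a function u, when it is itself
   (represented by) a locally integrable function, which is then unique up to
   a null set; 0 by convention otherwise. *)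
Definition wpd (R : realType) (j : 'I_2) (u : plane R -> R[i]) :
    plane R -> R[i] :=
  xget (fun=> 0) [set g | [/\ loc_int u, loc_int g &
    forall chi, test_fun chi -> ddist j (dist u) chi = dist g chi]].

Section Dirac.
Context {R : realType}.

Definition mx2 (a b c d : R[i]) : 'M[R[i]]_2 :=
  \matrix_(i, j) if i == 0 then (if j == 0 then a else b)
                 else (if j == 0 then c else d).

Definition dirac_beta : 'M[R[i]]_2 := mx2 1 0 0 (-1).
Definition I1 : 'M[R[i]]_2 := mx2 1 0 0 0.
Definition dirac_alpha (j : 'I_2) : 'M[R[i]]_2 :=
  if j == 0 then mx2 0 1 1 0 else mx2 0 (- 'i) 'i 0.

Definition spin_up : spinor R := delta_mx 0 0.

Definition Dirac (m : R) (F : (plane R -> R) -> spinor R)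
    (chi : plane R -> R) : spinor R :=
  (- 'i) *: (\sum_j dirac_alpha j *m ddist j F chi) + m%:C *: (dirac_beta *m F chi).

Definition dist_sol (m : R) (V : plane R -> 'M[R[i]]_2)
    (psi : plane R -> spinor R) : Prop :=
  forall chi, test_fun chi ->
    Dirac m (dist2 psi) chi + dist2 (fun x => V x *m psi x) chi
    - m%:C *: dist2 psi chi = 0.

Definition G0 (f : plane R -> R[i]) : plane R -> R[i] := fun x =>
  - ((2 * pi)^-1)%:C * cint (fun y => (ln (enorm (x - y)))%:C * f y).

Definition G0v (f : plane R -> spinor R) : plane R -> spinor R :=
  fun x => \col_k G0 (fun y => f y k 0) x.

(* The gradient in calG0 = - i alpha . nabla G_0 + 2 m G_0 I_1 is distributional,
   as in the Dirac operator; it is taken componentwise. *)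
Definition wpd2 (j : 'I_2) (f : plane R -> spinor R) : plane R -> spinor R :=
  fun x => \col_k wpd j (fun y => f y k 0) x.

Definition calG0 (m : R) (f : plane R -> spinor R) : plane R -> spinor R :=
  fun x => (- 'i) *: (\sum_j dirac_alpha j *m wpd2 j (G0v f) x)
           + (2 * m)%:C *: G0v (fun y => I1 *m f y) x.

Definition rdiag (d : 'I_2 -> R) : 'M[R[i]]_2 := diag_mx (\row_j (d j)%:C).

(* sign with sign(0) = 1, unlike Num.sg *)
Definition sgn1 (t : R) : R := if 0 <= t then 1 else -1.

Definition Umx (lam : 'I_2 -> plane R -> R) (x : plane R) : 'M[R[i]]_2 :=
  rdiag (fun j => sgn1 (lam j x)).

Definition vmx (lam : 'I_2 -> plane R -> R) (B : plane R -> 'M[R[i]]_2)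
    (x : plane R) : 'M[R[i]]_2 :=
  rdiag (fun j => Num.sqrt `|lam j x|) *m B x.

Definition opT (m : R) (U v : plane R -> 'M[R[i]]_2)
    (f : plane R -> spinor R) : plane R -> spinor R :=
  fun x => U x *m f x + v x *m calG0 m (fun y => (v y)^t* *m f y) x.

Definition first_col (v : plane R -> 'M[R[i]]_2) : plane R -> spinor R :=
  fun x => col 0 (v x).

Definition opP (v : plane R -> 'M[R[i]]_2) :
    (plane R -> spinor R) -> plane R -> spinor R :=
  orthproj [set g | exists z : R[i], g = fun x => z *: first_col v x].

Definition opQ (v : plane R -> 'M[R[i]]_2) (f : plane R -> spinor R) :
    plane R -> spinor R :=
  fun x => f x - opP v f x.

Definition kerQTQ (m : R) (U v : plane R -> 'M[R[i]]_2) :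
    set (plane R -> spinor R) :=
  [set f | [/\ Lp2 2%:E f,
               exists2 g, Lp2 2%:E g & ae_eq2 f (opQ v g) &
               ae_eq2 (opQ v (opT m U v (opQ v f))) (fun=> 0)]].

Definition opS1 (m : R) (U v : plane R -> 'M[R[i]]_2) :
    (plane R -> spinor R) -> plane R -> spinor R :=
  orthproj (kerQTQ m U v).

Definition ranS1 (m : R) (U v : plane R -> 'M[R[i]]_2) :
    set (plane R -> spinor R) :=
  [set f | Lp2 2%:E f /\ exists2 g, Lp2 2%:E g & ae_eq2 f (opS1 m U v g)].

Definition c_0 (m : R) (U v : plane R -> 'M[R[i]]_2)
    (phi : plane R -> spinor R) : R[i] :=
  inner (first_col v) (opT m U v phi) / (L2norm (first_col v) ^+ 2)%:C.

End Dirac.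

(* Main.v *)
From HB Require Import structures.
Require Import Defs.
From mathcomp Require Import all_boot all_order all_algebra.
From mathcomp Require Import all_classical all_reals all_analysis.
From mathcomp Require Import measurable_realfun complex.
From mathcomp Require Import ring lra.

Set Implicit Arguments.
Unset Strict Implicit.
Unset Printing Implicit Defensive.

Import Order.TTheory GRing.Theory Num.Theory.
Import numFieldNormedType.Exports.

Local Open Scope classical_set_scope.
Local Open Scope complex_scope.
Local Open Scope ring_scope.
Local Open Scope sesquilinear_scope.

(** Write f = V psi = v^* phi and let f0, f1 be its components.  In components
    the equation (D_m + V - m) psi = 0 says that i(d_0 - i d_1) psi1 = f0 and
    i(d_0 + i d_1) psi0 = f1 - 2 m psi1, so psi is obtained from f by inverting
    the Cauchy-Riemann operators; because 2 m psi1 appears as a source for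
    psi0, the logarithmic potential of f0 enters as well.  The proof makes this
    inversion rigorous for a distributional solution about which only
    psi = c e0 + (something small at infinity) is known, and then reads
    everything off the resulting formula.

    Inversion.  Let q_d be a smooth positive function on the half line with
    q_d(s) = s for s >= d^2.  The gradient in u of (1/2) ln q_d(|u|^2) is
    u q_d'/q_d(|u|^2); it equals u/|u|^2 outside the disc of radius d, and half
    its divergence is a bump supported in that disc.  Differences of two such
    functions, for radii d <= r, have compact support, and testing the two
    equations against them gives Green identities relating the bump averages
    of psi at radii d and r to the pairings of f with the regularised kernels
    ([green_psi1], [green_psi0]).  The flux of the gradient kernel through the
    boundary of a square is computed from the arctangent, so that the bumps
    have mass pi ([bump_ker_mass]).

    As r tends to infinity the average of psi at radius r tends to pi c e0,
    since a function that is arbitrarily small up to an integrable error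
    averages to 0 ([bump_ker_lim]).  The identity for psi0 also contains
    m ln r times the integral of f0; all its other terms converge, hence f0
    has integral 0 ([charge_psi0_mean]).  As d tends to 0 the bumps are an
    approximate identity, and almost everywhere
      psi1 = C (K0 f0 + i K1 f0),
      psi0 = c + (m/pi) L f0 + C (K0 f1 - i K1 f1),
    where K_j and L are convolution with u_j/|u|^2 and ln|u|, and C = -i/(2 pi)
    ([psi1_repr], [psi0_repr]).  Integrating by parts along the coordinate
    lines shows that the weak gradient of G0 f is -(1/(2 pi)) (K0 f, K1 f)
    ([wpd_G0]), which turns the two formulas into
    psi = c e0 - calG0 v^* phi.

    Decay.  Since |f| <= K w^2 |psi| with w = <x>^(-2-eps), the function
    g = 4 K w |psi| dominates (1+|y|)^2 |f|; it is integrable because w and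
    w |psi|^2 are.  The three potentials above are bounded by a multiple of
    (N(x) + |g|_1) / (1+|x|), where N is the convolution of g with 1/|u|; for
    the logarithmic one this uses that f0 has integral 0
    ([pot_grad_ln_decay], [pot_ln_norm_decay]).  This gives |psi| <= C(1 + N).
    Inserting the bound once into N and splitting the iterated kernel by the
    arithmetic-geometric mean inequality makes N bounded ([riesz_bounded]).
    Therefore psi - c e0 = O(1/(1+|x|)), which is in L^q for every q > 2.

    Conclusion.  The integral of f0 is the inner product of (a,c)^T with phi,
    so P phi = 0 and Q phi = phi.  As U^2 = 1, the representation formula gives
    T phi = v psi + v calG0 v^* phi = c (a,c)^T.  Hence Q T Q phi = 0, phi is
    fixed by the projection S_1, and c_0 = c.  The remainder may be taken
    entirely in the first summand: Gamma_1 + Gamma_2 and 0. *)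

(** * Lebesgue measure on the plane *)

Section Plane. Context {R : realType}.

Lemma mu2_setX (A B : set (measurableTypeR R)) : measurable A -> measurable B ->
  (mu2 R (A `*` B) = @lebesgue_measure R A * @lebesgue_measure R B)%E.
Proof. exact: product_measure1E. Qed.

Lemma mu2_sigma_finite : sigma_finite setT (mu2 R).
Proof.
have /sigma_finiteP[F [TF ndF Foo]] := sigma_finiteT (@lebesgue_measure R).
exists (fun n => F n `*` F n).
 rewrite -setXTT TF predeqE => -[x y]; split.
    move=> [/= [n _ Fnx] [k _ Gky]]; exists (maxn n k) => //; split.
    - by move: x Fnx; exact/subsetPset/ndF/leq_maxl.
    - by move: y Gky; exact/subsetPset/ndF/leq_maxr.
  by move=> [n _ []/= ? ?]; split; exists n.
move=> k; have [? ?] := Foo k.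
split; first exact: measurableX.
by rewrite mu2_setX// lte_mul_pinfty// ge0_fin_numE.
Qed.

(** A copy of the product measure that carries the sigma-finite structure
    required by the Fubini theorems; [mu2E] identifies the two. *)
Definition leb2 : set (mplane R) -> \bar R := mu2 R.
HB.instance Definition _ := Measure.on leb2.
HB.instance Definition _ := Measure_isSigmaFinite.Build _ _ _ leb2 mu2_sigma_finite.
Lemma mu2E : mu2 R = leb2 :> {measure set (mplane R) -> \bar R}. Proof. by []. Qed.

Lemma tonelli2 (F : mplane R * mplane R -> \bar R) :
  measurable_fun [set: mplane R * mplane R] F -> (forall x, 0 <= F x)%E ->
  (\int[mu2 R]_x \int[mu2 R]_y F (x, y) = \int[mu2 R]_y \int[mu2 R]_x F (x, y))%E.
Proof. by move=> mF F0; rewrite mu2E; exact: (@fubini_tonelli _ _ _ _ _ leb2 leb2). Qed.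

Lemma mu2_tonelli (F : mplane R -> \bar R) :
  measurable_fun [set: mplane R] F -> (forall x, 0 <= F x)%E ->
  (\int[mu2 R]_x F x = \int[lebesgue_measure]_s \int[lebesgue_measure]_t F (s, t))%E.
Proof. by move=> mF F0; exact: (@fubini_tonelli1 _ _ _ _ _ lebesgue_measure lebesgue_measure). Qed.

Lemma mu2_tonelli' (F : mplane R -> \bar R) :
  measurable_fun [set: mplane R] F -> (forall x, 0 <= F x)%E ->
  (\int[mu2 R]_x F x = \int[lebesgue_measure]_t \int[lebesgue_measure]_s F (s, t))%E.
Proof.
move=> mF F0; rewrite mu2_tonelli//.
exact: (@fubini_tonelli _ _ _ _ _ lebesgue_measure lebesgue_measure).
Qed.

(** The product of the two Borel sigma-algebras is the Borel sigma-algebra of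
    the plane because the plane is second countable: an open set is a countable
    union of open squares with rational centres. *)
Lemma open_mplane (A : set (plane R)) : open A -> measurable (A : set (mplane R)).
Proof.
move=> oA.
pose J (q : R) (n : nat) : set (measurableTypeR R) :=
  `]q - n.+1%:R^-1, q + n.+1%:R^-1[%classic.
pose bx (n : nat) (q r : rat) : set (mplane R) := J (ratr q) n `*` J (ratr r) n.
have mbx n q r : measurable (bx n q r).
  by apply: measurableX; exact: measurable_itv.
pose cx n q r := if pselect (bx n q r `<=` A) then bx n q r else set0.
have mcx n q r : measurable (cx n q r) by rewrite /cx; case: pselect => ?; [exact: mbx|exact: measurable0].
suff -> : A = \bigcup_n \bigcup_q \bigcup_r cx n q r.
  apply: bigcupT_measurable => n; apply: bigcupT_measurable_rat => q.
  by apply: bigcupT_measurable_rat => r; exact: mcx.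
rewrite eqEsubset; split; last first.
  by move=> x [n _ [q _ [r _]]]; rewrite /cx; case: pselect => // h /h.
move=> x Ax; have /nbhs_ballP[e /= e0 xeA] : nbhs x A by exact: open_nbhs_nbhs.
have [n _ /(_ _ (leqnn _)) /= ne] := near_infty_natSinv_lt (PosNum (divr_gt0 e0 (ltr0n _ 2))).
have n0 : 0 < n.+1%:R^-1 :> R by rewrite invr_gt0.
move: ne n0; set d : R := n.+1%:R^-1 => ne n0.
have rt (t : R) : exists q : rat, `|t - ratr q| < d.
  have tt : t < t + d by rewrite ltrDl.
  have [q] := rat_in_itvoo tt.
  by rewrite in_itv/= => /andP[q1 q2]; exists q; rewrite ltr_norml; apply/andP; split; lra.
have [q hq] := rt x.1; have [r hr] := rt x.2.
exists n => //; exists q => //; exists r => //; rewrite /cx /bx /J -/d; case: pselect => [sA|[]]; last first.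
  move=> y [] /=; rewrite !in_itv/= => /andP[y1 y2] /andP[y3 y4].
  apply: xeA; split => /=; rewrite -ball_normE/=;
    move: hq hr; rewrite !ltr_norml; lra.
by split; rewrite /= in_itv/=; move: hq hr; rewrite !ltr_norml => /andP[? ?] /andP[? ?]; apply/andP; split; lra.
Qed.

Lemma continuous_mplane (f : plane R -> R) :
  continuous f -> measurable_fun [set: mplane R] f.
Proof.
move=> /continuousP cf; apply: (measurability _ (RGenOpens.measurableE R)).
move=> _ [_ [a [b ->] <-]]; rewrite setTI; apply: open_mplane.
exact/cf/interval_open.
Qed.

Lemma closed_mplane (A : set (plane R)) : closed A -> measurable (A : set (mplane R)).
Proof. by move/closed_openC/open_mplane/measurableC; rewrite setCK. Qed.

Lemma compact_mplane (A : set (plane R)) : compact A -> measurable (A : set (mplane R)).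
Proof. by move/compact_closed => /(_ (@norm_hausdorff _ _)); exact: closed_mplane. Qed.

Definition box (y : plane R) (M : R) : set (plane R) :=
  `[y.1 - M, y.1 + M]%classic `*` `[y.2 - M, y.2 + M]%classic.

Lemma boxP y M x : box y M x <-> `|x.1 - y.1| <= M /\ `|x.2 - y.2| <= M.
Proof.
rewrite /box/= !in_itv/= !ler_norml; split.
  by move=> [/andP[? ?] /andP[? ?]]; split; apply/andP; split; lra.
by move=> [/andP[? ?] /andP[? ?]]; split; apply/andP; split; lra.
Qed.

Lemma box_measurable y M : measurable (box y M : set (mplane R)).
Proof. by apply: (@measurableX _ _ (measurableTypeR R) (measurableTypeR R)); exact: measurable_itv. Qed.

Lemma box_compact y M : compact (box y M).
Proof. by apply: compact_setX; exact: segment_compact. Qed.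

Lemma mu2_box y M : 0 <= M -> mu2 R (box y M) = ((2 * M) ^+ 2)%:E.
Proof.
move=> M0; rewrite mu2_setX; [|exact: measurable_itv..].
rewrite !lebesgue_measure_itv/= !lte_fin.
have h (t : R) : (if t - M < t + M then ((t + M)%:E - (t - M)%:E)%E else 0%E) = (2 * M)%:E.
  case: ifPn => [_|]; first by rewrite -EFinB; congr EFin; lra.
  by rewrite -leNgt => ?; congr EFin; lra.
by rewrite !h -EFinM expr2.
Qed.

Lemma compact_box (K : set (plane R)) : compact K -> exists2 M, 0 < M & K `<=` box 0 M.
Proof.
move=> /compact_bounded[M [_ hM]]; exists (`|M| + 1); first by rewrite ltr_wpDl.
move=> x Kx; have /= := hM (`|M| + 1) _ x Kx.
rewrite (le_lt_trans (ler_norm M)) ?ltrDl// => /(_ isT).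
by rewrite prod_normE ge_max => /andP[h1 h2]; apply/boxP; rewrite !subr0.
Qed.

End Plane.

(** * Smooth functions built from exp(-1/u) *)

Section FlatExp. Context {R : realType}.
Implicit Types u : R.

Lemma is_derive_mul (V : normedModType R) (f g : V -> R) (x v : V) (df dg : R) :
  is_derive x v f df -> is_derive x v g dg ->
  is_derive x v (fun t => f t * g t) (df * g x + f x * dg).
Proof.
move=> hf hg; apply: (is_derive_eq (is_deriveM hf hg)).
by rewrite /GRing.scale/= addrC mulrC.
Qed.

(** The factor u^(-n) is there because the derivative of each member of this
    family is a combination of two others. *)
Definition flatexp (n : nat) u : R := if 0 < u then u^-1 ^+ n * expR (- u^-1) else 0.

Lemma flatexp_ge0 n u : 0 <= flatexp n u.
Proof.
rewrite /flatexp; case: ifPn => // u0.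
by rewrite mulr_ge0 ?expR_ge0// exprn_ge0// invr_ge0 ltW.
Qed.

(** A term of the exponential series bounds exp(1/u) from below; the resulting
    quadratic bound makes the function differentiable at 0. *)
Lemma flatexp_le n u : flatexp n u <= (n.+2)`!%:R * u ^+ 2.
Proof.
rewrite /flatexp; case: ifPn => [u0|_]; last by rewrite mulr_ge0// sqr_ge0.
have := @expR_ge1Dxn R u^-1 n.+1; rewrite invr_ge0 ltW// => /(_ isT) h.
rewrite expRN ler_pdivrMr ?expR_gt0//.
have f0 : 0 < (n.+2)`!%:R :> R by rewrite ltr0n fact_gt0.
apply: (@le_trans _ _ ((n.+2)`!%:R * u ^+ 2 * (u^-1 ^+ n.+2 / (n.+2)`!%:R))).
  rewrite le_eqVlt; apply/orP; left; apply/eqP.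
  by rewrite -(addn2 n) exprD; field; rewrite addn2 !lt0r_neq0.
apply: ler_wpM2l; first by rewrite mulr_ge0 ?sqr_ge0 ?(ltW f0).
  by move: h; lra.
Qed.

Lemma is_derive_flatexp n u :
  is_derive u 1 (flatexp n) (flatexp n.+2 u - n%:R * flatexp n.+1 u).
Proof.
have [u0|u0|u0] := ltgtP u 0.
- have -> : flatexp n.+2 u - n%:R * flatexp n.+1 u = 0.
    by rewrite /flatexp ltNge (ltW u0) /= mulr0 subr0.
  apply: (@near_eq_is_derive _ R^o R^o (cst 0)) => //.
  near=> t; rewrite /flatexp/= ltNge; suff -> : t <= 0 by [].
  by apply: ltW; near: t; exact: lt_nbhsl.
- have -> : flatexp n.+2 u - n%:R * flatexp n.+1 u =
     (n%:R * u^-1 ^+ n.-1 * (- u ^- 2)) * expR (- u^-1) + u^-1 ^+ n * (expR (- u^-1) * - (- u ^- 2)).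
    rewrite /flatexp u0; case: n => [|n] /=; first by rewrite -exprVn; ring.
    by rewrite -exprVn !exprS; ring.
  apply: (@near_eq_is_derive _ R^o R^o (fun t : R => t^-1 ^+ n * expR (- t^-1) : R^o)) => //.
    near=> t; rewrite /flatexp/=; suff -> : 0 < t by [].
    by near: t; exact: lt_nbhsr.
  have hV : is_derive u 1 (fun t : R => t^-1) (- u ^- 2).
    have := @is_deriveV R id u 1 1 (lt0r_neq0 u0) _.
    by move=> /(_ (is_derive_id _ _)); rewrite /GRing.scale/= mulr1.
  have hX : is_derive u 1 (fun t : R => t^-1 ^+ n) (n%:R * u^-1 ^+ n.-1 * (- u ^- 2)).
    have hp : is_derive (u^-1) 1 (fun t : R => t ^+ n) (n%:R * u^-1 ^+ n.-1).
      apply: DeriveDef; first exact: exprn_derivable.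
      by rewrite exp_derive /GRing.scale/= mulr1 ?mulr_natl.
    exact: (@is_derive1_comp _ (fun t : R => t ^+ n) (fun t : R => t^-1)).
  have hE : is_derive u 1 (fun t : R => expR (- t^-1)) (expR (- u^-1) * - (- u ^- 2)).
    have h : is_derive u 1 (fun t : R => - t^-1) (- - u ^- 2) by exact: is_deriveN.
    exact: (@is_derive1_comp _ expR (fun t : R => - t^-1)).
  exact: is_derive_mul.
rewrite u0.
have -> : flatexp n.+2 0 - n%:R * flatexp n.+1 0 = 0 :> R.
  by rewrite /flatexp ltxx mulr0 subr0.
pose C : R := (n.+2)`!%:R.
have H : h^-1 *: (flatexp n (h *: 1 + 0) - flatexp n 0) @[h --> (0:R)^'] --> (0 : R).
  have f0 : flatexp n 0 = 0 :> R by rewrite /flatexp ltxx.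
  apply/cvgr0Pnorm_le => e e0; near=> h.
  have h0 : h != 0 by near: h; exact: nbhs_dnbhs_neq.
  rewrite f0 subr0 addr0 /GRing.scale/= mulr1 normrM normfV (ger0_norm (flatexp_ge0 _ _)).
  rewrite ler_pdivrMl ?normr_gt0//.
  apply: le_trans (flatexp_le _ _) _; rewrite -real_normK ?num_real// expr2 mulrA -/C mulrC.
  rewrite ler_wpM2l// mulrC -ler_pdivlMr ?ltr0n ?fact_gt0//; near: h.
  apply: dnbhs0_le; first by rewrite divr_gt0// ltr0n fact_gt0.
apply: DeriveDef; first by apply/cvg_ex; exists 0.
exact: cvg_lim H.
Unshelve. all: by end_near. Qed.

Definition coord (j : 'I_2) (x : plane R) : R := if j == 0 then x.1 else x.2.

(** A class of plane functions that contains every test function used below and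
    is closed under partial derivatives. Smoothness then needs no computation
    of higher derivatives. *)
Inductive elementary : (plane R -> R) -> Prop :=
| elementary_cst c : elementary (fun=> c)
| elementary_coord j : elementary (coord j)
| elementaryD f g : elementary f -> elementary g -> elementary (fun x => f x + g x)
| elementaryM f g : elementary f -> elementary g -> elementary (fun x => f x * g x)
| elementary_flatexp n f : elementary f -> elementary (fun x => flatexp n (f x))
| elementaryV f : elementary f -> (forall x, f x != 0) -> elementary (fun x => (f x)^-1)
| elementary_ln f : elementary f -> (forall x, 0 < f x) -> elementary (fun x => ln (f x)).

Lemma comp_diff (g : R -> R) (f : plane R -> R) (x : plane R) (dg : R) :
  is_derive (f x) 1 g dg -> differentiable (f : _ -> R^o) x ->
  differentiable ((fun y => g (f y)) : plane R -> R^o) x /\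
  forall j, pd j (fun y => g (f y)) x = dg * pd j f x.
Proof.
move=> hg hf.
have dgf : differentiable (g : R^o -> R^o) (f x).
  by apply/derivable1_diffP; exact: ex_derive.
split; first exact: (@differentiable_comp _ _ _ _ f g).
move=> j; rewrite /pd (deriveE _ (@differentiable_comp _ _ _ _ f g x hf dgf)).
rewrite (diff_comp hf dgf) /= (deriveE _ hf) (diff1E dgf) /= derive1E.
by rewrite derive_val /GRing.scale/= mulrC.
Qed.

Lemma pd_cst c j : pd j (fun=> c : R) = fun=> 0.
Proof. by apply/funext => x; rewrite /pd derive_cst. Qed.

Lemma coord_is_linear j : linear (coord j : plane R -> R^o).
Proof. by move=> k [a b] [c d]; rewrite /coord; case: (j == 0). Qed.

HB.instance Definition _ j :=
  GRing.isLinear.Build R (plane R) R^o _ (coord j : plane R -> R^o) (coord_is_linear j).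

Lemma continuous_coord j : continuous (coord j : plane R -> R).
Proof.
move=> x; rewrite /coord; case: (j == 0); first exact: cvg_fst.
exact: cvg_snd.
Qed.

Lemma diff_coord j (x : plane R) : differentiable (coord j : _ -> R^o) x.
Proof.
apply: (@linear_differentiable _ (plane R) R^o (coord j)); exact: continuous_coord.
Qed.

Lemma pd_coord i j : pd i (coord j) = fun=> (i == j)%:R.
Proof.
apply/funext => x; rewrite /pd (deriveE _ (diff_coord _ _)).
rewrite (@diff_lin _ (plane R) R^o (coord j)); last exact: continuous_coord.
by rewrite /coord /evec; case: i j => [[|[|//]] ?] [[|[|//]] ?].
Qed.

Lemma pdD (f g : plane R -> R) x j :
  differentiable (f : _ -> R^o) x -> differentiable (g : _ -> R^o) x ->
  pd j (fun x => f x + g x) x = pd j f x + pd j g x.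
Proof. by move=> hf hg; rewrite /pd; apply: deriveD; exact: diff_derivable. Qed.

Lemma pdM (f g : plane R -> R) x j :
  differentiable (f : _ -> R^o) x -> differentiable (g : _ -> R^o) x ->
  pd j (fun x => f x * g x) x = pd j f x * g x + f x * pd j g x.
Proof.
move=> /diff_derivable hf /diff_derivable hg; rewrite /pd.
rewrite (@deriveM _ _ f g)//= /GRing.scale/= addrC; congr (_ + _); exact: mulrC.
Qed.

Lemma elementary_diff f : elementary f -> forall x, differentiable (f : plane R -> R^o) x.
Proof.
elim=> {f} [c|j|f g _ hf _ hg|f g _ hf _ hg|n f _ hf|f _ hf f0|f _ hf f0] x.
- exact: differentiable_cst.
- exact: diff_coord.
- exact: (@differentiableD _ _ _ f g).
- exact: (@differentiableM _ _ f g).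
- by have [] := comp_diff (is_derive_flatexp n (f x)) (hf x).
- exact: (@differentiableV _ _ f).
- by have [] := comp_diff (is_derive1_ln (f0 x)) (hf x).
Qed.

Lemma is_derive_inv (u : R) : u != 0 -> is_derive u 1 (fun t : R => t^-1) (- u ^- 2).
Proof.
move=> u0; have := @is_deriveV R id u 1 1 u0 (is_derive_id _ _).
by rewrite /GRing.scale/= mulr1.
Qed.

Lemma elementary_pd f : elementary f -> forall j, elementary (pd j f).
Proof.
elim=> {f} [c|i|f g ef hf eg hg|f g ef hf eg hg|n f ef hf|f ef hf f0|f ef hf f0] j.
- by rewrite pd_cst; exact: elementary_cst.
- by rewrite pd_coord; exact: elementary_cst.
- have -> : pd j (fun x => f x + g x) = fun x => pd j f x + pd j g x.
    by apply/funext => x; rewrite pdD//; exact: elementary_diff.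
  exact: elementaryD.
- have -> : pd j (fun x => f x * g x) = fun x => pd j f x * g x + f x * pd j g x.
    by apply/funext => x; rewrite pdM//; exact: elementary_diff.
  by apply: elementaryD; exact: elementaryM.
- have -> : pd j (fun x => flatexp n (f x)) =
     fun x => (flatexp n.+2 (f x) + (- n%:R) * flatexp n.+1 (f x)) * pd j f x.
    apply/funext => x; have [_ ->] := comp_diff (is_derive_flatexp n (f x)) (elementary_diff ef x).
    by rewrite mulNr.
  apply: elementaryM (hf j); apply: elementaryD; first exact: elementary_flatexp.
  by apply: elementaryM; [exact: elementary_cst|exact: elementary_flatexp].
- have -> : pd j (fun x => (f x)^-1) =
     fun x => (-1) * ((f x)^-1 * (f x)^-1) * pd j f x.
    apply/funext => x; have [_ ->] := comp_diff (is_derive_inv (f0 x)) (elementary_diff ef x).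
    by rewrite mulN1r expr2 invfM.
  apply: elementaryM (hf j); apply: elementaryM; first exact: elementary_cst.
  by apply: elementaryM; exact: elementaryV.
- have -> : pd j (fun x => ln (f x)) = fun x => (f x)^-1 * pd j f x.
    by apply/funext => x; have [_ ->] := comp_diff (is_derive1_ln (f0 x)) (elementary_diff ef x).
  by apply: elementaryM (hf j); apply: elementaryV => // x; exact: lt0r_neq0.
Qed.

(** Each function of the class is differentiable and its partial derivatives
    stay in the class. *)
Lemma elementary_smooth f : elementary f -> smooth f.
Proof.
move=> ef s x; apply: elementary_diff.
by elim: s x => [|j s ih] _ //=; apply: elementary_pd; exact: ih (0, 0).
Qed.

Lemma box_closed (y : plane R) M : closed (box y M).
Proof. by apply: compact_closed; [exact: norm_hausdorff|exact: box_compact]. Qed.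

Lemma elementary_test f y M : elementary f -> (forall x, f x != 0 -> box y M x) -> test_fun f.
Proof.
move=> ef hf; split; first exact: elementary_smooth.
apply: (@subclosed_compact _ _ (box y M)).
- exact: closed_closure.
- exact: box_compact.
- rewrite (closure_id (box y M)).1; last exact: box_closed.
  exact: closure_subset.
Qed.

Lemma smooth_diff (f : plane R -> R) x : smooth f -> differentiable (f : _ -> R^o) x.
Proof. by move=> /(_ [::]). Qed.

Lemma diff_cont (f : plane R -> R) : (forall x, differentiable (f : _ -> R^o) x) -> continuous f.
Proof. by move=> hf x; exact: (differentiable_continuous (hf x)). Qed.

Lemma test_cont (f : plane R -> R) : test_fun f -> continuous f.
Proof. by move=> [sf _]; apply: diff_cont => x; exact: smooth_diff. Qed.

Lemma test_supp (f : plane R -> R) : test_fun f ->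
  exists2 M, 0 < M & forall x, f x != 0 -> box 0 M x.
Proof.
move=> [_ /compact_box[M M0 hM]]; exists M => // x fx.
by apply: hM; exact: subset_closure.
Qed.

Lemma cont_box_bounded (f : plane R -> R) M : continuous f ->
  (forall x, f x != 0 -> box 0 M x) -> exists2 C, 0 <= C & forall x, `|f x| <= C.
Proof.
move=> cf hM.
have [B [_ hB]] : bounded_set (f @` box 0 M).
  apply: compact_bounded; apply: continuous_compact; last exact: box_compact.
  exact: continuous_subspaceT.
exists (`|B| + 1); first by rewrite addr_ge0.
move=> x; have [->|fx] := eqVneq (f x) 0; first by rewrite normr0 addr_ge0.
apply: (hB (`|B| + 1)); first by rewrite (le_lt_trans (ler_norm _))// ltrDl.
by exists x => //; exact: hM.
Qed.

Lemma test_bound (f : plane R -> R) : test_fun f ->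
  exists2 C, 0 <= C & forall x, `|f x| <= C.
Proof.
by move=> tf; have [M _ hM] := test_supp tf; exact: cont_box_bounded (test_cont tf) hM.
Qed.

Lemma test_pd (f : plane R -> R) j : test_fun f -> test_fun (pd j f).
Proof.
move=> [sf cf]; split.
  by move=> s x; have := sf (rcons s j) x; rewrite -cats1 foldr_cat.
apply: (@subclosed_compact _ _ (closure [set x | f x != 0])) => //.
  exact: closed_closure.
rewrite [X in _ `<=` X](closure_id _).1; last exact: closed_closure.
apply: closure_subset.
move=> x /= hx; apply: contrapT => nx; move/negP: hx; apply; apply/eqP.
have : nbhs x (~` closure [set x | f x != 0]).
  by apply: open_nbhs_nbhs; split => //; apply: closed_openC; exact: closed_closure.
move=> hn; rewrite /pd (@near_eq_derive _ _ R^o f (cst 0)) ?derive_cst//.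
by apply: filterS hn => y /= ny; apply: contrapT => fy; apply: ny; apply: subset_closure; apply/eqP.
Qed.

End FlatExp.

(** * Test functions separate locally integrable functions *)

Section Fundamental. Context {R : realType}.

Definition open_rect (a b c d : R) : set (mplane R) := `]a, b[%classic `*` `]c, d[%classic.

Lemma open_rect_measurable a b c d : measurable (open_rect a b c d).
Proof. by apply: (@measurableX _ _ (measurableTypeR R) (measurableTypeR R)); exact: measurable_itv. Qed.

Definition open_rects : set (set (mplane R)) := [set A | exists a b c d, A = open_rect a b c d].

Lemma open_rectI a b c d a' b' c' d' : open_rect a b c d `&` open_rect a' b' c' d' =
  open_rect (Num.max a a') (Num.min b b') (Num.max c c') (Num.min d d').
Proof.
have h (s t u w : R) : `]Num.max s u, Num.min t w[%classic = `]s, t[%classic `&` `]u, w[%classic.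
  apply/seteqP; split => x /=; rewrite !in_itv/= gt_max lt_min.
    by move=> /andP[/andP[-> ->] /andP[-> ->]].
  by move=> [/andP[-> ->] /andP[-> ->]].
by rewrite /open_rect !h setXI.
Qed.

Lemma setI_closed_open_rects : setI_closed open_rects.
Proof.
move=> _ _ [a [b [c [d ->]]]] [a' [b' [c' [d' ->]]]].
by rewrite open_rectI; do 4 eexists.
Qed.

Lemma open_rects_generate : (measurable : set (set (mplane R))) `<=` <<s open_rects >>.
Proof.
pose T0 := g_sigma_algebraType open_rects.
have mT : forall a b c d, measurable (open_rect a b c d : set T0).
  by move=> a b c d; apply: sub_sigma_algebra; exists a, b, c, d.
have U (t : R) : exists n : nat, - n%:R < t < n%:R.
  exists (Num.truncn `|t|).+1; rewrite -ltr_norml; exact: truncnS_gt.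
have m1 : measurable_fun [set: T0] (fst : T0 -> measurableTypeR R).
  apply: (measurability _ (RGenOpens.measurableE R)) => _ [_ [a [b ->] <-]]; rewrite setTI.
  have -> : (fst : T0 -> measurableTypeR R) @^-1` `]a, b[%classic = \bigcup_(n : nat) (open_rect a b (- n%:R) n%:R).
    apply/seteqP; split => [[x y] /= xab|[x y] [n _ [//]]].
    by have [n hn] := U y; exists n => //; split => //=; rewrite in_itv.
  by apply: bigcupT_measurable => n; exact: mT.
have m2 : measurable_fun [set: T0] (snd : T0 -> measurableTypeR R).
  apply: (measurability _ (RGenOpens.measurableE R)) => _ [_ [a [b ->] <-]]; rewrite setTI.
  have -> : (snd : T0 -> measurableTypeR R) @^-1` `]a, b[%classic = \bigcup_(n : nat) (open_rect (- n%:R) n%:R a b).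
    apply/seteqP; split => [[x y] /= xab|[x y] [n _ [//]]].
    by have [n hn] := U x; exists n => //; split => //=; rewrite in_itv.
  by apply: bigcupT_measurable => n; exact: mT.
have mid := measurable_fun_pair m1 m2.
move=> E mE; have := mid measurableT E mE; rewrite setTI.
by congr (<<s open_rects >> _); apply/seteqP; split => -[].
Qed.

(** Open rectangles are stable under intersection and generate the Borel sets,
    so by Dynkin the signed measure of density h vanishes as soon as it
    vanishes on them. *)
Lemma integrable_open_rects0 (h : mplane R -> R) N : 0 < N ->
  (mu2 R).-integrable setT (EFin \o h) -> (forall x, ~ open_rect (-N) N (-N) N x -> h x = 0) ->
  (forall a b c d, (\int[mu2 R]_(x in open_rect a b c d) (EFin \o h) x = 0)%E) ->
  ae_eq (mu2 R) setT (EFin \o h) (cst 0%E).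
Proof.
move=> N0 ih hN h0; apply: integral_ae_eq => // E _ mE.
rewrite integral_cst// mul0e.
apply: (@dynkin_induction _ _ open_rects (fun E => (\int[mu2 R]_(x in E) (EFin \o h) x = 0)%E)).
- by apply/seteqP; split; [exact: open_rects_generate|apply: smallest_sub;
    [exact: sigma_algebra_measurable|move=> _ [a [b [c [d ->]]]]; exact: open_rect_measurable]].
- exact: setI_closed_open_rects.
- rewrite -[RHS](h0 (- N) N (- N) N) [RHS]integral_mkcond; apply: eq_integral => x _.
  by rewrite patchE; case: ifPn => // /negP; rewrite inE => /hN /= ->.
- by move=> _ [a [b [c [d ->]]]]; exact: h0.
- move=> S mS hS.
  have hT : (\int[mu2 R]_(x in setT) (EFin \o h) x = 0)%E.
    rewrite -[RHS](h0 (- N) N (- N) N) [RHS]integral_mkcond; apply: eq_integral => x _.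
    by rewrite patchE; case: ifPn => // /negP; rewrite inE => /hN /= ->.
  move: hT; rewrite -(setvU S) integral_setU//; last first.
  - by rewrite disj_set2E setICl.
  - by rewrite setvU; case/integrableP: ih.
  - exact: measurableC.
  by rewrite hS adde0.
- move=> F mF tF hF; rewrite integral_bigcup//.
    by rewrite eseries0.
  by apply: integrableS ih => //; exact: bigcupT_measurable.
- exact: open_rects_generate.
Qed.

Lemma flatexp_cvg (t : R) :
  flatexp 0 (n.+1%:R * t) @[n --> \oo] --> (if 0 < t then 1 else 0 : R).
Proof.
case: ifPn => t0; last first.
  rewrite (_ : (fun _ => _) = fun=> 0); first exact: cvg_cst.
  apply/funext => n; rewrite /flatexp ifF//; apply/negbTE.
  by rewrite pmulr_rgt0.
rewrite (_ : (fun _ => _) = fun n : nat => expR (- (n.+1%:R^-1 * t^-1))); last first.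
  by apply/funext => n; rewrite /flatexp pmulr_rgt0// t0 expr0 mul1r invfM.
rewrite -[X in _ --> X]expR0; apply: (cvg_comp (fun n : nat => - (n.+1%:R^-1 * t^-1)) expR _ (@continuous_expR R 0)).
have : - (n.+1%:R^-1 * t^-1) @[n --> \oo] --> - (0 * t^-1 : R).
  by apply: cvgN; apply: cvgM; [exact: cvg_harmonic|exact: cvg_cst].
by rewrite mul0r oppr0.
Qed.

Lemma flatexp_le1 (t : R) : flatexp 0 t <= 1.
Proof.
rewrite /flatexp; case: ifPn => // t0.
by rewrite expr0 mul1r expR_le1 oppr_le0 invr_ge0 ltW.
Qed.

(** Smooth functions that increase to the indicator of an open rectangle. *)
Definition rect_bump (a b c d : R) (n : nat) (x : plane R) : R :=
  flatexp 0 (n.+1%:R * (x.1 - a)) * flatexp 0 (n.+1%:R * (b - x.1)) *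
  (flatexp 0 (n.+1%:R * (x.2 - c)) * flatexp 0 (n.+1%:R * (d - x.2))).

Lemma rect_bump_ge0 a b c d n x : 0 <= rect_bump a b c d n x.
Proof. by rewrite /rect_bump !mulr_ge0 ?flatexp_ge0. Qed.

Lemma rect_bump_le1 a b c d n x : rect_bump a b c d n x <= 1.
Proof.
by rewrite /rect_bump; do 2?[apply: mulr_ile1; rewrite ?mulr_ge0 ?flatexp_ge0 ?flatexp_le1//].
Qed.

Lemma flatexp_neq0 (n : nat) (t : R) : flatexp 0 (n.+1%:R * t) != 0 -> 0 < t.
Proof.
rewrite /flatexp; case: ifPn; last by rewrite eqxx.
by rewrite pmulr_rgt0.
Qed.

Lemma rect_bump_supp a b c d n x : rect_bump a b c d n x != 0 -> open_rect a b c d x.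
Proof.
rewrite /rect_bump !mulf_eq0 !negb_or => /andP[/andP[/flatexp_neq0 h1 /flatexp_neq0 h2] /andP[/flatexp_neq0 h3 /flatexp_neq0 h4]].
by split; rewrite /= in_itv/=; apply/andP; split; rewrite -subr_gt0.
Qed.

Lemma elementary_rect_bump a b c d n : elementary (rect_bump a b c d n).
Proof.
have e1 (k l : R) (j : 'I_2) : elementary (fun x : plane R => flatexp 0 (n.+1%:R * (k * coord j x + l))).
  apply: elementary_flatexp; apply: elementaryM; first exact: elementary_cst.
  by apply: elementaryD; [apply: elementaryM; [exact: elementary_cst|exact: elementary_coord]|exact: elementary_cst].
have -> : rect_bump a b c d n = fun x =>
  flatexp 0 (n.+1%:R * (1 * coord 0 x + - a)) * flatexp 0 (n.+1%:R * (-1 * coord 0 x + b)) *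
  (flatexp 0 (n.+1%:R * (1 * coord 1 x + - c)) * flatexp 0 (n.+1%:R * (-1 * coord 1 x + d))).
  apply/funext => x; rewrite /rect_bump /coord /=.
  by rewrite !mul1r !mulN1r ![- _ + _]addrC.
by apply: elementaryM; apply: elementaryM; exact: e1.
Qed.

Lemma open_rect_box a b c d : open_rect a b c d `<=` box 0 (`|a| + `|b| + `|c| + `|d|).
Proof.
move=> x []; rewrite /= !in_itv/= => /andP[h1 h2] /andP[h3 h4].
apply/boxP; rewrite !subr0 !ler_norml; split; apply/andP; split;
have := ler_norm a; have := ler_norm b;have := ler_norm c; have := ler_norm d;
have := ler_norm (-a); have := ler_norm (-b);have := ler_norm (-c); have := ler_norm (-d);
rewrite !normrN;
have := normr_ge0 a; have := normr_ge0 b;have := normr_ge0 c; have := normr_ge0 d; lra.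
Qed.

Lemma rect_bump_test a b c d n : test_fun (rect_bump a b c d n).
Proof.
apply: elementary_test (elementary_rect_bump _ _ _ _ _) _ => x /rect_bump_supp/open_rect_box; exact.
Qed.

Lemma rect_bump_cvg a b c d x : rect_bump a b c d n x @[n --> \oo] --> (\1_(open_rect a b c d) x : R).
Proof.
have -> : \1_(open_rect a b c d) x = (if 0 < x.1 - a then 1 else 0) * (if 0 < b - x.1 then 1 else 0) *
   ((if 0 < x.2 - c then 1 else 0) * (if 0 < d - x.2 then 1 else 0)) :> R.
  rewrite indicE !subr_gt0.
  have -> : (x \in open_rect a b c d) = [&& a < x.1, x.1 < b, c < x.2 & x.2 < d].
    apply/idP/idP; first by rewrite inE /open_rect/= !in_itv/= => -[/andP[-> ->] /andP[-> ->]].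
    by move=> /and4P[? ? ? ?]; rewrite inE /open_rect/= !in_itv/=; split; apply/andP.
  move: (a < _) (_ < b) (c < _) (_ < d) => b1 b2 b3 b4.
  by case: b1; case: b2; case: b3; case: b4; rewrite /= ?(mulr0, mul0r, mulr1).
by apply: cvgM; apply: cvgM; exact: flatexp_cvg.
Qed.

(** Dominated convergence along the smooth approximations of the indicator. *)
Lemma test_fun_rect0 (h : plane R -> R) a b c d :
  measurable_fun [set: mplane R] h ->
  (forall N, (mu2 R).-integrable (box 0 N : set (mplane R)) (EFin \o h)) ->
  (forall chi, test_fun chi -> \int[mu2 R]_x (h x * chi x) = 0) ->
  (\int[mu2 R]_x (h x * \1_(open_rect a b c d) x)%:E = 0)%E.
Proof.
move=> mh ih h0.
pose K := `|a| + `|b| + `|c| + `|d|.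
pose g (x : mplane R) : \bar R := ((EFin \o (fun x => `|h x|)) \_ (box 0 K)) x.
have ig : (mu2 R).-integrable [set: mplane R] g.
  rewrite /g -integrable_mkcond; last exact: box_measurable.
  exact: integrable_norm.
have mb n : measurable_fun [set: mplane R] (fun x => h x * rect_bump a b c d n x).
  by apply: measurable_funM => //; apply: continuous_mplane; apply: test_cont; exact: rect_bump_test.
have hg n x : (`|(h x * rect_bump a b c d n x)%:E| <= g x)%E.
  rewrite /g patchE; case: ifPn => [_|].
    rewrite lee_fin normrM (ger0_norm (rect_bump_ge0 _ _ _ _ _ _)).
    by rewrite ler_piMr// rect_bump_le1.
  rewrite notin_setE => nb; have [->|/rect_bump_supp/open_rect_box//] := eqVneq (rect_bump a b c d n x) 0.
  by rewrite mulr0 abse0.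
have ib n : (mu2 R).-integrable [set: mplane R] (EFin \o (fun x => h x * rect_bump a b c d n x)).
  apply: le_integrable ig => //; first exact/measurable_EFinP.
  move=> x _; apply: le_trans (hg n x) _; exact: lee_abs.
have [|||||_ _] := @dominated_convergence _ _ _ (mu2 R) [set: mplane R] measurableT
  (fun n => EFin \o (fun x => h x * rect_bump a b c d n x))
  (EFin \o (fun x => h x * \1_(open_rect a b c d) x)) g.
- by move=> n; exact/measurable_EFinP.
- apply/measurable_EFinP; apply: measurable_funM => //; apply: measurable_indic; exact: open_rect_measurable.
- apply/aeW => x _; apply: cvg_EFin; first by near=> n.
  by apply: cvgM; [exact: cvg_cst|exact: rect_bump_cvg].
- exact: ig.
- by apply/aeW => x n _; exact: hg.
rewrite (_ : (fun _ => _) = fun=> 0%E) => [/cvg_lim <-//|].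
  by rewrite lim_cst.
apply/funext => n; have := h0 _ (rect_bump_test a b c d n); rewrite /Rintegral => hf.
by rewrite -[LHS]fineK ?hf//; exact: integrable_fin_num.
Unshelve. all: by end_near. Qed.

(** Cut to a large square, the function is integrable and has integral 0 on
    every open rectangle; then let the square grow. *)
Lemma test_fun_separating (h : plane R -> R) :
  measurable_fun [set: mplane R] h ->
  (forall N, (mu2 R).-integrable (box 0 N : set (mplane R)) (EFin \o h)) ->
  (forall chi, test_fun chi -> \int[mu2 R]_x (h x * chi x) = 0) ->
  {ae mu2 R, forall x, h x = 0}.
Proof.
move=> mh ih h0.
pose hN (N : nat) (x : mplane R) : R := h x * \1_(open_rect (- N.+1%:R) N.+1%:R (- N.+1%:R) N.+1%:R) x.
have mhN N : measurable_fun [set: mplane R] (hN N).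
  by apply: measurable_funM => //; apply: measurable_indic; exact: open_rect_measurable.
have ihN N : (mu2 R).-integrable setT (EFin \o hN N).
  have := ih (`|- N.+1%:R| + `|N.+1%:R| + `|- N.+1%:R| + `|N.+1%:R|).
  rewrite integrable_mkcond; last exact: box_measurable.
  apply: le_integrable => //; first exact/measurable_EFinP.
  move=> x _; rewrite patchE /comp /hN indicE.
  case: (boolP (x \in open_rect _ _ _ _)) => [|_]; last by rewrite mulr0 abse0 abse_ge0.
  rewrite inE => /open_rect_box xb; rewrite ifT; last by rewrite inE.
  by rewrite mulr1.
have z N : {ae mu2 R, forall x, hN N x = 0}.
  have : ae_eq (mu2 R) setT (EFin \o hN N) (cst 0%E).
    apply: (@integrable_open_rects0 _ N.+1%:R) => //.
      by move=> x; rewrite /hN indicE; case: (boolP (x \in _)); rewrite ?inE// mulr0.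
    move=> a b c d.
    pose a' := Num.max a (- N.+1%:R); pose b' := Num.min b N.+1%:R.
    pose c' := Num.max c (- N.+1%:R); pose d' := Num.min d N.+1%:R.
    have E x : \1_(open_rect a b c d) x * \1_(open_rect (- N.+1%:R) N.+1%:R (- N.+1%:R) N.+1%:R) x = \1_(open_rect a' b' c' d') x :> R.
      have -> : open_rect a' b' c' d' = open_rect a b c d `&` open_rect (- N.+1%:R) N.+1%:R (- N.+1%:R) N.+1%:R.
        by rewrite open_rectI.
      by rewrite indicI.
    rewrite integral_mkcond -[RHS](test_fun_rect0 a' b' c' d' mh ih h0).
    apply: eq_integral => x _; rewrite patchE -E /hN indicE /=.
    by case: ifPn => _; rewrite ?mul1r// mul0r mulr0.
  by apply: filterS => x /(_ Logic.I) [].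
have : {ae mu2 R, forall x, forall N, hN N x = 0} by apply: ae_foralln.
apply: filterS => x hx.
pose N := Num.truncn (`|x.1| + `|x.2|).
have := hx N; rewrite /hN indicE mem_set ?mulr1//.
have : `|x.1| + `|x.2| < N.+1%:R by exact: truncnS_gt.
move: (N.+1%:R) => K hK; split; rewrite /= in_itv/= -ltr_norml.
  by apply: le_lt_trans hK; rewrite lerDl.
by apply: le_lt_trans hK; rewrite lerDr.
Qed.

End Fundamental.

(** * The singular kernel and the polynomial weight *)

Section Kernel. Context {R : realType}.

Lemma mu2_le (f g : mplane R -> \bar R) :
  measurable_fun [set: mplane R] f -> measurable_fun [set: mplane R] g ->
  (forall x, 0 <= f x)%E -> (forall x, f x <= g x)%E ->
  (\int[mu2 R]_x f x <= \int[mu2 R]_x g x)%E.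
Proof.
move=> mf mg f0 fg; exact: ge0_le_integral.
Qed.

(** Compare f with the sum over n of a_n times the indicator of a square of
    radius r_n, and sum the geometric series. Squares replace discs because
    their measure is a product of lengths. *)
Lemma dyadic_integral_le (f : mplane R -> R) y (a r : nat -> R) (C z : R) :
  measurable_fun [set: mplane R] f -> (forall x, 0 <= f x) ->
  (forall n, 0 <= a n) -> (forall n, 0 <= r n) -> 0 <= z < 1 ->
  (forall n, a n * (2 * r n) ^+ 2 <= C * z ^+ n) ->
  (forall x, f x != 0 -> exists n, box y (r n) x /\ f x <= a n) ->
  (\int[mu2 R]_x (f x)%:E <= (C / (1 - z))%:E)%E.
Proof.
move=> mf f0 a0 r0 /andP[z0 z1] aC fa.
pose g n (x : mplane R) : \bar R := (a n * \1_(box y (r n)) x)%:E.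
have g0 n x : (0 <= g n x)%E by rewrite lee_fin mulr_ge0.
have mg n : measurable_fun [set: mplane R] (g n).
  apply/measurable_EFinP; apply: measurable_funM => //; apply: measurable_indic; exact: box_measurable.
apply: (@le_trans _ _ (\int[mu2 R]_x (\sum_(n <oo) g n x)%E)%E).
  have mF : measurable_fun [set: mplane R] (EFin \o f) by exact/measurable_EFinP.
  have sg0 x : (0 <= \sum_(n <oo) g n x)%E by apply: nneseries_ge0 => *; exact: g0.
  have msg : measurable_fun [set: mplane R] (fun x => \sum_(n <oo) g n x)%E.
    by apply: ge0_emeasurable_sum => *; first [exact: mg|exact: g0].
  apply: mu2_le => // x; have [->|/fa[n [bx fx]]] := eqVneq (f x) 0; first exact: sg0.
  apply: le_trans (@nneseries_lim_ge _ (g ^~ x) xpredT 0 n.+1 _); last by move=> *; exact: g0.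
  rewrite big_nat_recr//= -[leLHS]add0e leeD//; first exact: sume_ge0.
  by rewrite /g indicE mem_set// mulr1 lee_fin.
rewrite integral_nneseries//.
have ig n : (\int[mu2 R]_x g n x = (a n * (2 * r n) ^+ 2)%:E)%E.
  rewrite /g; under eq_integral do rewrite EFinM.
  rewrite ge0_integralZl_EFin//; last first.
    by apply/measurable_EFinP; apply: measurable_indic; exact: box_measurable.
  by rewrite integral_indic ?setIT ?mu2_box -?EFinM//; exact: box_measurable.
apply: (@le_trans _ _ (\sum_(n <oo) (C * z ^+ n)%:E)%E).
  by apply: lee_nneseries => n _; rewrite ?ig ?lee_fin ?mulr_ge0 ?sqr_ge0.
have : (fun n => (\sum_(0 <= i < n) (C * z ^+ i)%:E)%E) @ \oo --> (C / (1 - z))%:E.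
  under eq_fun do rewrite sumEFin.
  apply: cvg_EFin; first by near=> n.
  have := @cvg_geometric_series _ C z; rewrite ger0_norm// => /(_ z1).
  exact.
by move=> /cvg_lim ->.
Unshelve. all: by end_near. Qed.

(** The kernel 1/|u| is used in the powers 1/2, 1 and 3/2, which are the powers
    1, 2 and 3 of its square root. The value at 0 is 0. *)
Definition invroot (u : plane R) : R := Num.sqrt (enorm u)^-1.

Lemma invroot_ge0 u : 0 <= invroot u. Proof. exact: sqrtr_ge0. Qed.

Lemma enorm_ge0 (u : plane R) : 0 <= enorm u. Proof. exact: sqrtr_ge0. Qed.

Lemma enorm_ge_fst (u : plane R) : `|u.1| <= enorm u.
Proof. by rewrite -sqrtr_sqr /enorm ler_wsqrtr// lerDl sqr_ge0. Qed.

Lemma enorm_ge_snd (u : plane R) : `|u.2| <= enorm u.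
Proof. by rewrite -sqrtr_sqr /enorm ler_wsqrtr// lerDr sqr_ge0. Qed.

Lemma enorm_sqr (u : plane R) : enorm u ^+ 2 = u.1 ^+ 2 + u.2 ^+ 2.
Proof. by rewrite sqr_sqrtr// addr_ge0 ?sqr_ge0. Qed.

Lemma enorm_le (u : plane R) : enorm u <= `|u.1| + `|u.2|.
Proof.
rewrite -(@ler_pXn2r _ 2) ?nnegrE ?enorm_ge0 ?addr_ge0//.
rewrite enorm_sqr -(real_normK (num_real u.1)) -(real_normK (num_real u.2)).
have := normr_ge0 u.1; have := normr_ge0 u.2; nra.
Qed.

Lemma enormN (u : plane R) : enorm (- u) = enorm u.
Proof. by rewrite /enorm /= !sqrrN. Qed.

Lemma enormB (u w : plane R) : enorm (u - w) = enorm (w - u).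
Proof. by rewrite -enormN opprB. Qed.

Lemma invrootB (u w : plane R) : invroot (u - w) = invroot (w - u).
Proof. by rewrite /invroot enormB. Qed.

Lemma invroot_sqr u : invroot u ^+ 2 = (enorm u)^-1.
Proof. by rewrite sqr_sqrtr// invr_ge0 enorm_ge0. Qed.

Lemma measurable_enorm : measurable_fun [set: mplane R] (@enorm R).
Proof.
apply: (@measurableT_comp _ _ _ _ _ _ (@Num.sqrt R)).
  by apply: continuous_measurable_fun; exact: sqrt_continuous.
apply: measurable_funD; apply: measurable_funX.
  exact: measurable_fst.
exact: measurable_snd.
Qed.

Lemma measurable_inv : measurable_fun [set: R] (fun t : R => t^-1).
Proof.
have -> : (fun t : R => t^-1) = fun t => t * (`|t| `^ (-1)) ^+ 2.
  apply/funext => t; rewrite powR_inv1// exprVn real_normK ?num_real//.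
  by have [->|t0] := eqVneq t 0; [rewrite invr0 mul0r|field].
apply: measurable_funM => //; apply: measurable_funX.
apply: (@measurableT_comp _ _ _ _ _ _ (fun t : R => t `^ (-1))) => //; exact: measurable_powR.
Qed.

Lemma measurable_invroot : measurable_fun [set: mplane R] invroot.
Proof.
apply: (@measurableT_comp _ _ _ _ _ _ (@Num.sqrt R)).
  by apply: continuous_measurable_fun; exact: sqrt_continuous.
apply: (@measurableT_comp _ _ _ _ _ _ (fun t : R => t^-1)); first exact: measurable_inv.
exact: measurable_enorm.
Qed.

Lemma measurable_sub2 : measurable_fun [set: mplane R * mplane R] (fun z : mplane R * mplane R => (z.1 - z.2 : mplane R)).
Proof.
apply: measurable_fun_pair => /=; apply: measurable_funB.
- exact: (measurableT_comp (@measurable_fst _ _ (measurableTypeR R) (measurableTypeR R)) measurable_fst).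
- exact: (measurableT_comp (@measurable_fst _ _ (measurableTypeR R) (measurableTypeR R)) measurable_snd).
- exact: (measurableT_comp (@measurable_snd _ _ (measurableTypeR R) (measurableTypeR R)) measurable_fst).
- exact: (measurableT_comp (@measurable_snd _ _ (measurableTypeR R) (measurableTypeR R)) measurable_snd).
Qed.

Lemma measurable_ker (k : mplane R -> R) : measurable_fun [set: mplane R] k ->
  measurable_fun [set: mplane R * mplane R] (fun z : mplane R * mplane R => k (z.1 - z.2)).
Proof. by move=> mk; apply: (measurableT_comp mk); exact: measurable_sub2. Qed.

Lemma measurable_shift (k : mplane R -> R) x : measurable_fun [set: mplane R] k ->
  measurable_fun [set: mplane R] (fun y : mplane R => k (x - y)).
Proof.
by move=> mk; exact: (measurableT_comp (measurable_ker mk) (pair1_measurable (x : mplane R))).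
Qed.

Lemma measurable_shift' (k : mplane R -> R) x : measurable_fun [set: mplane R] k ->
  measurable_fun [set: mplane R] (fun y : mplane R => k (y - x)).
Proof.
by move=> mk; exact: (measurableT_comp (measurable_ker mk) (pair2_measurable (x : mplane R))).
Qed.

(** The ratio 1/4 makes the power 3/2 of the radii rational. *)
Lemma dyadic_small (t : R) : 0 < t -> t <= 1 ->
  exists n : nat, 4^-1 ^+ n.+1 < t /\ t <= 4^-1 ^+ n.
Proof.
move=> t0 t1.
have ex : exists n : nat, 4^-1 ^+ n.+1 < t.
  exists (Num.truncn t^-1); rewrite exprVn invf_plt ?posrE ?exprn_gt0//.
  apply: lt_le_trans (truncnS_gt _) _.
  elim: (Num.truncn _).+1 => // n ih; rewrite exprS -natr1.
  have : 1 <= 4 ^+ n :> R by rewrite exprn_ege1// ler1n.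
  move: ih; lra.
case: (ex_minnP ex) => n hn hmin; exists n; split => //.
case: n hn hmin => [|n] hn hmin; first by rewrite expr0.
by rewrite leNgt; apply/negP => /hmin; rewrite ltnn.
Qed.

(** The power -3/2 is integrable near 0 in dimension two. On the shell where
    |u| is about 4^(-n) it is at most 8^(n+1), while the square of radius
    4^(-n) has area 4 16^(-n): the terms 32 2^(-n) add up to 64. *)
Lemma invroot3_local x :
  (\int[mu2 R]_y (invroot (x - y) ^+ 3 * \1_(box x 1) y)%:E <= 64%:E)%E.
Proof.
have -> : (64 : R) = 32 / (1 - 2^-1) by field.
apply: (@dyadic_integral_le _ x (fun n => 8 ^+ n.+1) (fun n => 4^-1 ^+ n)).
- apply: measurable_funM; last by apply: measurable_indic; exact: box_measurable.
  by apply: measurable_funX; apply: measurable_shift; exact: measurable_invroot.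
- by move=> y; rewrite mulr_ge0// exprn_ge0// invroot_ge0.
- by move=> n; rewrite exprn_ge0.
- by move=> n; rewrite exprn_ge0// invr_ge0.
- by apply/andP; split; lra.
- move=> n; rewrite (_ : 2^-1 = 8 * 4^-1 ^+ 2 :> R); last by field.
  rewrite [(8 * _) ^+ n]exprMn [(4^-1 ^+ 2) ^+ n]exprAC exprS.
  by rewrite le_eqVlt; apply/orP; left; apply/eqP; ring.
- move=> y; rewrite mulf_eq0 negb_or indicE pnatr_eq0 eqb0 negbK => /andP[hr].
  rewrite inE => /boxP[b1 b2].
  pose t := Num.max `|y.1 - x.1| `|y.2 - x.2|.
  have te : t <= enorm (x - y).
    by rewrite ge_max; apply/andP; split; rewrite distrC; [exact: (enorm_ge_fst (x - y))|exact: (enorm_ge_snd (x - y))].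
  have et : enorm (x - y) <= t + t.
    apply: le_trans (enorm_le _) _; rewrite /= distrC [`|x.2 - _|]distrC.
    by rewrite lerD// le_max lexx ?orbT.
  have t0 : 0 < t.
    rewrite ltNge; apply: contra hr => t0; have : enorm (x - y) = 0.
      by apply/eqP; rewrite eq_le enorm_ge0 andbT (le_trans et)// -[leRHS]addr0 lerD.
    by rewrite /invroot => ->; rewrite invr0 sqrtr0 expr0n.
  have t1 : t <= 1 by rewrite ge_max b1.
  have [n [n1 n2]] := dyadic_small t0 t1.
  exists n; split.
    by apply/boxP; split; apply: le_trans n2; rewrite le_max lexx ?orbT.
  rewrite mem_set ?mulr1; last exact/boxP.
  have -> : 8 ^+ n.+1 = (2 ^+ n.+1) ^+ 3 :> R.
    by rewrite -exprM mulnC exprM; congr (_ ^+ _); ring.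
  rewrite lerXn2r ?nnegrE ?invroot_ge0 ?exprn_ge0//.
  rewrite -(@ler_pXn2r _ 2) ?nnegrE ?invroot_ge0 ?exprn_ge0// invroot_sqr.
  have -> : (2 ^+ n.+1) ^+ 2 = (4^-1 ^+ n.+1)^-1 :> R.
    by rewrite -exprM mulnC exprM exprVn invrK; congr (_ ^+ _); ring.
  have h0 : 0 < 4^-1 ^+ n.+1 :> R by rewrite exprn_gt0// invr_gt0.
  have h1 := lt_le_trans n1 te.
  by rewrite lef_pV2 ?posrE ?h0 ?(lt_trans h0 h1)// ltW.
Qed.

Lemma japanese_ge1 (y : plane R) : 1 <= japanese y.
Proof. by rewrite -[leLHS]sqrtr1 ler_wsqrtr// lerDl sqr_ge0. Qed.

Lemma japanese_ge (y : plane R) : enorm y <= japanese y.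
Proof. by rewrite -[leLHS]ger0_norm ?enorm_ge0// -sqrtr_sqr ler_wsqrtr// lerDr. Qed.

Lemma japanese_le (y : plane R) : japanese y <= 1 + enorm y.
Proof.
rewrite -(@ler_pXn2r _ 2) ?nnegrE ?addr_ge0 ?enorm_ge0 ?sqrtr_ge0//.
by rewrite sqr_sqrtr ?addr_ge0 ?sqr_ge0//; have := enorm_ge0 y; nra.
Qed.

Lemma measurable_japanese : measurable_fun [set: mplane R] (@japanese R).
Proof.
apply: (@measurableT_comp _ _ _ _ _ _ (@Num.sqrt R)).
  by apply: continuous_measurable_fun; exact: sqrt_continuous.
by apply: measurable_funD => //; apply: measurable_funX; exact: measurable_enorm.
Qed.

Definition weight (e : R) (y : plane R) : R := japanese y `^ (- 2 - e).

Lemma weight_ge0 e y : 0 <= weight e y. Proof. exact: powR_ge0. Qed.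

Lemma weight_le1 e y : 0 <= e -> weight e y <= 1.
Proof.
move=> e0; rewrite /weight -[leRHS](powRr0 (japanese y)); apply: ler_powR.
  exact: japanese_ge1.
lra.
Qed.

Lemma measurable_weight e : measurable_fun [set: mplane R] (weight e).
Proof.
apply: (@measurableT_comp _ _ _ _ _ _ (fun t : R => t `^ (- 2 - e))); last exact: measurable_japanese.
exact: measurable_powR.
Qed.

Lemma dyadic_large (t : R) : exists n : nat, t <= 2 ^+ n /\ (n = 0%N \/ 2 ^+ n / 2 < t).
Proof.
have ex : exists n : nat, t <= 2 ^+ n.
  exists (Num.truncn t).+1; apply: le_trans (ltW (truncnS_gt _)) _.
  elim: (Num.truncn _).+1 => // n ih; rewrite exprS -natr1.
  have : 1 <= 2 ^+ n :> R by rewrite exprn_ege1// ler1n.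
  move: ih; lra.
case: (ex_minnP ex) => n hn hmin; exists n; split => //.
case: n hn hmin => [|n] hn hmin; [by left|right].
rewrite exprS mulrAC divff// mul1r ltNge; apply/negP => /hmin.
by rewrite ltnn.
Qed.

(** On the shell of radius 2^n the weight times the area is of order 2^(-e n).
    *)
Lemma weight_integral e : 0 < e -> exists2 M : R, 0 <= M & (\int[mu2 R]_y (weight e y)%:E <= M%:E)%E.
Proof.
move=> e0; pose z : R := 2 `^ (- e); pose C : R := 16 * 2^-1 `^ (- e).
have z01 : 0 <= z < 1.
  rewrite powR_ge0/= /z /powR gt_eqF// expR_lt1 nmulr_rlt0 ?oppr_lt0//.
  by rewrite ln_gt0// ltr1n.
exists (C / (1 - z)).
  by rewrite divr_ge0 ?mulr_ge0 ?powR_ge0// subr_ge0 ltW//; case/andP: z01.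
apply: (@dyadic_integral_le _ 0 (fun n => (2 ^+ n / 2) `^ (- 2 - e)) (fun n => 2 ^+ n)) => //.
- exact: measurable_weight.
- by move=> y; exact: weight_ge0.
- move=> n; set u : R := 2 ^+ n / 2.
  have u0 : 0 < u by rewrite divr_gt0// exprn_gt0.
  have -> : 2 * 2 ^+ n = 4 * u by rewrite /u; field.
  have -> : u `^ (- 2 - e) = u ^- 2 * u `^ (- e).
    by rewrite powRD ?lt0r_neq0 ?implybT// -(@powR_inv1 _ (u^+2)) ?sqr_ge0// -powR_mulrn ?ltW// -powRrM mulrN1.
  have -> : u `^ (- e) = z ^+ n * 2^-1 `^ (- e).
    rewrite /u powRM ?exprn_ge0 ?invr_ge0//; congr (_ * _).
    by rewrite -(powR_mulrn n (ler0n _ 2)) -(powR_mulrn n (powR_ge0 2 (- e))) -!powRrM mulrC.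
  rewrite /C le_eqVlt; apply/orP; left; apply/eqP; field; exact: lt0r_neq0.
move=> y _; have [n [n1 n2]] := dyadic_large (Num.max `|y.1| `|y.2|).
exists n; split.
  by apply/boxP; rewrite !subr0; split; apply: le_trans n1; rewrite le_max lexx ?orbT.
rewrite /weight.
have hu : 2 ^+ n / 2 <= japanese y.
  case: n2 => [->|/ltW n2]; first by apply: le_trans (japanese_ge1 y); rewrite expr0; lra.
  apply: le_trans n2 (le_trans _ (japanese_ge y)).
  by rewrite ge_max enorm_ge_fst enorm_ge_snd.
have h0 : 0 < 2 ^+ n / 2 :> R by rewrite divr_gt0// exprn_gt0.
have h1 := lt_le_trans h0 hu.
rewrite (_ : - 2 - e = - (2 + e)); last by ring.
rewrite !powRN lef_pV2 ?posrE ?powR_gt0//.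
by apply: ge0_ler_powR => //; rewrite ?nnegrE ?ltW// addr_gt0.
Qed.

(** Away from x the cube is at most 1; near x the weight is. *)
Lemma invroot3_weight_le e x y : 0 <= e ->
  invroot (x - y) ^+ 3 * weight e y <= invroot (x - y) ^+ 3 * \1_(box x 1) y + weight e y.
Proof.
move=> e0; rewrite indicE; case: (boolP (y \in box x 1)) => [_|].
  rewrite mulr1; apply: ler_wpDr; first exact: weight_ge0.
  by rewrite ler_piMr ?exprn_ge0 ?invroot_ge0 ?weight_le1.
rewrite mulr0 add0r notin_setE => nb; rewrite ler_piMl ?weight_ge0// exprn_ile1 ?invroot_ge0//.
have e1 : 1 <= enorm (x - y).
  rewrite leNgt; apply/negP => h; apply: nb; apply/boxP.
  rewrite distrC [`|y.2 - _|]distrC.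
  have := enorm_ge_fst (x - y); have := enorm_ge_snd (x - y) => /= h2 h1.
  by split; apply: ltW; [apply: le_lt_trans h1 h|apply: le_lt_trans h2 h].
by rewrite -[leRHS]sqrtr1 ler_wsqrtr// invf_le1// (lt_le_trans ltr01).
Qed.

Lemma invroot3_weight_integral e : 0 < e -> exists2 M : R, 0 <= M &
  forall x, (\int[mu2 R]_y (invroot (x - y) ^+ 3 * weight e y)%:E <= M%:E)%E.
Proof.
move=> e0; have [M M0 hM] := weight_integral e0; exists (64 + M); first exact: addr_ge0.
have mr x : measurable_fun [set: mplane R] (fun y => invroot (x - y) ^+ 3).
  by apply: measurable_funX; apply: measurable_shift; exact: measurable_invroot.
move=> x; apply: (@le_trans _ _ (\int[mu2 R]_y ((invroot (x - y) ^+ 3 * \1_(box x 1) y)%:E + (weight e y)%:E)%E)%E).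
  apply: mu2_le.
  - by apply/measurable_EFinP; apply: measurable_funM => //; exact: measurable_weight.
  - apply: emeasurable_funD; apply/measurable_EFinP; last exact: measurable_weight.
    by apply: measurable_funM => //; apply: measurable_indic; exact: box_measurable.
  - by move=> y; rewrite lee_fin mulr_ge0 ?exprn_ge0 ?invroot_ge0 ?weight_ge0.
  - by move=> y; rewrite -EFinD lee_fin invroot3_weight_le// ltW.
rewrite ge0_integralD//.
- by rewrite EFinD leeD// invroot3_local.
- by move=> y _; rewrite lee_fin mulr_ge0 ?exprn_ge0 ?invroot_ge0.
- apply/measurable_EFinP; apply: measurable_funM => //; apply: measurable_indic; exact: box_measurable.
- by move=> y _; rewrite lee_fin weight_ge0.
- by apply/measurable_EFinP; exact: measurable_weight.
Qed.

End Kernel.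

(** * Pairing complex functions with real kernels *)

Notation L1 f := ((mu2 _).-integrable [set: mplane _] (EFin \o f)).

Section Pairing. Context {R : realType}.
Implicit Types (f g : plane R -> R[i]) (k : mplane R -> R).

Lemma ae_imp (A B : plane R -> Prop) : (forall x, A x -> B x) ->
  {ae mu2 R, forall x, A x} -> {ae mu2 R, forall x, B x}.
Proof. by move=> AB; apply: (@filterS (mplane R) (almost_everywhere (mu2 R)) _). Qed.

Lemma ae_imp2 (A B C : plane R -> Prop) : (forall x, A x -> B x -> C x) ->
  {ae mu2 R, forall x, A x} -> {ae mu2 R, forall x, B x} -> {ae mu2 R, forall x, C x}.
Proof. by move=> ABC; apply: (@filterS2 (mplane R) (almost_everywhere (mu2 R)) _). Qed.

Lemma cmodE (z : R[i]) : cmod z = Num.sqrt (complex.Re z ^+ 2 + complex.Im z ^+ 2).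
Proof. by case: z. Qed.

Lemma cmod_ge0 (z : R[i]) : 0 <= cmod z.
Proof. by rewrite cmodE sqrtr_ge0. Qed.

Lemma cmodD (z w : R[i]) : cmod (z + w) <= cmod z + cmod w.
Proof. exact: (@le_normcD R z w). Qed.

Lemma cmodM (z w : R[i]) : cmod (z * w) = cmod z * cmod w.
Proof. exact: ComplexField.Normc.normcM. Qed.

Lemma cmodN (z : R[i]) : cmod (- z) = cmod z.
Proof. exact: (@normcN R z). Qed.

Lemma cmodC (r : R) : cmod r%:C = `|r|.
Proof. by rewrite cmodE /= expr0n addr0 sqrtr_sqr. Qed.

Lemma cmod0 : cmod (0 : R[i]) = 0.
Proof. exact: ComplexField.Normc.normc0. Qed.

Lemma Re_cmod (z : R[i]) : `|complex.Re z| <= cmod z.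
Proof. by rewrite cmodE -sqrtr_sqr ler_wsqrtr// lerDl sqr_ge0. Qed.

Lemma Im_cmod (z : R[i]) : `|complex.Im z| <= cmod z.
Proof. by rewrite cmodE -sqrtr_sqr ler_wsqrtr// lerDr sqr_ge0. Qed.

Lemma cmod_le (z : R[i]) : cmod z <= `|complex.Re z| + `|complex.Im z|.
Proof.
have h := @addr_ge0 _ _ _ (normr_ge0 (complex.Re z)) (normr_ge0 (complex.Im z)).
rewrite -[leRHS]ger0_norm// cmodE -sqrtr_sqr ler_wsqrtr//.
rewrite -(real_normK (num_real (complex.Re z))) -(real_normK (num_real (complex.Im z))).
have := normr_ge0 (complex.Re z); have := normr_ge0 (complex.Im z); nra.
Qed.

Lemma Re_mulC (z : R[i]) (r : R) : complex.Re (z * r%:C) = complex.Re z * r.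
Proof. by case: z => a b /=; rewrite mulr0 subr0. Qed.

Lemma Im_mulC (z : R[i]) (r : R) : complex.Im (z * r%:C) = complex.Im z * r.
Proof. by case: z => a b /=; rewrite mulr0 add0r. Qed.

Lemma ReD (z w : R[i]) : complex.Re (z + w) = complex.Re z + complex.Re w.
Proof. by case: z; case: w. Qed.

Lemma ImD (z w : R[i]) : complex.Im (z + w) = complex.Im z + complex.Im w.
Proof. by case: z; case: w. Qed.

Lemma ReM (z w : R[i]) : complex.Re (z * w) = complex.Re z * complex.Re w - complex.Im z * complex.Im w.
Proof. by case: z; case: w. Qed.

Lemma ImM (z w : R[i]) : complex.Im (z * w) = complex.Re z * complex.Im w + complex.Im z * complex.Re w.
Proof. by case: z; case: w. Qed.

Lemma complex_ext (z w : R[i]) : complex.Re z = complex.Re w -> complex.Im z = complex.Im w -> z = w.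
Proof. by case: z => a b; case: w => c d /= -> ->. Qed.

Lemma measurable_cmod f : cmeasurable f -> measurable_fun [set: mplane R] (fun x => cmod (f x)).
Proof.
move=> [m1 m2]; rewrite (_ : (fun _ => _) = fun x => Num.sqrt (complex.Re (f x) ^+ 2 + complex.Im (f x) ^+ 2)); last first.
  by apply/funext => x; rewrite cmodE.
apply: (@measurableT_comp _ _ _ _ _ _ (@Num.sqrt R)).
  by apply: continuous_measurable_fun; exact: sqrt_continuous.
by apply: measurable_funD; apply: measurable_funX.
Qed.

Lemma distE f k : dist f k =
  (\int[mu2 R]_x (complex.Re (f x) * k x)) +i* (\int[mu2 R]_x (complex.Im (f x) * k x)).
Proof.
rewrite /dist /cint; congr (_ +i* _); apply: eq_Rintegral => x _.
  exact: Re_mulC.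
exact: Im_mulC.
Qed.

(** The integral in [dist] takes a conventional value when it diverges;
    absolute convergence makes the pairing additive. *)
Definition pairable f k := [/\ cmeasurable f, measurable_fun [set: mplane R] k &
  (\int[mu2 R]_x (cmod (f x) * `|k x|)%:E < +oo)%E].

Lemma L1P (h : mplane R -> R) : L1 h <-> measurable_fun [set: mplane R] h /\ (\int[mu2 R]_x (`|h x|)%:E < +oo)%E.
Proof.
split; first by move=> /integrableP[/measurable_EFinP mh lt]; split.
by move=> [mh lt]; apply/integrableP; split => //; exact/measurable_EFinP.
Qed.

Lemma L1_le (h H : mplane R -> R) : measurable_fun [set: mplane R] h -> (forall x, `|h x| <= H x) -> L1 H -> L1 h.
Proof.
move=> mh hH; apply: le_integrable => //; first exact/measurable_EFinP.
by move=> x _; rewrite /= lee_fin (le_trans (hH x))// ler_norm.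
Qed.

Lemma pairable_L1 f k : pairable f k -> L1 (fun x => cmod (f x) * `|k x|).
Proof.
move=> [mf mk lt]; apply/L1P; split.
  by apply: measurable_funM; [exact: measurable_cmod|exact: measurableT_comp].
by under eq_integral do rewrite ger0_norm ?mulr_ge0 ?cmod_ge0//.
Qed.

Lemma pairable_Re f k : pairable f k -> L1 (fun x => complex.Re (f x) * k x).
Proof.
move=> h; have [[m1 m2] mk _] := h; apply: L1_le (pairable_L1 h); first exact: measurable_funM.
by move=> x; rewrite normrM ler_wpM2r// Re_cmod.
Qed.

Lemma pairable_Im f k : pairable f k -> L1 (fun x => complex.Im (f x) * k x).
Proof.
move=> h; have [[m1 m2] mk _] := h; apply: L1_le (pairable_L1 h); first exact: measurable_funM.
by move=> x; rewrite normrM ler_wpM2r// Im_cmod.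
Qed.

Lemma L1_pairable f k : cmeasurable f -> measurable_fun [set: mplane R] k ->
  L1 (fun x => cmod (f x) * k x) -> pairable f k.
Proof.
move=> mf mk /L1P[_ h]; split => //; apply: le_lt_trans h.
rewrite le_eqVlt; apply/orP; left; apply/eqP; apply: eq_integral => x _.
by rewrite normrM (ger0_norm (cmod_ge0 _)).
Qed.

Lemma pairable_le f k K : pairable f K -> measurable_fun [set: mplane R] k -> (forall x, `|k x| <= `|K x|) -> pairable f k.
Proof.
move=> h mk kK; have [mf mK _] := h; apply: L1_pairable => //; apply: L1_le (pairable_L1 h).
  by apply: measurable_funM => //; exact: measurable_cmod.
by move=> x; rewrite normrM (ger0_norm (cmod_ge0 _)) ler_wpM2l ?cmod_ge0.
Qed.

Lemma L1D (h h' : mplane R -> R) : L1 h -> L1 h' -> L1 (fun x => h x + h' x).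
Proof. by move=> a b; apply: (integrableD measurableT a b). Qed.

Lemma L1Z (a : R) (h : mplane R -> R) : L1 h -> L1 (fun x => a * h x).
Proof. by move=> ih; have := integrableZl measurableT a ih; apply: eq_integrable. Qed.

Lemma pairableD f k k' : pairable f k -> pairable f k' -> pairable f (fun x => k x + k' x).
Proof.
move=> h h'; have [mf mk _] := h; have [_ mk' _] := h'; apply: L1_pairable => //.
  exact: measurable_funD.
apply: L1_le (L1D (pairable_L1 h) (pairable_L1 h')).
  by apply: measurable_funM; [exact: measurable_cmod|exact: measurable_funD].
by move=> x; rewrite normrM (ger0_norm (cmod_ge0 _)) -mulrDr ler_wpM2l ?cmod_ge0// ler_normD.
Qed.

Lemma pairableZ f k a : pairable f k -> pairable f (fun x => a * k x).
Proof.
move=> h; have [mf mk _] := h; apply: L1_pairable => //; first exact: measurable_funM.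
apply: L1_le (L1Z `|a| (pairable_L1 h)).
  by apply: measurable_funM; [exact: measurable_cmod|exact: measurable_funM].
by move=> x; rewrite !normrM (ger0_norm (cmod_ge0 _)) mulrCA.
Qed.

Lemma distD f k k' : pairable f k -> pairable f k' -> dist f (fun x => k x + k' x) = dist f k + dist f k'.
Proof.
move=> h h'; rewrite !distE; apply: complex_ext => /=; rewrite -RintegralD//;
  try exact: pairable_Re; try exact: pairable_Im; by apply: eq_Rintegral => x _; rewrite mulrDr.
Qed.

Lemma distZ f k a : pairable f k -> dist f (fun x => a * k x) = a%:C * dist f k.
Proof.
move=> h; rewrite !distE; apply: complex_ext => /=; rewrite ?mul0r ?subr0 ?addr0 -RintegralZl//;
  try exact: pairable_Re; try exact: pairable_Im; by apply: eq_Rintegral => x _; rewrite mulrCA.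
Qed.

Lemma dist_ext f k k' : k =1 k' -> dist f k = dist f k'.
Proof. by move=> /funext ->. Qed.

Lemma dist_ae f g k : cmeasurable f -> cmeasurable g -> measurable_fun [set: mplane R] k ->
  {ae mu2 R, forall x, f x = g x} -> dist f k = dist g k.
Proof.
move=> [mf mf'] [mg mg'] mk fg; rewrite !distE; congr (_ +i* _); rewrite /Rintegral; congr fine;
  apply: ae_eq_integral => //; try (by apply/measurable_EFinP; exact: measurable_funM);
  by apply: ae_imp fg => x /= -> _.
Qed.

(** The factor 2 comes from bounding the modulus by the sum of the moduli of
    the real and imaginary parts. *)
Lemma dist_bound f k : pairable f k ->
  ((cmod (dist f k))%:E <= 2%:E * \int[mu2 R]_x (cmod (f x) * `|k x|)%:E)%E.
Proof.
move=> h; have ih := pairable_L1 h.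
have fin : (\int[mu2 R]_x (cmod (f x) * `|k x|)%:E)%E \is a fin_num by exact: integrable_fin_num ih.
rewrite -(fineK fin) -EFinM lee_fin.
apply: le_trans (cmod_le _) _; rewrite distE /= mulr2n mulrDl mul1r lerD//.
- apply: le_trans (le_normr_Rintegral measurableT (pairable_Re h)) _.
  apply: le_Rintegral => //; first exact: integrable_norm (pairable_Re h).
  by move=> x _; rewrite normrM ler_wpM2r// Re_cmod.
- apply: le_trans (le_normr_Rintegral measurableT (pairable_Im h)) _.
  apply: le_Rintegral => //; first exact: integrable_norm (pairable_Im h).
  by move=> x _; rewrite normrM ler_wpM2r// Im_cmod.
Qed.

Definition cvgC (u : nat -> R[i]) (l : R[i]) :=
  (fun n => complex.Re (u n)) @ \oo --> complex.Re l /\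
  (fun n => complex.Im (u n)) @ \oo --> complex.Im l.

Lemma cvgC_unique u l l' : cvgC u l -> cvgC u l' -> l = l'.
Proof.
move=> [a b] [a' b']; apply: complex_ext.
  by rewrite -(cvg_lim (@Rhausdorff R) a) -(cvg_lim (@Rhausdorff R) a').
by rewrite -(cvg_lim (@Rhausdorff R) b) -(cvg_lim (@Rhausdorff R) b').
Qed.

Lemma cvgCD u w l l' : cvgC u l -> cvgC w l' -> cvgC (fun n => u n + w n) (l + l').
Proof.
move=> [a b] [a' b']; split.
  by rewrite ReD; under eq_fun do rewrite ReD; exact: cvgD.
by rewrite ImD; under eq_fun do rewrite ImD; exact: cvgD.
Qed.

Lemma cvgCZ u l (z : R[i]) : cvgC u l -> cvgC (fun n => z * u n) (z * l).
Proof.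
move=> [a b]; split.
  by rewrite ReM; under eq_fun do rewrite ReM; apply: cvgB; apply: cvgM => //; exact: cvg_cst.
by rewrite ImM; under eq_fun do rewrite ImM; apply: cvgD; apply: cvgM => //; exact: cvg_cst.
Qed.

Lemma cvgC_cst l : cvgC (fun=> l) l.
Proof. by split; exact: cvg_cst. Qed.

Lemma Rdominated_cvg (h_ : nat -> mplane R -> R) (h H : mplane R -> R) :
  (forall n, measurable_fun [set: mplane R] (h_ n)) -> measurable_fun [set: mplane R] h ->
  {ae mu2 R, forall x, (fun n => h_ n x) @ \oo --> h x} ->
  {ae mu2 R, forall x, forall n, `|h_ n x| <= H x} -> L1 H ->
  (fun n => \int[mu2 R]_x h_ n x) @ \oo --> \int[mu2 R]_x h x.
Proof.
move=> mh_ mh ch bh iH.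
have [|||||ih _ hc] := @dominated_convergence _ _ _ (mu2 R) [set: mplane R] measurableT
  (fun n => EFin \o h_ n) (EFin \o h) (EFin \o H).
- by move=> n; exact/measurable_EFinP.
- exact/measurable_EFinP.
- by apply: ae_imp ch => x hx _; apply: cvg_EFin => //; near=> n.
- exact: iH.
- by apply: ae_imp bh => x hx n _; rewrite /= lee_fin.
apply: fine_cvg; rewrite fineK; first exact: hc.
exact: integrable_fin_num ih.
Unshelve. all: by end_near. Qed.

Lemma dist_cvg f (k_ : nat -> mplane R -> R) k K :
  (forall n, measurable_fun [set: mplane R] (k_ n)) -> measurable_fun [set: mplane R] k ->
  {ae mu2 R, forall x, (fun n => k_ n x) @ \oo --> k x} ->
  {ae mu2 R, forall x, forall n, `|k_ n x| <= K x} -> pairable f K ->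
  cvgC (fun n => dist f (k_ n)) (dist f k).
Proof.
move=> mk_ mk ck bk h; have [[m1 m2] mK _] := h.
split.
  rewrite (_ : (fun n => _) = fun n => \int[mu2 R]_x (complex.Re (f x) * k_ n x)); last first.
    by apply/funext => n; rewrite distE.
  rewrite distE; apply: (Rdominated_cvg _ _ _ _ (pairable_L1 h)).
  - by move=> n; exact: measurable_funM.
  - exact: measurable_funM.
  - by apply: ae_imp ck => x hx; apply: cvgM => //; exact: cvg_cst.
  - apply: ae_imp bk => x hx n; rewrite normrM ler_pM// ?Re_cmod//.
    exact: le_trans (hx n) (ler_norm _).
rewrite (_ : (fun n => _) = fun n => \int[mu2 R]_x (complex.Im (f x) * k_ n x)); last first.
  by apply/funext => n; rewrite distE.
rewrite distE; apply: (Rdominated_cvg _ _ _ _ (pairable_L1 h)).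
- by move=> n; exact: measurable_funM.
- exact: measurable_funM.
- by apply: ae_imp ck => x hx; apply: cvgM => //; exact: cvg_cst.
- apply: ae_imp bk => x hx n; rewrite normrM ler_pM// ?Im_cmod//.
  exact: le_trans (hx n) (ler_norm _).
Qed.

End Pairing.

Section PairingFubini. Context {R : realType}.
Implicit Types (f g : plane R -> R[i]) (k : mplane R -> R).

Lemma L1_norm (h : mplane R -> R) : L1 h -> L1 (fun x => `|h x|).
Proof.
move=> /L1P[mh lt]; apply/L1P; split; first exact: measurableT_comp.
by under eq_integral do rewrite normr_id.
Qed.

Lemma cmeasurableD f g : cmeasurable f -> cmeasurable g -> cmeasurable (fun x => f x + g x).
Proof.
move=> [a b] [a' b']; split.
  by under eq_fun do rewrite ReD; exact: measurable_funD.
by under eq_fun do rewrite ImD; exact: measurable_funD.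
Qed.

Lemma cmeasurableM f g : cmeasurable f -> cmeasurable g -> cmeasurable (fun x => f x * g x).
Proof.
move=> [a b] [a' b']; split.
  by under eq_fun do rewrite ReM; apply: measurable_funB; exact: measurable_funM.
by under eq_fun do rewrite ImM; apply: measurable_funD; exact: measurable_funM.
Qed.

Lemma cmeasurable_cst (z : R[i]) : cmeasurable (fun=> z).
Proof. by split; exact: measurable_cst. Qed.

Lemma cmeasurableZ f z : cmeasurable f -> cmeasurable (fun x => z * f x).
Proof. by move=> mf; apply: cmeasurableM => //; exact: cmeasurable_cst. Qed.

Lemma pairableDf f g k : pairable f k -> pairable g k -> pairable (fun x => f x + g x) k.
Proof.
move=> h h'; have [mf mk _] := h; have [mg _ _] := h'.
have mfg := cmeasurableD mf mg; split => //.
suff /L1P[_] : L1 (fun x => cmod (f x + g x) * `|k x|).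
  by under eq_integral do rewrite ger0_norm ?mulr_ge0 ?cmod_ge0//.
apply: L1_le (L1D (pairable_L1 h) (pairable_L1 h')).
  by apply: measurable_funM; [exact: measurable_cmod|exact: measurableT_comp].
by move=> x; rewrite ger0_norm ?mulr_ge0 ?cmod_ge0// -mulrDl ler_wpM2r// cmodD.
Qed.

Lemma pairableZf f k z : pairable f k -> pairable (fun x => z * f x) k.
Proof.
move=> h; have [mf mk _] := h; have mz := cmeasurableZ z mf; split => //.
suff /L1P[_] : L1 (fun x => cmod (z * f x) * `|k x|).
  by under eq_integral do rewrite ger0_norm ?mulr_ge0 ?cmod_ge0//.
apply: L1_le (L1Z (cmod z) (pairable_L1 h)).
  by apply: measurable_funM; [exact: measurable_cmod|exact: measurableT_comp].
by move=> x; rewrite ger0_norm ?mulr_ge0 ?cmod_ge0// cmodM mulrA.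
Qed.

Lemma distDf f g k : pairable f k -> pairable g k -> dist (fun x => f x + g x) k = dist f k + dist g k.
Proof.
move=> h h'; rewrite !distE; apply: complex_ext => /=; rewrite -RintegralD//;
  try exact: pairable_Re; try exact: pairable_Im; apply: eq_Rintegral => x _.
  by rewrite ReD mulrDl.
by rewrite ImD mulrDl.
Qed.

Lemma distZf f k z : pairable f k -> dist (fun x => z * f x) k = z * dist f k.
Proof.
move=> h; rewrite !distE; apply: complex_ext => /=.
  rewrite ReM /= -!RintegralZl//; [|exact: pairable_Im|exact: pairable_Re].
  rewrite -RintegralB//; [|exact: L1Z (pairable_Re h)|exact: L1Z (pairable_Im h)].
  by apply: eq_Rintegral => x _; rewrite ReM; ring.
rewrite ImM /= -!RintegralZl//; [|exact: pairable_Re|exact: pairable_Im].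
rewrite -RintegralD//; [|exact: L1Z (pairable_Im h)|exact: L1Z (pairable_Re h)].
by apply: eq_Rintegral => x _; rewrite ImM; ring.
Qed.

Lemma measurable_tonelli (F : mplane R * mplane R -> \bar R) : measurable_fun [set: mplane R * mplane R] F ->
  (forall z, 0 <= F z)%E -> measurable_fun [set: mplane R] (fun x => \int[mu2 R]_y F (x, y))%E.
Proof. by move=> mF F0; rewrite mu2E; exact: (@measurable_fun_fubini_tonelli_F _ _ _ _ _ leb2 F mF F0). Qed.

Lemma measurable_tonelli' (F : mplane R * mplane R -> \bar R) : measurable_fun [set: mplane R * mplane R] F ->
  (forall z, 0 <= F z)%E -> measurable_fun [set: mplane R] (fun y => \int[mu2 R]_x F (x, y))%E.
Proof. by move=> mF F0; rewrite mu2E; exact: (@measurable_fun_fubini_tonelli_G _ _ _ _ _ leb2 F mF F0). Qed.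

Lemma measurable_Rint (F : mplane R * mplane R -> R) : measurable_fun [set: mplane R * mplane R] F ->
  measurable_fun [set: mplane R] (fun x => \int[mu2 R]_y F (x, y)).
Proof.
move=> mF.
have mF' : measurable_fun [set: mplane R * mplane R] (fun z => (F z)%:E) by exact/measurable_EFinP.
have mp : measurable_fun [set: mplane R * mplane R] (fun z => maxe (F z)%:E 0%E) by apply: measurable_maxe.
have mn : measurable_fun [set: mplane R * mplane R] (fun z => maxe (- (F z)%:E)%E 0%E).
  by apply: measurable_maxe => //; exact: measurableT_comp.
have m0 (t : \bar R) : (0 <= maxe t 0)%E by rewrite le_max lexx orbT.
have hp := measurable_tonelli mp (fun z => m0 _).
have hn := measurable_tonelli mn (fun z => m0 _).
have h : measurable_fun [set: mplane R] (fun x => \int[mu2 R]_y (F (x, y))%:E)%E.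
  have := emeasurable_funB hp hn.
  congr (measurable_fun _ _); apply/funext => x; rewrite [RHS]integralE.
  by congr (_ - _)%E; apply: eq_integral => y _; rewrite ?funeposE ?funenegE.
exact (measurableT_comp (@fine_measurable _ [set: \bar R] measurableT) h).
Qed.

(** Holds without integrability because the finite part of an undefined
    integral is 0 by convention on both sides. *)
Lemma RintegralZl_total (a : R) (h : mplane R -> R) : measurable_fun [set: mplane R] h ->
  \int[mu2 R]_x (a * h x) = a * \int[mu2 R]_x h x.
Proof.
move=> mh; have [->|a0] := eqVneq a 0.
  under eq_Rintegral do rewrite mul0r.
  by rewrite mul0r /Rintegral integral0.
have [lt|nlt] := boolP (\int[mu2 R]_x `|(h x)%:E| < +oo)%E.
  by rewrite RintegralZl//; apply/L1P.
have nig : ~~ (\int[mu2 R]_x `|(a * h x)%:E| < +oo)%E.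
  apply: contra nlt => lt.
  have : L1 (fun x => a^-1 * (a * h x)).
    by apply: L1Z; apply/L1P; split => //; exact: measurable_funM.
  by move=> /L1P[_]; under eq_integral do rewrite mulKf//.
have z (H : mplane R -> R) : measurable_fun [set: mplane R] H -> ~~ (\int[mu2 R]_x `|(H x)%:E| < +oo)%E ->
  \int[mu2 R]_x H x = 0.
  move=> mH; rewrite integral_fin_num_abs// /Rintegral.
  by case: (integral _ _ _).
by rewrite !z// ?mulr0//; exact: measurable_funM.
Qed.

Lemma ae_fineK (G : mplane R -> \bar R) : (mu2 R).-integrable [set: mplane R] G ->
  {ae mu2 R, forall x, G x = (fine (G x))%:E}.
Proof.
move=> iG; have := integrable_ae measurableT iG.
by apply: ae_imp => x /(_ Logic.I) h; rewrite fineK.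
Qed.

(** The finite part of the inner integral agrees with it almost everywhere,
    which allows real-valued inner integrals in the Fubini theorem. *)
Lemma fubini_slices_L1 (F : mplane R * mplane R -> R) : measurable_fun [set: mplane R * mplane R] F ->
  (\int[mu2 R]_x \int[mu2 R]_y (`|F (x, y)|)%:E < +oo)%E ->
  (mu2 R).-integrable [set: mplane R] (fun x => \int[mu2 R]_y (F (x, y))%:E)%E /\
  L1 (fun x => \int[mu2 R]_y F (x, y)).
Proof.
move=> mF lt.
have mF' : measurable_fun [set: mplane R * mplane R] (EFin \o F) by exact/measurable_EFinP.
have i1 : (mu2 R).-integrable [set: mplane R] (fun x => \int[mu2 R]_y (F (x, y))%:E)%E.
  have iF : (leb2 \x leb2)%E.-integrable [set: mplane R * mplane R] (EFin \o F).
    by apply/(@integrable12ltyP _ _ _ _ _ leb2 leb2).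
  rewrite mu2E; exact (@integrable_fubini_F _ _ _ _ _ leb2 leb2 (EFin \o F) iF).
split => //; have mR := measurable_Rint mF.
apply: le_integrable i1 => //; first exact/measurable_EFinP.
move=> x _ /=; rewrite /Rintegral.
by case: (\int[mu2 R]_y _)%E => //= ; rewrite normr0 leey.
Qed.

Lemma RFubini (F : mplane R * mplane R -> R) : measurable_fun [set: mplane R * mplane R] F ->
  (\int[mu2 R]_y \int[mu2 R]_x (`|F (x, y)|)%:E < +oo)%E ->
  [/\ L1 (fun x => \int[mu2 R]_y F (x, y)), L1 (fun y => \int[mu2 R]_x F (x, y)) &
   \int[mu2 R]_x \int[mu2 R]_y F (x, y) = \int[mu2 R]_y \int[mu2 R]_x F (x, y)].
Proof.
move=> mF lt.
have mF' : measurable_fun [set: mplane R * mplane R] (EFin \o F) by exact/measurable_EFinP.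
have iF : (leb2 \x leb2)%E.-integrable [set: mplane R * mplane R] (EFin \o F).
  by apply/(@integrable21ltyP _ _ _ _ _ leb2 leb2).
have [i1 j1] : (mu2 R).-integrable [set: mplane R] (fun x => \int[mu2 R]_y (F (x, y))%:E)%E /\
  L1 (fun x => \int[mu2 R]_y F (x, y)).
  apply: fubini_slices_L1 => //; rewrite (@tonelli2 _ (fun z => (`|F z|)%:E))//.
  by apply/measurable_EFinP; exact: measurableT_comp.
have [i2 j2] : (mu2 R).-integrable [set: mplane R] (fun y => \int[mu2 R]_x (F (x, y))%:E)%E /\
  L1 (fun y => \int[mu2 R]_x F (x, y)).
  apply: (@fubini_slices_L1 (fun z => F (z.2, z.1))) => //.
  exact: (measurableT_comp mF (measurable_fun_pair (@measurable_snd _ _ (mplane R) (mplane R)) (@measurable_fst _ _ (mplane R) (mplane R)))).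
split => //.
rewrite {1}/Rintegral [RHS]/Rintegral; congr fine.
transitivity (\int[mu2 R]_x \int[mu2 R]_y (F (x, y))%:E)%E.
  apply: ae_eq_integral => //; [by case/integrableP: j1|by case/integrableP: i1|].
  by apply: ae_imp (ae_fineK i1) => x hx _; rewrite hx.
transitivity (\int[mu2 R]_y \int[mu2 R]_x (F (x, y))%:E)%E.
  rewrite mu2E; exact: (@Fubini _ _ _ _ _ leb2 leb2 _ iF).
apply: ae_eq_integral => //; [by case/integrableP: i2|by case/integrableP: j2|].
by apply: ae_imp (ae_fineK i2) => x hx _; rewrite {1}hx.
Qed.

Lemma dist_measurable f (K : mplane R * mplane R -> R) : cmeasurable f -> measurable_fun [set: mplane R * mplane R] K ->
  cmeasurable (fun x => dist f (fun y => K (x, y))).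
Proof.
move=> [m1 m2] mK; split.
  under eq_fun do rewrite distE /=.
  apply: (@measurable_Rint (fun z => complex.Re (f z.2) * K z)).
  by apply: measurable_funM => //; exact: (measurableT_comp m1 measurable_snd).
under eq_fun do rewrite distE /=.
apply: (@measurable_Rint (fun z => complex.Im (f z.2) * K z)).
by apply: measurable_funM => //; exact: (measurableT_comp m2 measurable_snd).
Qed.

(** The bound Phi controls the inner integral in x uniformly enough that
    pairing |f| with it gives absolute convergence of the double integral. *)
Lemma dist_fubini f (chi : mplane R -> R) (K : mplane R * mplane R -> R) (Phi : mplane R -> R) :
  measurable_fun [set: mplane R] chi -> measurable_fun [set: mplane R * mplane R] K ->
  (forall y, (\int[mu2 R]_x (`|chi x * K (x, y)|)%:E <= (Phi y)%:E)%E) -> pairable f Phi ->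
  [/\ pairable (fun x => dist f (fun y => K (x, y))) chi,
      pairable f (fun y => \int[mu2 R]_x (chi x * K (x, y))) &
      dist (fun x => dist f (fun y => K (x, y))) chi = dist f (fun y => \int[mu2 R]_x (chi x * K (x, y)))].
Proof.
move=> mchi mK hPhi hf; have [mf mPhi _] := hf; have [m1 m2] := mf.
have mF : measurable_fun [set: mplane R * mplane R] (fun z => chi z.1 * K z).
  by apply: measurable_funM => //; exact: (measurableT_comp mchi measurable_fst).
have mc := measurable_cmod mf.
have mcF (h : mplane R -> R) : measurable_fun [set: mplane R] h ->
    measurable_fun [set: mplane R * mplane R] (fun z => h z.2 * (chi z.1 * K z)).
  by move=> mh; apply: measurable_funM => //; exact: (measurableT_comp mh measurable_snd).
have Phi0 y : 0 <= Phi y.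
  by rewrite -lee_fin; apply: le_trans (hPhi y); apply: integral_ge0 => x _; rewrite lee_fin.
have mA (h : mplane R -> R) : measurable_fun [set: mplane R] h ->
    measurable_fun [set: mplane R * mplane R] (fun z => (`|h z.2 * (chi z.1 * K z)|)%:E).
  by move=> mh; apply/measurable_EFinP; apply: measurableT_comp => //; exact: mcF.
have lt (h : mplane R -> R) : measurable_fun [set: mplane R] h -> (forall y, `|h y| <= cmod (f y)) ->
  (\int[mu2 R]_y \int[mu2 R]_x (`|h y * (chi x * K (x, y))|)%:E < +oo)%E.
  move=> mh hh; have [_ _] := hf; apply: le_lt_trans; apply: mu2_le.
  - exact: (@measurable_tonelli' (fun z => (`|h z.2 * (chi z.1 * K z)|)%:E) (mA h mh)).
  - by apply/measurable_EFinP; apply: measurable_funM => //; exact: measurableT_comp.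
  - by move=> y; apply: integral_ge0 => x _; rewrite lee_fin.
  - move=> y; under eq_integral do rewrite normrM EFinM.
    rewrite ge0_integralZl_EFin//; last first.
      apply/measurable_EFinP; apply: measurableT_comp => //.
      exact: (measurableT_comp mF (pair2_measurable (y : mplane R))).
    rewrite (ger0_norm (Phi0 y)) EFinM; apply: lee_pmul; rewrite ?lee_fin//.
    by apply: integral_ge0 => x _; rewrite lee_fin.
have key (h : mplane R -> R) : measurable_fun [set: mplane R] h -> (forall y, `|h y| <= cmod (f y)) ->
  [/\ L1 (fun x => (\int[mu2 R]_y (h y * K (x, y))) * chi x),
      L1 (fun y => h y * \int[mu2 R]_x (chi x * K (x, y))) &
      \int[mu2 R]_x ((\int[mu2 R]_y (h y * K (x, y))) * chi x) =
      \int[mu2 R]_y (h y * \int[mu2 R]_x (chi x * K (x, y)))].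
  move=> mh hh; have [j1 j2 e] := RFubini (mcF h mh) (lt h mh hh).
  have m1x x : measurable_fun [set: mplane R] (fun y => h y * K (x, y)).
    by apply: measurable_funM => //; exact: (measurableT_comp mK (pair1_measurable (x : mplane R))).
  have m2y y : measurable_fun [set: mplane R] (fun x => chi x * K (x, y)).
    exact: (measurableT_comp mF (pair2_measurable (y : mplane R))).
  have e1 : (fun x => \int[mu2 R]_y (h y * (chi x * K (x, y)))) = fun x => (\int[mu2 R]_y (h y * K (x, y))) * chi x.
    apply/funext => x; rewrite mulrC -RintegralZl_total//; apply: eq_Rintegral => y _; exact: mulrCA.
  have e2 : (fun y => \int[mu2 R]_x (h y * (chi x * K (x, y)))) = fun y => h y * \int[mu2 R]_x (chi x * K (x, y)).
    by apply/funext => y; rewrite RintegralZl_total.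
  by rewrite -e1 -e2.
have [i1 i2 e1] := key _ m1 (fun y => Re_cmod (f y)).
have [i3 i4 e2] := key _ m2 (fun y => Im_cmod (f y)).
have mD := dist_measurable mf mK.
have mI : measurable_fun [set: mplane R] (fun y => \int[mu2 R]_x (chi x * K (x, y))).
  have := @measurable_Rint (fun z => chi z.2 * K (z.2, z.1)); apply.
  exact: (measurableT_comp mF (measurable_fun_pair (@measurable_snd _ _ (mplane R) (mplane R)) (@measurable_fst _ _ (mplane R) (mplane R)))).
have bd (g : plane R -> R[i]) (k : mplane R -> R) : cmeasurable g -> measurable_fun [set: mplane R] k ->
  L1 (fun x => complex.Re (g x) * k x) -> L1 (fun x => complex.Im (g x) * k x) -> pairable g k.
  move=> mg mk j1 j2; split => //.
  suff /L1P[_] : L1 (fun x => cmod (g x) * `|k x|).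
    by under eq_integral do rewrite ger0_norm ?mulr_ge0 ?cmod_ge0//.
  apply: L1_le (L1D (L1_norm j1) (L1_norm j2)).
    by apply: measurable_funM; [exact: measurable_cmod|exact: measurableT_comp].
  by move=> x; rewrite ger0_norm ?mulr_ge0 ?cmod_ge0// !normrM -mulrDl ler_wpM2r// cmod_le.
split.
- by apply: bd => //; under eq_fun do rewrite distE /=.
- exact: bd.
- rewrite distE [RHS]distE; congr (_ +i* _).
    by rewrite -e1; apply: eq_Rintegral => x _; rewrite distE.
  by rewrite -e2; apply: eq_Rintegral => x _; rewrite distE.
Qed.

End PairingFubini.

(** * Potentials of sources with two moments *)

Section Potential. Context {R : realType}.
Implicit Types (f g : plane R -> R[i]) (kap : mplane R -> R).

(** One majorant for both kernels: 1/|u| is its first term, and |ln|u|| is at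
    most 1/|u| + |u|. Up to constants it also bounds their regularisations at
    all radii d <= 1. *)
Definition ker_majorant (u : plane R) : R := invroot u ^+ 2 + 1 + enorm u.

Lemma ker_majorant_ge0 u : 0 <= ker_majorant u.
Proof. by rewrite /ker_majorant !addr_ge0 ?sqr_ge0 ?enorm_ge0. Qed.

Lemma measurable_ker_majorant : measurable_fun [set: mplane R] ker_majorant.
Proof.
apply: measurable_funD; last exact: measurable_enorm.
by apply: measurable_funD => //; apply: measurable_funX; exact: measurable_invroot.
Qed.

Lemma enormD (u v : plane R) : enorm (u + v) <= enorm u + enorm v.
Proof.
have eu := enorm_ge0 u; have ev := enorm_ge0 v.
rewrite -(@ler_pXn2r _ 2%N) ?nnegrE ?enorm_ge0 ?addr_ge0//.
rewrite sqrrD !enorm_sqr /=.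
suff : u.1 * v.1 + u.2 * v.2 <= enorm u * enorm v by move=> h; nra.
have [h|/ltW h] := leP (u.1 * v.1 + u.2 * v.2) 0; first by rewrite (le_trans h)// mulr_ge0.
rewrite -(@ler_pXn2r _ 2%N) ?nnegrE ?mulr_ge0//.
rewrite exprMn !enorm_sqr -subr_ge0.
by rewrite [X in 0 <= X](_ : _ = (u.1 * v.2 - u.2 * v.1) ^+ 2); [exact: sqr_ge0|ring].
Qed.

Lemma invroot_sqr_le (x y : plane R) : invroot (x - y) ^+ 2 <= invroot (y - x) ^+ 3 * \1_(box y 1) x + 1.
Proof.
rewrite invrootB; have r0 := invroot_ge0 (y - x); rewrite indicE.
case: (boolP (x \in box y 1)) => [_|].
  rewrite mulr1; move: (invroot _) r0 => r r0; have r30 : 0 <= r ^+ 3 by rewrite exprn_ge0.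
  have [r1|r1] := leP r 1; first by have := exprn_ile1 2 r0 r1; lra.
  have : 0 <= r ^+ 2 * (r - 1) by rewrite mulr_ge0 ?sqr_ge0// subr_ge0 ltW.
  by rewrite mulrBr mulr1 -exprSr; lra.
rewrite mulr0 add0r notin_setE => nb; rewrite exprn_ile1//.
have e1 : 1 <= enorm (y - x).
  rewrite leNgt; apply/negP => h; apply: nb; apply/boxP.
  rewrite distrC [`|x.2 - _|]distrC.
  have := enorm_ge_fst (y - x); have := enorm_ge_snd (y - x) => /= h2 h1.
  by split; apply: ltW; [apply: le_lt_trans h1 h|apply: le_lt_trans h2 h].
by rewrite -[leRHS]sqrtr1 ler_wsqrtr// invf_le1// (lt_le_trans ltr01).
Qed.

(** Averaged over a bounded set of x, the singularity disappears and only
    linear growth in y remains, which one moment of the source absorbs. *)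
Lemma ker_majorant_box N : 0 <= N -> exists2 C, 0 <= C & forall y,
  (\int[mu2 R]_x (ker_majorant (x - y) * \1_(box 0 N) x)%:E <= (C * (1 + enorm y))%:E)%E.
Proof.
move=> N0; exists (64 + (2 + 4 * N + 2) * (2 * N) ^+ 2).
  by rewrite addr_ge0// mulr_ge0 ?sqr_ge0//; lra.
move=> y; have ey := enorm_ge0 y.
pose c : R := 2 + 4 * N + 2 * enorm y.
have c0 : 0 <= c by rewrite /c; lra.
have mb (z : plane R) (M : R) : measurable_fun [set: mplane R] (\1_(box z M) : mplane R -> R).
  by apply: measurable_indic; exact: box_measurable.
have mM : measurable_fun [set: mplane R] (fun x => ker_majorant (x - y)).
  by apply: measurable_shift'; exact: measurable_ker_majorant.
have mr : measurable_fun [set: mplane R] (fun x => invroot (y - x) ^+ 3).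
  by apply: measurable_funX; apply: measurable_shift; exact: measurable_invroot.
apply: (@le_trans _ _ (\int[mu2 R]_x ((invroot (y - x) ^+ 3 * \1_(box y 1) x)%:E + (c * \1_(box 0 N) x)%:E)%E)%E).
  apply: mu2_le.
  - by apply/measurable_EFinP; exact: measurable_funM.
  - by apply: emeasurable_funD; apply/measurable_EFinP; apply: measurable_funM.
  - by move=> x; rewrite lee_fin mulr_ge0 ?ker_majorant_ge0.
  - move=> x; rewrite -EFinD lee_fin; have [bx|nbx] := pselect (box 0 N x); last first.
      rewrite (_ : \1_(box 0 N) x = 0); last by rewrite indicE memNset.
      by rewrite !mulr0 addr0 mulr_ge0 ?exprn_ge0 ?invroot_ge0.
    rewrite (_ : \1_(box 0 N) x = 1); last by rewrite indicE mem_set.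
    rewrite !mulr1 /ker_majorant /c; have := invroot_sqr_le x y.
    have : enorm (x - y) <= 4 * N + 2 * enorm y; last by lra.
    have := enormD x (- y); rewrite enormN.
    have := enorm_le x; move/boxP : bx; rewrite !subr0 => -[]; lra.
rewrite ge0_integralD//; last 4 first.
- by move=> x _; rewrite lee_fin mulr_ge0 ?exprn_ge0 ?invroot_ge0.
- by apply/measurable_EFinP; exact: measurable_funM.
- by move=> x _; rewrite lee_fin mulr_ge0.
- by apply/measurable_EFinP; exact: measurable_funM.
under [X in (_ + X <= _)%E]eq_integral do rewrite EFinM.
rewrite ge0_integralZl_EFin//; last by apply/measurable_EFinP; exact: mb.
have -> : (\int[mu2 R]_x (\1_(box 0 N) x : R)%:E = ((2 * N) ^+ 2)%:E)%E.
  by rewrite integral_indic ?setIT ?mu2_box//; exact: box_measurable.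
rewrite -EFinM.
apply: le_trans (leeD (invroot3_local y) (le_refl _)) _; rewrite -EFinD lee_fin /c.
move: ((2 * N) ^+ 2) (sqr_ge0 (2 * N)) => Q Q0.
rewrite [leRHS]mulrDl; have : 0 <= N * Q by rewrite mulr_ge0.
have : 0 <= Q * enorm y by rewrite mulr_ge0.
have : 0 <= N * Q * enorm y by rewrite !mulr_ge0.
nra.
Qed.

(** Two moments are assumed since one is lost to the growth of the kernels and
    the other to the weight 1 + |x| in the decay estimates. *)
Definition moment2 f := pairable f (fun y => (1 + enorm y) ^+ 2).

Definition pot kap f : plane R -> R[i] := fun x => dist f (fun y => kap (x - y)).

Definition ker_bound (C : R) kap := measurable_fun [set: mplane R] kap /\ forall u, `|kap u| <= C * ker_majorant u.

Lemma moment2_pairable1 f : moment2 f -> pairable f (fun y => 1 + enorm y).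
Proof.
move=> sf; apply: pairable_le sf _ _; first by apply: measurable_funD => //; exact: measurable_enorm.
move=> x; have := enorm_ge0 x => e0; rewrite !ger0_norm ?sqr_ge0//; nra.
Qed.

Lemma moment2_pairable_const f : moment2 f -> pairable f (fun=> 1).
Proof.
move=> sf; apply: pairable_le sf _ _; first exact: measurable_cst.
move=> x; have := enorm_ge0 x => e0; rewrite !ger0_norm ?sqr_ge0//; nra.
Qed.

(** Covers both test functions and indicators of squares, so that one Fubini
    statement serves pairing and local integrability. *)
Definition bounded_supp (chi : mplane R -> R) (B N : R) :=
  [/\ measurable_fun [set: mplane R] chi, 0 <= B, 0 <= N & forall x, `|chi x| <= B * \1_(box 0 N) x].

Lemma test_bounded_supp chi : test_fun chi -> exists B N, bounded_supp chi B N.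
Proof.
move=> tc; have [N N0 hN] := test_supp tc; have [B B0 hB] := test_bound tc.
exists B, N; split => //; [|exact: ltW|].
  by apply: continuous_mplane; exact: test_cont.
move=> x; have [->|/hN bx] := eqVneq (chi x) 0; first by rewrite normr0 mulr_ge0.
by rewrite indicE mem_set// mulr1.
Qed.

Lemma box_bounded_supp N : 0 <= N -> bounded_supp \1_(box 0 N) 1 N.
Proof.
move=> N0; split => //.
  by apply: measurable_indic; exact: box_measurable.
by move=> x; rewrite mul1r ger0_norm.
Qed.

Lemma pot_bound_box chi B N : bounded_supp chi B N -> exists2 C', 0 <= C' & forall C kap, 0 <= C -> ker_bound C kap ->
  forall y, (\int[mu2 R]_x (`|chi x * kap (x - y)|)%:E <= (C * (C' * (1 + enorm y)))%:E)%E.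
Proof.
move=> [mchi B0 N0 hchi]; have [C1 C10 hC1] := ker_majorant_box N0.
exists (B * C1); first exact: mulr_ge0.
move=> C kap C0 [mk hk] y.
have mM : measurable_fun [set: mplane R] (fun x => ker_majorant (x - y) * \1_(box 0 N) x).
  apply: measurable_funM; last by apply: measurable_indic; exact: box_measurable.
  by apply: measurable_shift'; exact: measurable_ker_majorant.
apply: (@le_trans _ _ (\int[mu2 R]_x ((C * B)%:E * (ker_majorant (x - y) * \1_(box 0 N) x)%:E)%E)%E).
  apply: mu2_le.
  - apply/measurable_EFinP; apply: measurableT_comp => //; apply: measurable_funM => //.
    exact: measurable_shift'.
  - by apply: emeasurable_funM => //; apply/measurable_EFinP.
  - by move=> x; rewrite lee_fin.
  - move=> x; rewrite -EFinM lee_fin normrM mulrC.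
    apply: le_trans (ler_pM _ _ (hk _) (hchi _)) _ => //.
    by rewrite le_eqVlt; apply/orP; left; apply/eqP; ring.
rewrite ge0_integralZl_EFin ?mulr_ge0//; last 2 first.
- by move=> x _; rewrite lee_fin mulr_ge0 ?ker_majorant_ge0.
- exact/measurable_EFinP.
apply: le_trans (lee_wpmul2l _ (hC1 y)) _; first by rewrite lee_fin mulr_ge0.
by rewrite -EFinM lee_fin le_eqVlt; apply/orP; left; apply/eqP; ring.
Qed.

Lemma pot_fubini f chi B N C kap : moment2 f -> bounded_supp chi B N -> 0 <= C -> ker_bound C kap ->
  pairable (pot kap f) chi /\
  dist (pot kap f) chi = dist f (fun y => \int[mu2 R]_x (chi x * kap (x - y))).
Proof.
move=> sf bc C0 hk; have [C' C'0 /(_ _ _ C0 hk) h] := pot_bound_box bc.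
have [mchi _ _ _] := bc; have [mk _] := hk.
have [||||d1 _ e] := @dist_fubini _ f chi (fun z => kap (z.1 - z.2)) (fun y => C * (C' * (1 + enorm y))).
- exact: mchi.
- exact: measurable_ker.
- exact: h.
- by apply: pairableZ; apply: pairableZ; exact: moment2_pairable1.
by split.
Qed.

Lemma pot_measurable f kap : moment2 f -> measurable_fun [set: mplane R] kap -> cmeasurable (pot kap f).
Proof.
move=> [mf _ _] mk; exact: (@dist_measurable _ f (fun z => kap (z.1 - z.2)) mf (measurable_ker mk)).
Qed.

Lemma loc_intP f : loc_int f <-> cmeasurable f /\ forall N, 0 <= N -> pairable f \1_(box 0 N).
Proof.
split.
  move=> [mf lf]; split => // N N0; split => //.
    by apply: measurable_indic; exact: box_measurable.
  have := lf _ (@box_compact R 0 N); rewrite integrable_mkcond; last exact: box_measurable.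
  move=> /integrableP[_]; apply: le_lt_trans; apply: mu2_le.
  - apply/measurable_EFinP; apply: measurable_funM; first exact: measurable_cmod.
    by apply: measurableT_comp => //; apply: measurable_indic; exact: box_measurable.
  - apply: measurableT_comp => //; apply/(measurable_restrictT _ _).1; first exact: box_measurable.
    by apply/measurable_EFinP; apply: measurable_funTS; exact: measurable_cmod.
  - by move=> x; rewrite lee_fin mulr_ge0 ?cmod_ge0.
  - move=> x; rewrite patchE indicE; case: ifPn => _; last by rewrite normr0 mulr0 abse_ge0.
    by rewrite normr1 mulr1 /= lee_fin ler_norm.
move=> [mf lf]; split => // K cK; have [M M0 KM] := compact_box cK.
have mc := measurable_cmod mf.
apply: (@integrableS _ _ _ (mu2 R) (box 0 M : set (mplane R))) => //.
- exact: box_measurable.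
- exact: compact_mplane.
have := pairable_L1 (lf M (ltW M0)).
rewrite integrable_mkcond; last exact: box_measurable.
apply: eq_integrable => // x _; rewrite patchE /= indicE; case: ifPn => _.
  by rewrite normr1 mulr1.
by rewrite normr0 mulr0.
Qed.

Lemma pot_loc_int f C kap : moment2 f -> 0 <= C -> ker_bound C kap -> loc_int (pot kap f).
Proof.
move=> sf C0 hk; apply/loc_intP; split; first by apply: pot_measurable => //; case: hk.
by move=> N N0; have [] := pot_fubini sf (box_bounded_supp N0) C0 hk.
Qed.

Lemma loc_int_pairable f chi B N : loc_int f -> bounded_supp chi B N -> pairable f chi.
Proof.
move=> /loc_intP[mf lf] [mc B0 N0 hc]; apply: pairable_le (pairableZ B (lf N N0)) mc _ => x.
by rewrite [leRHS]ger0_norm ?mulr_ge0.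
Qed.

(** After exchanging the integrals the singularity is averaged out, and
    dominated convergence applies twice: in x for fixed y, then in y. *)
Lemma pot_cvg f chi B N C (kap_ : nat -> mplane R -> R) kap :
  moment2 f -> bounded_supp chi B N -> 0 <= C -> (forall n, ker_bound C (kap_ n)) -> ker_bound C kap ->
  (forall u, (fun n => kap_ n u) @ \oo --> kap u) ->
  cvgC (fun n => dist (pot (kap_ n) f) chi) (dist (pot kap f) chi).
Proof.
move=> sf bc C0 hk_ hk ck; have [C' C'0 h] := pot_bound_box bc.
have [mchi B0 N0 hchi] := bc.
have mI (k : mplane R -> R) : measurable_fun [set: mplane R] k ->
    measurable_fun [set: mplane R] (fun y => \int[mu2 R]_x (chi x * k (x - y))).
  move=> mk; have := @measurable_Rint _ (fun z => chi z.2 * k (z.2 - z.1)); apply.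
  apply: measurable_funM; first exact: (measurableT_comp mchi measurable_snd).
  exact: (measurableT_comp (measurable_ker mk)
    (measurable_fun_pair (@measurable_snd _ _ (mplane R) (mplane R)) (@measurable_fst _ _ (mplane R) (mplane R)))).
rewrite (pot_fubini sf bc C0 hk).2.
under eq_fun do rewrite (pot_fubini sf bc C0 (hk_ _)).2.
have mF (k : mplane R -> R) y : measurable_fun [set: mplane R] k -> measurable_fun [set: mplane R] (fun x => chi x * k (x - y)).
  by move=> mk; apply: measurable_funM => //; exact: measurable_shift'.
have igF k y : ker_bound C k -> L1 (fun x => chi x * k (x - y)).
  move=> hk'; apply/L1P; split; first by apply: mF; case: hk'.
  by apply: le_lt_trans (h _ _ C0 hk' y) _; rewrite ltry.
apply: (dist_cvg (K := fun y => C * (C' * (1 + enorm y)))).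
- by move=> n; apply: mI; case: (hk_ n).
- by apply: mI; case: hk.
- apply/aeW => y.
  have kM : ker_bound C (fun u => C * ker_majorant u).
    split; first by apply: measurable_funM => //; exact: measurable_ker_majorant.
    by move=> u; rewrite ger0_norm// mulr_ge0 ?ker_majorant_ge0.
  apply: (Rdominated_cvg (H := fun x => `|chi x * (C * ker_majorant (x - y))|)).
  + by move=> n; apply: mF; case: (hk_ n).
  + by apply: mF; case: hk.
  + by apply/aeW => x; apply: cvgM; [exact: cvg_cst|exact: ck].
  + apply/aeW => x n; rewrite !normrM ler_wpM2l// -normrM.
    by apply: le_trans ((hk_ n).2 _) _; rewrite ler_norm.
  + exact: (L1_norm (igF _ y kM)).
- apply/aeW => y n; rewrite -lee_fin; apply: le_trans (h _ _ C0 (hk_ n) y).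
  have i := igF _ y (hk_ n).
  have fin := integrable_fin_num measurableT (L1_norm i).
  by rewrite -(fineK fin) lee_fin; exact: le_normr_Rintegral.
- by apply: pairableZ; apply: pairableZ; exact: moment2_pairable1.
Qed.

End Potential.

(** * The weak gradient of the logarithmic potential *)

Section Lines. Context {R : realType}.
Notation mu := (@lebesgue_measure R).

Lemma is_derive_continuous (H h : R -> R) : (forall s : R, is_derive s 1 H (h s)) -> continuous H.
Proof.
by move=> dH s; apply: differentiable_continuous; apply/derivable1_diffP; exact: ex_derive.
Qed.

Lemma ftc_int (H h : R -> R) a b : a < b -> (forall s : R, is_derive s 1 H (h s)) ->
  continuous h -> (\int[mu]_(x in `[a, b]) (h x)%:E = (H b - H a)%:E)%E.
Proof.
move=> ab dH ch; rewrite EFinB; apply: continuous_FTC2 => //.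
- exact: continuous_subspaceT.
- have cH := is_derive_continuous dH.
  split; first by move=> s _; exact: ex_derive.
    by apply: cvg_at_right_filter; exact: cH.
  by apply: cvg_at_left_filter; exact: cH.
- by move=> s _; rewrite derive1E; exact: derive_val.
Qed.

Lemma ftc_int0 (H h : R -> R) M : 0 < M -> (forall s : R, is_derive s 1 H (h s)) ->
  continuous h -> (forall s, M <= `|s| -> H s = 0 /\ h s = 0) ->
  (\int[mu]_x (h x)%:E = 0)%E.
Proof.
move=> M0 dH ch z; transitivity (\int[mu]_(x in `[(- M)%R, M]) (h x)%:E)%E.
  rewrite [RHS]integral_mkcond; apply: eq_integral => x _; rewrite patchE.
  case: ifPn => //; rewrite notin_setE /= in_itv/= => /negP; rewrite -ler_norml -ltNge => /ltW xM.
  by rewrite (z x xM).2.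
rewrite (@ftc_int H h)//; last by rewrite (lt_trans _ M0)// oppr_lt0.
by rewrite (z M _).1 ?(z (- M) _).1 ?subrr// ?normrN ger0_norm// ltW.
Qed.

Lemma ae_point1 (A : R -> Prop) t0 : (forall t, t != t0 -> A t) -> {ae mu, forall t, A t}.
Proof.
move=> hA; exists [set t0]; split; [exact: measurable_set1|exact: lebesgue_measure_set1|].
by move=> t /= nA; apply: contrapT => /eqP tt; apply: nA; exact: hA.
Qed.

Lemma ae_point (A : plane R -> Prop) x0 : (forall x, x != x0 -> A x) -> {ae mu2 R, forall x, A x}.
Proof.
move=> hA; exists ([set x0.1] `*` [set x0.2]); split.
- by apply: (@measurableX _ _ (measurableTypeR R) (measurableTypeR R)); exact: measurable_set1.
- by rewrite mu2_setX ?lebesgue_measure_set1 ?mul0e//; exact: measurable_set1.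
- move=> x /= nA; apply: contrapT => nx; apply: nA; apply: hA; apply/eqP => xx.
  by apply: nx; rewrite xx.
Qed.

(** Fubini, with one exceptional line allowed: the integrals along a line
    through a singularity are never computed. *)
Lemma mu2_lines0 (F : mplane R -> R) (t0 : R) : L1 F ->
  (forall t, t != t0 -> (\int[mu]_s (F (s, t))%:E = 0)%E) -> \int[mu2 R]_x F x = 0.
Proof.
move=> iF h; rewrite /Rintegral.
rewrite -(@integral21_prod_meas1 _ _ _ _ _ mu mu (EFin \o F) iF).
transitivity (fine (\int[mu]_x cst 0%E x)); last by rewrite integral0.
congr fine; apply: ae_eq_integral => //.
- exact: (measurable_fubini_G iF).
- by apply: (@ae_point1 _ t0) => t tt _; exact: h.
Qed.

Lemma mu2_lines0' (F : mplane R -> R) (t0 : R) : L1 F ->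
  (forall t, t != t0 -> (\int[mu]_s (F (t, s))%:E = 0)%E) -> \int[mu2 R]_x F x = 0.
Proof.
move=> iF h; rewrite /Rintegral.
rewrite -(@integral12_prod_meas1 _ _ _ _ _ mu mu (EFin \o F) iF).
transitivity (fine (\int[mu]_x cst 0%E x)); last by rewrite integral0.
congr fine; apply: ae_eq_integral => //.
- exact: (measurable_fubini_F iF).
- by apply: (@ae_point1 _ t0) => t tt _; exact: h.
Qed.

(** The line parallel to the j-th axis at height t; it lets both partial
    derivatives share one proof. *)
Definition slice (j : 'I_2) (t s : R) : plane R := if j == 0 then (s, t) else (t, s).

Lemma slice_derive (f : plane R -> R) j t s : differentiable (f : _ -> R^o) (slice j t s) ->
  is_derive s 1 (fun s => f (slice j t s)) (pd j f (slice j t s)).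
Proof.
move=> df; have dv := diff_derivable (v := evec R j) df.
have e (h : R) : slice j t (h *: (1 : R^o) + s) = h *: evec R j + slice j t s.
  rewrite /slice /evec; case: (j == 0); congr (_, _);
  by rewrite /= /GRing.scale/= ?mulr1 ?mulr0 ?add0r.
have E : (fun h : R => h^-1 *: (((fun s => f (slice j t s)) \o shift s) (h *: (1 : R^o)) - f (slice j t s))) =
   (fun h : R => h^-1 *: ((f \o shift (slice j t s)) (h *: evec R j) - f (slice j t s))).
  by apply/funext => h; rewrite /= e.
apply: DeriveDef; first by rewrite /derivable E.
by rewrite /pd /derive E.
Qed.

Lemma slice_cont (f : plane R -> R) j t : continuous f -> continuous (fun s => f (slice j t s)).
Proof.
move=> cf s; apply: (@continuous_comp _ _ _ (slice j t) f); last exact: cf.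
apply/cvg_ballP => e e0; near=> u.
have bu : ball s e u by near: u; exists e.
by rewrite /slice; case: (j == 0); split => //=; exact: ballxx.
Unshelve. all: by end_near. Qed.

Lemma mu2_slices0 j (F : mplane R -> R) (t0 : R) : L1 F ->
  (forall t, t != t0 -> (\int[mu]_s (F (slice j t s))%:E = 0)%E) -> \int[mu2 R]_x F x = 0.
Proof.
by rewrite /slice; case: (j == 0) => iF h; [exact: mu2_lines0 h|exact: mu2_lines0' h].
Qed.

Definition ln_norm (u : plane R) : R := ln (enorm u).

Definition grad_ln (j : 'I_2) (u : plane R) : R := coord j u / enorm u ^+ 2.

Lemma enorm0 (u : plane R) : enorm u = 0 -> u = 0.
Proof.
move=> e; have := enorm_ge_fst u; have := enorm_ge_snd u; rewrite e !normr_le0 => /eqP u2 /eqP u1.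
by case: u u1 u2 {e} => a b /= -> ->.
Qed.

Lemma ln_norm_ker_bound : ker_bound 1 ln_norm.
Proof.
split; first exact: (measurableT_comp (@measurable_ln R) measurable_enorm).
move=> u; rewrite mul1r /ln_norm /ker_majorant invroot_sqr; have e0 := enorm_ge0 u.
have [e|/eqP e] := eqVneq (enorm u) 0.
  by rewrite e ln0// normr0 invr0 !addr_ge0.
have ep : 0 < enorm u by rewrite lt_neqAle e0 andbT eq_sym; exact/eqP.
have iv : 0 < (enorm u)^-1 by rewrite invr_gt0.
have h1 := ln_sublinear ep; have h2 := ln_sublinear iv.
by rewrite ler_norml; apply/andP; split; move: h1 h2; rewrite lnV ?posrE//; lra.
Qed.

Lemma coord_le j (u : plane R) : `|coord j u| <= enorm u.
Proof. by rewrite /coord; case: ifP => _; [exact: enorm_ge_fst|exact: enorm_ge_snd]. Qed.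

Lemma grad_ln_le j u : `|grad_ln j u| <= (enorm u)^-1.
Proof.
rewrite /grad_ln normrM normfV (ger0_norm (sqr_ge0 _)).
have [->|e] := eqVneq (enorm u) 0; first by rewrite expr0n invr0 mulr0.
have ep : 0 < enorm u by rewrite lt_neqAle enorm_ge0 andbT eq_sym.
rewrite ler_pdivrMr ?exprn_gt0// expr2 mulKf//; exact: coord_le.
Qed.

Lemma grad_ln_ker_bound j : ker_bound 1 (grad_ln j).
Proof.
split.
  apply: measurable_funM; first by apply: continuous_mplane; exact: continuous_coord.
  apply: (measurableT_comp (@measurable_inv R)); apply: measurable_funX; exact: measurable_enorm.
move=> u; rewrite mul1r /ker_majorant invroot_sqr (le_trans (grad_ln_le _ _))//.
by have := enorm_ge0 u; lra.
Qed.

Lemma pot_L1 chi B N C kap y : bounded_supp chi B N -> 0 <= C -> ker_bound C kap ->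
  L1 (fun x : mplane R => chi x * kap (x - y)).
Proof.
move=> bc C0 hk; have [C' _ h] := pot_bound_box bc.
have [mchi _ _ _] := bc; have [mk _] := hk.
apply/L1P; split; last by apply: le_lt_trans (h _ _ C0 hk y) _; rewrite ltry.
by apply: measurable_funM => //; exact: measurable_shift'.
Qed.

Lemma lnkE (u : plane R) : u != 0 -> ln_norm u = 2^-1 * ln (u.1 ^+ 2 + u.2 ^+ 2).
Proof.
move=> u0; have q0 : 0 <= u.1 ^+ 2 + u.2 ^+ 2 by rewrite addr_ge0 ?sqr_ge0.
by rewrite /ln_norm /enorm -powR12_sqrt// ln_powR.
Qed.

(** Integration by parts along the lines that avoid the singularity. *)
Lemma ln_norm_by_parts j chi y : test_fun chi ->
  \int[mu2 R]_x (pd j chi x * ln_norm (x - y)) = - \int[mu2 R]_x (chi x * grad_ln j (x - y)).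
Proof.
move=> tc; have tc' := test_pd j tc.
have [B [N bc]] := test_bounded_supp tc; have [B' [N' bc']] := test_bounded_supp tc'.
have i1 := pot_L1 y bc' ler01 ln_norm_ker_bound; have i2 := pot_L1 y bc ler01 (grad_ln_ker_bound j).
apply/eqP; rewrite -addr_eq0 -RintegralD//; apply/eqP.
have [_ _ N0 hN] := bc; have [_ _ N0' hN'] := bc'.
pose M := N + N' + 1.
have M0 : 0 < M by rewrite ltr_wpDl// addr_ge0.
pose y1 : R := if j == 0 then y.1 else y.2; pose y2 : R := if j == 0 then y.2 else y.1.
apply: (@mu2_slices0 j _ y2); first exact: L1D.
move=> t tt.
have sE s : (slice j t s - y).1 ^+ 2 + (slice j t s - y).2 ^+ 2 = (s - y1) ^+ 2 + (t - y2) ^+ 2.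
  by rewrite /slice /y1 /y2; case: (j == 0) => //=; rewrite addrC.
have q0 s : 0 < (s - y1) ^+ 2 + (t - y2) ^+ 2.
  by rewrite ltr_wpDl ?sqr_ge0// exprn_even_gt0//= subr_eq0.
have lE s : ln_norm (slice j t s - y) = 2^-1 * ln ((s - y1) ^+ 2 + (t - y2) ^+ 2).
  rewrite lnkE ?sE//; apply/eqP => z; have := sE s; rewrite z /= expr0n /= addr0 => e.
  by have := q0 s; rewrite -e ltxx.
have gE s : grad_ln j (slice j t s - y) = (s - y1) / ((s - y1) ^+ 2 + (t - y2) ^+ 2).
  rewrite /grad_ln enorm_sqr sE; congr (_ / _); rewrite /coord /slice /y1.
  by case: (j == 0).
have dl (s : R) : is_derive s 1 (fun s : R => 2^-1 * ln ((s - y1) ^+ 2 + (t - y2) ^+ 2))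
   ((s - y1) / ((s - y1) ^+ 2 + (t - y2) ^+ 2)).
  have d1 : is_derive s 1 (fun s : R => s - y1) 1 by apply: is_derive_eq; rewrite subr0.
  have dq : is_derive s 1 (fun s : R => (s - y1) ^+ 2 + (t - y2) ^+ 2) (2 * (s - y1)).
    have d2 := is_derive_mul d1 d1.
    have := is_deriveD d2 (is_derive_cst ((t - y2) ^+ 2) s 1).
    by move=> h; apply: (is_derive_eq h); rewrite addr0; ring.
  have dln := is_derive1_comp (f := @ln R) (g := fun s : R => (s - y1) ^+ 2 + (t - y2) ^+ 2) (is_derive1_ln (q0 s)) dq.
  have dz := is_derive_mul (is_derive_cst (2^-1 : R) s 1) dln.
  apply: (is_derive_eq dz); rewrite mul0r add0r /=.
  have := lt0r_neq0 (q0 s); move: (_ + _) => Q Q0; field; exact: Q0.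
have dc s := slice_derive (smooth_diff (slice j t s) tc.1).
under eq_integral do rewrite lE gE.
apply: (@ftc_int0 (fun s => chi (slice j t s) * (2^-1 * ln ((s - y1) ^+ 2 + (t - y2) ^+ 2))) _ M M0).
- move=> s; exact: is_derive_mul.
- have cl : continuous (fun s : R => s - y1).
    by move=> s; apply: cvgB; [exact: cvg_id|exact: cvg_cst].
  have c1 := slice_cont (j := j) (t := t) (test_cont tc).
  have c2 := slice_cont (j := j) (t := t) (test_cont tc').
  have c3 := is_derive_continuous dl.
  have c4 : continuous (fun s : R => (s - y1) / ((s - y1) ^+ 2 + (t - y2) ^+ 2)).
    move=> s; exact: (cvgM (cl s) (cvgV (lt0r_neq0 (q0 s)) (cvgD (cvgM (cl s) (cl s)) (cvg_cst _)))).
  move=> s; exact: (cvgD (cvgM (c2 s) (c3 s)) (cvgM (c1 s) (c4 s))).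
- move=> s sM.
  have nb K : 0 <= K -> K < M -> ~ box 0 K (slice j t s).
    move=> K0 KM /boxP[]; rewrite !subr0 /slice; case: (j == 0) => /= h1 h2.
      by have := le_trans sM h1; rewrite leNgt KM.
    by have := le_trans sM h2; rewrite leNgt KM.
  have nz (k : mplane R -> R) b K : (forall x, `|k x| <= b * \1_(box 0 K) x) -> 0 <= K -> K < M -> k (slice j t s) = 0.
    move=> hk K0 KM; apply/eqP; rewrite -normr_le0; apply: le_trans (hk _) _.
    by rewrite indicE memNset ?mulr0//; exact: nb.
  rewrite (nz _ _ _ hN) ?(nz _ _ _ hN') ?mul0r ?addr0//; rewrite /M; lra.
Qed.

End Lines.

Section WeakGradient. Context {R : realType}.
Implicit Types (f g : plane R -> R[i]).

Lemma loc_box_L1 f N : loc_int f ->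
  (mu2 R).-integrable (box 0 N : set (mplane R)) (EFin \o (fun x => complex.Re (f x))) /\
  (mu2 R).-integrable (box 0 N : set (mplane R)) (EFin \o (fun x => complex.Im (f x))).
Proof.
move=> [[m1 m2] lf]; have i := lf _ (@box_compact R 0 N).
split; (apply: le_integrable i; first exact: box_measurable;
  first by apply/measurable_EFinP; exact: measurable_funTS) => x _;
  rewrite /= lee_fin [leRHS]ger0_norm ?cmod_ge0//; [exact: Re_cmod|exact: Im_cmod].
Qed.

Lemma dist_inj f g : loc_int f -> loc_int g ->
  (forall chi, test_fun chi -> dist f chi = dist g chi) ->
  {ae mu2 R, forall x, f x = g x}.
Proof.
move=> lf lg fg; have [[m1 m2] _] := lf; have [[m1' m2'] _] := lg.
have h1 : {ae mu2 R, forall x, complex.Re (f x) - complex.Re (g x) = 0}.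
  apply: test_fun_separating; first exact: measurable_funB.
    move=> N; have [a _] := loc_box_L1 N lf; have [b _] := loc_box_L1 N lg.
    by have := integrableB (box_measurable 0 N) a b; apply: eq_integrable; first exact: box_measurable.
  move=> chi tc; have [B [N bc]] := test_bounded_supp tc.
  under eq_Rintegral do rewrite mulrBl.
  rewrite RintegralB//; try (apply: pairable_Re; exact: loc_int_pairable bc).
  by have := fg chi tc; rewrite !distE => -[-> _]; rewrite subrr.
have h2 : {ae mu2 R, forall x, complex.Im (f x) - complex.Im (g x) = 0}.
  apply: test_fun_separating; first exact: measurable_funB.
    move=> N; have [_ a] := loc_box_L1 N lf; have [_ b] := loc_box_L1 N lg.
    by have := integrableB (box_measurable 0 N) a b; apply: eq_integrable; first exact: box_measurable.
  move=> chi tc; have [B [N bc]] := test_bounded_supp tc.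
  under eq_Rintegral do rewrite mulrBl.
  rewrite RintegralB//; try (apply: pairable_Im; exact: loc_int_pairable bc).
  by have := fg chi tc; rewrite !distE => -[_ ->]; rewrite subrr.
apply: ae_imp2 h1 h2 => x /eqP a /eqP b; apply: complex_ext; apply/eqP.
  by rewrite -subr_eq0.
by rewrite -subr_eq0.
Qed.

Lemma loc_intZ f z : loc_int f -> loc_int (fun x => z * f x).
Proof.
move=> /loc_intP[mf lf]; apply/loc_intP; split; first exact: cmeasurableZ.
by move=> N N0; apply: pairableZf; exact: lf.
Qed.

Lemma loc_intD f g : loc_int f -> loc_int g -> loc_int (fun x => f x + g x).
Proof.
move=> /loc_intP[mf lf] /loc_intP[mg lg]; apply/loc_intP; split; first exact: cmeasurableD.
by move=> N N0; apply: pairableDf; [exact: lf|exact: lg].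
Qed.

Lemma G0E f x : G0 f x = (- (2 * pi)^-1)%:C * pot ln_norm f x.
Proof.
rewrite /G0 /pot /dist rmorphN; congr (_ * cint _).
by apply/funext => y; rewrite mulrC.
Qed.

Lemma pot_inner f chi B N C kap : moment2 f -> bounded_supp chi B N -> 0 <= C -> ker_bound C kap ->
  pairable f (fun y => \int[mu2 R]_x (chi x * kap (x - y))).
Proof.
move=> sf bc C0 hk; have [C' C'0 /(_ _ _ C0 hk) h] := pot_bound_box bc.
have [mchi _ _ _] := bc; have [mk _] := hk.
have [||||//] := @dist_fubini _ f chi (fun z => kap (z.1 - z.2)) (fun y => C * (C' * (1 + enorm y))).
- exact: mchi.
- exact: measurable_ker.
- exact: h.
- by apply: pairableZ; apply: pairableZ; exact: moment2_pairable1.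
Qed.

(** The chosen weak derivative is determined up to a null set by [dist_inj],
    and the potential with kernel u_j/|u|^2 is one by exchanging the integrals
    and integrating by parts in x. *)
Lemma wpd_G0 f j : moment2 f ->
  {ae mu2 R, forall x, wpd j (G0 f) x = (- (2 * pi)^-1)%:C * pot (grad_ln j) f x}.
Proof.
move=> sf; set z : R[i] := (- (2 * pi)^-1)%:C.
pose g x := z * pot (grad_ln j) f x.
have lG : loc_int (G0 f).
  rewrite (_ : G0 f = fun x => z * pot ln_norm f x); last by apply/funext => x; exact: G0E.
  by apply: loc_intZ; exact: (pot_loc_int sf ler01 ln_norm_ker_bound).
have lg : loc_int g by apply: loc_intZ; exact: (pot_loc_int sf ler01 (grad_ln_ker_bound j)).
pose S := [set h | [/\ loc_int (G0 f), loc_int h &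
    forall chi, test_fun chi -> ddist j (dist (G0 f)) chi = dist h chi]].
have Sg : S g.
  split => // chi tc; rewrite /ddist.
  have [B [N bc]] := test_bounded_supp tc; have [B' [N' bc']] := test_bounded_supp (test_pd j tc).
  rewrite (_ : G0 f = fun x => z * pot ln_norm f x); last by apply/funext => x; exact: G0E.
  have [d1 e1] := pot_fubini sf bc' ler01 ln_norm_ker_bound.
  have [d2 e2] := pot_fubini sf bc ler01 (grad_ln_ker_bound j).
  rewrite distZf// distZf// e1 e2 -mulrN; congr (_ * _).
  rewrite -mulN1r (_ : -1 = (-1 : R)%:C); last by rewrite rmorphN.
  rewrite -distZ; last exact: pot_inner bc' ler01 ln_norm_ker_bound.
  by apply: dist_ext => y; rewrite ln_norm_by_parts// mulN1r opprK.
have [_ lw dw] : S (wpd j (G0 f)) by apply: (xgetPex (fun=> 0)); exists g.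
apply: (dist_inj lw lg) => chi tc; have [_ _ dg] := Sg.
by rewrite -dw// dg.
Qed.

End WeakGradient.

(** * Radial regularisation of the logarithm *)

Section Radial. Context {R : realType}.
Implicit Types (d s : R).

(** Supported in s <= d^2, where s stands for |u|^2, so u lies in the disc of
    radius d. *)
Definition cutoff (n : nat) d s : R := flatexp n (1 - s / d ^+ 2).

(** A smooth positive replacement of s = |u|^2 that differs from it only on [0,
    d^2]. *)
Definition rsq d s : R := s + d ^+ 2 * cutoff 0 d s.
(** The derivative of [rsq]; [rsq2] is the second derivative. *)
Definition rsq1 d s : R := 1 - cutoff 2 d s.
Definition rsq2 d s : R := (cutoff 4 d s - 2 * cutoff 3 d s) / d ^+ 2.
(** The logarithmic derivative of [rsq]; [dlog1] is its derivative. *)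
Definition dlog d s : R := rsq1 d s / rsq d s.
Definition dlog1 d s : R := rsq2 d s / rsq d s - dlog d s ^+ 2.
(** Half the divergence of the vector field u [dlog](|u|^2) in the plane, as a
    function of s = |u|^2. *)
Definition bump_profile d s : R := dlog d s + s * dlog1 d s.

Lemma cutoff0 n d s : 0 < d -> d ^+ 2 <= s -> cutoff n d s = 0.
Proof.
move=> d0 ds; rewrite /cutoff /flatexp ifF//; apply/negbTE; rewrite -leNgt subr_le0.
by rewrite ler_pdivlMr ?exprn_gt0// mul1r.
Qed.

Lemma cutoff_ge0 n d s : 0 <= cutoff n d s. Proof. exact: flatexp_ge0. Qed.

Lemma cutoff_le n d s : 0 < d -> 0 <= s -> cutoff n d s <= (n.+2)`!%:R.
Proof.
move=> d0 s0; have [ds|ds] := leP (d ^+ 2) s; first by rewrite cutoff0// ler0n.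
apply: le_trans (flatexp_le _ _) _; rewrite ler_piMr// exprn_ile1//.
  by rewrite subr_ge0 ler_pdivrMr ?exprn_gt0// mul1r ltW.
by rewrite gerBl divr_ge0// sqr_ge0.
Qed.

Lemma rsq_ge d s : s <= rsq d s.
Proof. by rewrite /rsq lerDl mulr_ge0 ?sqr_ge0 ?cutoff_ge0. Qed.

(** For s >= d^2/2 the summand s suffices; below, the cutoff is at least
    exp(-2). *)
Lemma rsq_ge_sqr d s : 0 < d -> 0 <= s -> expR (- 2) * d ^+ 2 <= rsq d s.
Proof.
move=> d0 s0; have d20 : 0 < d ^+ 2 by rewrite exprn_gt0.
have e1 : expR (-2) <= 2^-1 :> R.
  rewrite expRN lef_pV2 ?posrE ?expR_gt0//; have := @expR_ge1Dx R 2; lra.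
have [h|h] := leP (d ^+ 2 / 2) s.
  apply: le_trans (rsq_ge d s); apply: le_trans h; rewrite mulrC ler_wpM2l// ltW//.
apply: (@le_trans _ _ (d ^+ 2 * cutoff 0 d s)); last by rewrite /rsq lerDr.
rewrite mulrC ler_wpM2l ?(ltW d20)// /cutoff /flatexp.
have t2 : 2^-1 <= 1 - s / d ^+ 2.
  suff : s / d ^+ 2 <= 2^-1 by lra.
  by rewrite ler_pdivrMr// mulrC ltW.
have t0 : 0 < 1 - s / d ^+ 2 by apply: lt_le_trans t2.
rewrite t0 expr0 mul1r ler_expR lerNl opprK -[leRHS]invrK lef_pV2 ?posrE//.
Qed.

Lemma rsq_gt0 d s : 0 < d -> 0 <= s -> 0 < rsq d s.
Proof.
move=> d0 s0; apply: lt_le_trans (rsq_ge_sqr d0 s0).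
by rewrite mulr_gt0 ?expR_gt0 ?exprn_gt0.
Qed.

Lemma rsq_le d s : 0 < d -> 0 <= s -> rsq d s <= s + d ^+ 2.
Proof.
move=> d0 s0; rewrite /rsq lerD2l ler_piMr ?sqr_ge0// flatexp_le1//.
Qed.

Lemma rsq_out d s : 0 < d -> d ^+ 2 <= s -> rsq d s = s.
Proof. by move=> d0 ds; rewrite /rsq cutoff0// mulr0 addr0. Qed.

Lemma dlog_out d s : 0 < d -> d ^+ 2 <= s -> dlog d s = s^-1.
Proof. by move=> d0 ds; rewrite /dlog /rsq1 rsq_out// cutoff0// subr0 mul1r. Qed.

Lemma bump_profile_out d s : 0 < d -> d ^+ 2 <= s -> bump_profile d s = 0.
Proof.
move=> d0 ds; have s0 : s != 0 by rewrite gt_eqF// (lt_le_trans _ ds)// exprn_gt0.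
rewrite /bump_profile /dlog1 dlog_out// /rsq2 !cutoff0// mulr0 subrr !mul0r sub0r; field.
exact: s0.
Qed.

(** Here 25 = 1 + 4!, by the factorial bound on [flatexp] of index 2. *)
Lemma rsq1_le d s : 0 < d -> 0 <= s -> `|rsq1 d s| <= 25.
Proof.
move=> d0 s0; have := cutoff_le 2 d0 s0; have := cutoff_ge0 2 d s.
rewrite /rsq1 ler_norml (_ : 4`!%:R = 24 :> R)//; move=> h1 h2; apply/andP; split; lra.
Qed.

(** Here 960 = 6! + 2 5!, by the factorial bounds on [flatexp] of indices 4 and
    3. *)
Lemma rsq2_le d s : 0 < d -> 0 <= s -> `|rsq2 d s| <= 960 / d ^+ 2.
Proof.
move=> d0 s0; have d20 : 0 < d ^+ 2 by rewrite exprn_gt0.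
rewrite /rsq2 normrM normfV (ger0_norm (ltW d20)) ler_pM2r ?invr_gt0//.
have := cutoff_le 4 d0 s0; have := cutoff_ge0 4 d s; have := cutoff_le 3 d0 s0; have := cutoff_ge0 3 d s.
rewrite (_ : 6`!%:R = 720 :> R)// (_ : 5`!%:R = 120 :> R)//.
by move=> h1 h2 h3 h4; rewrite ler_norml; apply/andP; split; lra.
Qed.

Lemma dlog_le d s : 0 < d -> 0 <= s -> `|dlog d s| <= 25 / rsq d s.
Proof.
move=> d0 s0; have q0 := rsq_gt0 d0 s0.
rewrite /dlog normrM normfV (ger0_norm (ltW q0)) ler_pM2r ?invr_gt0//; exact: rsq1_le.
Qed.

(** With |rsq1| <= 25, s <= rsq and rsq >= exp(-2) d^2, the terms of
    [bump_profile] contribute (25 + 25^2) exp 2 and 960. *)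
Definition bump_cst : R := 650 * expR 2 + 960.

Lemma bump_profile_le d s : 0 < d -> 0 <= s -> `|bump_profile d s| <= bump_cst / d ^+ 2.
Proof.
move=> d0 s0; have q0 := rsq_gt0 d0 s0; have d20 : 0 < d ^+ 2 by rewrite exprn_gt0.
have sq : s / rsq d s <= 1 by rewrite ler_pdivrMr// mul1r rsq_ge.
have sq0 : 0 <= s / rsq d s by rewrite divr_ge0// ltW.
have iq : (rsq d s)^-1 <= expR 2 / d ^+ 2.
  rewrite -[leRHS]invrK lef_pV2 ?posrE ?invr_gt0 ?divr_gt0 ?expR_gt0//.
  by rewrite invfM invrK -expRN; exact: rsq_ge_sqr.
have h1 : `|dlog d s| <= 25 * (expR 2 / d ^+ 2).
  by apply: le_trans (dlog_le d0 s0) _; rewrite ler_pM2l.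
have h2 : s * `|rsq2 d s / rsq d s| <= 960 / d ^+ 2.
  rewrite normrM normfV (ger0_norm (ltW q0)) mulrCA -[leRHS]mulr1.
  by apply: ler_pM => //; exact: rsq2_le.
have h3 : s * `|dlog d s ^+ 2| <= 625 * (expR 2 / d ^+ 2).
  rewrite normrX expr2; have w0 := normr_ge0 (dlog d s).
  have hs : s * `|dlog d s| <= 25.
    apply: (@le_trans _ _ (s * (25 / rsq d s))); first by rewrite ler_wpM2l// dlog_le.
    by rewrite mulrCA -[leRHS]mulr1 ler_pM2l.
  rewrite (_ : 625 * _ = 25 * (25 * (expR 2 / d ^+ 2))); last by ring.
  by rewrite [leLHS]mulrA; apply: ler_pM => //; exact: mulr_ge0.
rewrite /bump_profile /dlog1; apply: le_trans (ler_normD _ _) _.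
rewrite [`|s * _|]normrM (ger0_norm s0).
have h4 : s * `|rsq2 d s / rsq d s - dlog d s ^+ 2| <= 960 / d ^+ 2 + 625 * (expR 2 / d ^+ 2).
  apply: le_trans (lerD h2 h3); rewrite -mulrDr ler_wpM2l//; exact: ler_normB.
apply: le_trans (lerD h1 h4) _; rewrite /bump_cst le_eqVlt; apply/orP; left; apply/eqP.
by field; rewrite gt_eqF.
Qed.

Lemma is_derive_cutoff n d s : d != 0 -> is_derive s 1 (cutoff n d) (- (cutoff n.+2 d s - n%:R * cutoff n.+1 d s) / d ^+ 2).
Proof.
move=> d0.
have da : is_derive s 1 (fun s : R => 1 - s / d ^+ 2) (- (d ^+ 2)^-1).
  have d1 := is_derive_mul (is_derive_id s 1) (is_derive_cst ((d ^+ 2)^-1) s 1).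
  have := is_deriveB (is_derive_cst (1 : R) s 1) d1.
  by move=> h; apply: (is_derive_eq h); rewrite /= mulr0 addr0 mul1r sub0r.
have := is_derive1_comp (f := flatexp n) (g := fun s : R => 1 - s / d ^+ 2) (is_derive_flatexp n (1 - s / d ^+ 2)) da.
by move=> h; apply: (is_derive_eq h); rewrite /cutoff mulrN mulNr.
Qed.

Lemma is_derive_rsq d s : d != 0 -> is_derive s 1 (rsq d) (rsq1 d s).
Proof.
move=> d0; have h1 := is_derive_mul (is_derive_cst (d ^+ 2) s 1) (is_derive_cutoff 0 s d0).
have := is_deriveD (is_derive_id s 1) h1.
move=> h; apply: (is_derive_eq h); rewrite /= /rsq1 mul0r add0r mul0r subr0; field.
exact: d0.
Qed.

Lemma is_derive_rsq1 d s : d != 0 -> is_derive s 1 (rsq1 d) (rsq2 d s).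
Proof.
move=> d0; have := is_deriveB (is_derive_cst (1 : R) s 1) (is_derive_cutoff 2 s d0).
by move=> h; apply: (is_derive_eq h); rewrite /= /rsq2 sub0r mulNr opprK.
Qed.

Lemma is_derive_dlog d s : 0 < d -> 0 <= s -> is_derive s 1 (dlog d) (dlog1 d s).
Proof.
move=> d0 s0; have dn := lt0r_neq0 d0; have q0 := lt0r_neq0 (rsq_gt0 d0 s0).
have h1 := is_derive1_comp (f := fun t : R => t^-1) (g := rsq d) (is_derive_inv q0) (is_derive_rsq s dn).
have h2 := is_derive_mul (is_derive_rsq1 s dn) h1.
by apply: (is_derive_eq h2); rewrite /dlog1 /dlog /=; field.
Qed.

End Radial.

Section RadialTests. Context {R : realType}.
Implicit Types (d r : R) (x y u : plane R).

Definition sqnorm u : R := u.1 ^+ 2 + u.2 ^+ 2.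
Definition bump_ker d u : R := bump_profile d (sqnorm u).
(** The gradient of [log_ker]. *)
Definition grad_ker (j : 'I_2) d u : R := coord j u * dlog d (sqnorm u).
Definition log_ker d u : R := 2^-1 * ln (rsq d (sqnorm u)).
(** The Hessian of [log_ker]. *)
Definition hess_ker (i j : 'I_2) d u : R :=
  (i == j)%:R * dlog d (sqnorm u) + 2 * coord i u * coord j u * dlog1 d (sqnorm u).

Lemma I2_cases (i : 'I_2) : i = 0 \/ i = 1.
Proof. by case: i => [[|[|//]] i2]; [left|right]; exact: val_inj. Qed.

Lemma sqnorm_ge0 u : 0 <= sqnorm u. Proof. by rewrite addr_ge0 ?sqr_ge0. Qed.

(** The regularised form of the fact that the Laplacian of ln|u| is 2 pi times
    the point mass at 0. *)
Lemma hess_ker_trace d u : hess_ker 0 0 d u + hess_ker 1 1 d u = 2 * bump_ker d u.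
Proof. by rewrite /hess_ker /bump_ker /bump_profile /sqnorm /coord/=; ring. Qed.

Lemma hess_ker_sym d u : hess_ker 0 1 d u = hess_ker 1 0 d u.
Proof. by rewrite /hess_ker/=; ring. Qed.

Lemma elementary_shift j x : elementary (fun y => coord j (x - y)).
Proof.
rewrite (_ : (fun y => _) = fun y => coord j x + (-1) * coord j y).
  apply: elementaryD; first exact: elementary_cst.
  by apply: elementaryM; [exact: elementary_cst|exact: elementary_coord].
by apply/funext => y; rewrite mulN1r /coord; case: (j == 0).
Qed.

Lemma pd_shift i j x y : pd i (fun y => coord j (x - y)) y = - (i == j)%:R.
Proof.
rewrite (_ : (fun y => _) = fun y => coord j x + (-1) * coord j y).
  rewrite pdD; last 2 first.
  - exact: elementary_diff (elementary_cst _) _.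
  - exact: elementary_diff (elementaryM (elementary_cst (-1)) (elementary_coord j)) _.
  rewrite pdM; last 2 first.
  - exact: elementary_diff (elementary_cst _) _.
  - exact: elementary_diff (elementary_coord _) _.
  by rewrite !pd_cst pd_coord; ring.
by apply/funext => z; rewrite mulN1r /coord; case: (j == 0).
Qed.

Lemma sqnormE x y : sqnorm (x - y) = coord 0 (x - y) * coord 0 (x - y) + coord 1 (x - y) * coord 1 (x - y).
Proof. by rewrite /sqnorm !expr2. Qed.

Lemma elementary_sqnorm x : elementary (fun y => sqnorm (x - y)).
Proof.
rewrite (_ : (fun y => _) = fun y => coord 0 (x - y) * coord 0 (x - y) + coord 1 (x - y) * coord 1 (x - y)).
  by apply: elementaryD; apply: elementaryM; exact: elementary_shift.
by apply/funext => y; exact: sqnormE.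
Qed.

Lemma pd_sqnorm i x y : pd i (fun y => sqnorm (x - y)) y = - (2 * coord i (x - y)).
Proof.
rewrite (_ : (fun y => _) = fun y => coord 0 (x - y) * coord 0 (x - y) + coord 1 (x - y) * coord 1 (x - y)); last first.
  by apply/funext => z; exact: sqnormE.
have e j := elementary_diff (elementary_shift j x) y.
have ee j := elementary_diff (elementaryM (elementary_shift j x) (elementary_shift j x)) y.
rewrite pdD// !pdM// !pd_shift.
by case: (I2_cases i) => -> /=; ring.
Qed.

Lemma elementary_cutoff n d x : 0 < d -> elementary (fun y => cutoff n d (sqnorm (x - y))).
Proof.
move=> d0; rewrite /cutoff; apply: elementary_flatexp.
rewrite (_ : (fun y => _) = fun y => 1 + (- (d ^+ 2)^-1) * sqnorm (x - y)).
  apply: elementaryD; first exact: elementary_cst.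
  by apply: elementaryM; [exact: elementary_cst|exact: elementary_sqnorm].
by apply/funext => y; rewrite mulNr mulrC.
Qed.

Lemma elementary_rsq d x : 0 < d -> elementary (fun y => rsq d (sqnorm (x - y))).
Proof.
move=> d0; apply: elementaryD; first exact: elementary_sqnorm.
by apply: elementaryM; [exact: elementary_cst|exact: elementary_cutoff].
Qed.

Lemma elementary_dlog d x : 0 < d -> elementary (fun y => dlog d (sqnorm (x - y))).
Proof.
move=> d0; apply: elementaryM.
  rewrite (_ : (fun y => _) = fun y => 1 + (-1) * cutoff 2 d (sqnorm (x - y))).
    apply: elementaryD; first exact: elementary_cst.
    by apply: elementaryM; [exact: elementary_cst|exact: elementary_cutoff].
  by apply/funext => y; rewrite mulN1r.
apply: elementaryV; first exact: elementary_rsq.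
by move=> y; apply: lt0r_neq0; apply: rsq_gt0 => //; exact: sqnorm_ge0.
Qed.

Lemma elementary_grad_ker j d x : 0 < d -> elementary (fun y => grad_ker j d (x - y)).
Proof. by move=> d0; apply: elementaryM; [exact: elementary_shift|exact: elementary_dlog]. Qed.

Lemma elementary_log_ker d x : 0 < d -> elementary (fun y => log_ker d (x - y)).
Proof.
move=> d0; apply: elementaryM; first exact: elementary_cst.
apply: elementary_ln; first exact: elementary_rsq.
by move=> y; apply: rsq_gt0 => //; exact: sqnorm_ge0.
Qed.

Lemma pd_grad_ker i j d x y : 0 < d -> pd i (fun y => grad_ker j d (x - y)) y = - hess_ker i j d (x - y).
Proof.
move=> d0.
have [dw pw] := comp_diff (f := fun y => sqnorm (x - y)) (is_derive_dlog d0 (sqnorm_ge0 (x - y))) (elementary_diff (elementary_sqnorm x) y).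
rewrite /grad_ker (pdM i (elementary_diff (elementary_shift j x) y) dw).
by rewrite pd_shift pw pd_sqnorm /hess_ker; ring.
Qed.

Lemma pd_log_ker i d x y : 0 < d -> pd i (fun y => log_ker d (x - y)) y = - grad_ker i d (x - y).
Proof.
move=> d0; have q0 := rsq_gt0 d0 (sqnorm_ge0 (x - y)).
have [dq pq] := comp_diff (f := fun y => sqnorm (x - y))
  (is_derive_rsq (sqnorm (x - y)) (lt0r_neq0 d0)) (elementary_diff (elementary_sqnorm x) y).
have [dl pl] := comp_diff (f := fun y => rsq d (sqnorm (x - y))) (is_derive1_ln q0) dq.
rewrite /log_ker pdM//.
by rewrite pd_cst mul0r add0r pl pq pd_sqnorm /grad_ker /dlog; field; exact: lt0r_neq0.
Qed.

(** Outside the larger radius both terms equal u_j/|u|^2 and cancel, so the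
    difference has compact support although neither term has. *)
Definition grad_test j d r x y : R := grad_ker j d (x - y) + (-1) * grad_ker j r (x - y).
(** A compactly supported primitive of -[grad_test]: here both terms equal
    ln|u| outside the larger radius. *)
Definition log_test d r x y : R := log_ker d (x - y) + (-1) * log_ker r (x - y).

Lemma sqnorm_box x y r : sqnorm (x - y) < r ^+ 2 -> 0 < r -> box x r y.
Proof.
move=> h r0; apply/boxP; rewrite distrC [`|y.2 - _|]distrC; move: h; rewrite /sqnorm /= => h.
split; rewrite leNgt; apply/negP => hh.
  have : r ^+ 2 < (x.1 - y.1) ^+ 2.
    by rewrite -[ltRHS]real_normK ?num_real// ltrXn2r// ?nnegrE// ltW.
  have := sqr_ge0 (x.2 - y.2); lra.
have : r ^+ 2 < (x.2 - y.2) ^+ 2.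
  by rewrite -[ltRHS]real_normK ?num_real// ltrXn2r// ?nnegrE// ltW.
have := sqr_ge0 (x.1 - y.1); lra.
Qed.

Lemma grad_test_test_fun j d r x : 0 < d -> d <= r -> test_fun (grad_test j d r x).
Proof.
move=> d0 dr; have r0 := lt_le_trans d0 dr; apply: (@elementary_test _ _ x r).
  apply: elementaryD; first exact: elementary_grad_ker.
  by apply: elementaryM; [exact: elementary_cst|exact: elementary_grad_ker].
move=> y; have [h _|h] := ltP (sqnorm (x - y)) (r ^+ 2); first exact: sqnorm_box.
rewrite /grad_test /grad_ker !dlog_out// ?mulN1r ?subrr ?eqxx//.
by apply: le_trans h; rewrite lerXn2r// ?nnegrE// ltW.
Qed.

Lemma log_test_test_fun d r x : 0 < d -> d <= r -> test_fun (log_test d r x).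
Proof.
move=> d0 dr; have r0 := lt_le_trans d0 dr; apply: (@elementary_test _ _ x r).
  apply: elementaryD; first exact: elementary_log_ker.
  by apply: elementaryM; [exact: elementary_cst|exact: elementary_log_ker].
move=> y; have [h _|h] := ltP (sqnorm (x - y)) (r ^+ 2); first exact: sqnorm_box.
rewrite /log_test /log_ker !rsq_out// ?mulN1r ?subrr ?eqxx//.
by apply: le_trans h; rewrite lerXn2r// ?nnegrE// ltW.
Qed.

Lemma pd_sub i (f g : plane R -> R) y : elementary f -> elementary g ->
  pd i (fun y => f y + (-1) * g y) y = pd i f y + (-1) * pd i g y.
Proof.
move=> ef eg; have e1 := elementary_diff ef y; have e2 := elementary_diff eg y.
have e3 := elementary_diff (elementaryM (elementary_cst (-1)) eg) y; have ec := elementary_diff (elementary_cst (-1)) y.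
rewrite (pdD i e1 e3); congr (_ + _).
by rewrite (pdM i ec e2) pd_cst mul0r add0r.
Qed.

Lemma pd_grad_test i j d r x y : 0 < d -> 0 < r ->
  pd i (grad_test j d r x) y = - (hess_ker i j d (x - y) + (-1) * hess_ker i j r (x - y)).
Proof.
move=> d0 r0; rewrite (pd_sub i y (elementary_grad_ker j x d0) (elementary_grad_ker j x r0)).
by rewrite (pd_grad_ker i j x y d0) (pd_grad_ker i j x y r0); ring.
Qed.

Lemma pd_log_test i d r x y : 0 < d -> 0 < r -> pd i (log_test d r x) y = - grad_test i d r x y.
Proof.
move=> d0 r0; rewrite (pd_sub i y (elementary_log_ker x d0) (elementary_log_ker x r0)).
by rewrite (pd_log_ker i x y d0) (pd_log_ker i x y r0) /grad_test; ring.
Qed.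

End RadialTests.

(** * Green identities for the radial test functions *)

Section ComplexAlgebra. Context {R : realType}.
Implicit Types (A B C D a b l t M : R[i]).

Lemma mulii : 'i * 'i = -1 :> R[i].
Proof. by rewrite -expr2 sqr_i. Qed.

Lemma two_half : (2 : R[i]) * (- 2^-1)%:C = -1.
Proof.
rewrite (_ : (2 : R[i]) = (2 : R)%:C); last by rewrite rmorphMn rmorph1.
by rewrite -rmorphM mulrN divff ?pnatr_eq0// rmorphN rmorph1.
Qed.

(** The linear algebra behind [green_psi1], with A, C and B, D the pairings of
    psi1 with the diagonal and the mixed derivatives of the test functions. *)
Lemma green_alg1 A B C D a b : 'i * A + B + a = 0 -> 'i * D + C + b = 0 -> D = B ->
  A + C = 'i * (a + 'i * b).
Proof.
move=> e0 e1 eD; rewrite eD in e1.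
have -> : a = - ('i * A + B) by apply/eqP; rewrite -subr_eq0 opprK addrC e0.
have -> : b = - ('i * B + C) by apply/eqP; rewrite -subr_eq0 opprK addrC e1.
have := mulii; set I := ('i : R[i]) => hI.
have -> : I * (- (I * A + B) + I * - (I * B + C)) = - (I * I) * A - (I * I) * C - I * B - (I * I) * (I * B) by ring.
rewrite hI; ring.
Qed.

(** The linear algebra behind [green_psi0]. The extra unknowns t0, t1 are the
    pairings of psi1 with [grad_test]; they are eliminated with the first
    equation, tested against [log_test]. *)
Lemma green_alg0 A B C D a b l t0 t1 s0 s1 M M2 :
  'i * A - B - M2 * t0 + a = 0 -> 'i * D - C - M2 * t1 + b = 0 ->
  'i * s0 + s1 + l = 0 -> s0 = - t0 -> s1 = - t1 -> M2 = 2 * M -> D = B ->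
  (- 2^-1)%:C * (A + C) = M * l + (- 2^-1)%:C * ('i * (a - 'i * b)).
Proof.
move=> e0 e1 eL es0 es1 eM eD; subst s0 s1 M2 D.
have -> : a = - ('i * A - B - 2 * M * t0) by apply/eqP; rewrite -subr_eq0 opprK addrC e0.
have -> : b = - ('i * B - C - 2 * M * t1) by apply/eqP; rewrite -subr_eq0 opprK addrC e1.
have -> : l = 'i * t0 + t1.
  by apply/eqP; rewrite -subr_eq0 -eL; apply/eqP; ring.
have := mulii; have := two_half; set I := ('i : R[i]); set H := (- _)%:C => h2 hI.
have -> : M * (I * t0 + t1) + H * (I * (- (I * A - B - 2 * M * t0) - I * - (I * B - C - 2 * M * t1))) =
  M * (I * t0 + t1) + H * (- (I * I) * A + I * B + (I * I) * (I * B) - (I * I) * C) + (2 * H) * (M * (I * t0 - (I * I) * t1)) by ring.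
rewrite hI h2; ring.
Qed.

End ComplexAlgebra.

Section RadialIdentities. Context {R : realType}.
Variables (m : R) (psi0 psi1 f0 f1 : plane R -> R[i]).
Implicit Types (d r : R) (x y : plane R).
Hypotheses (lp0 : loc_int psi0) (lp1 : loc_int psi1).
Hypotheses (lf0 : loc_int f0) (lf1 : loc_int f1).
Hypothesis E0 : forall chi, test_fun chi ->
  'i * dist psi1 (pd 0 chi) + dist psi1 (pd 1 chi) + dist f0 chi = 0.
Hypothesis E1 : forall chi, test_fun chi ->
  'i * dist psi0 (pd 0 chi) - dist psi0 (pd 1 chi) - (2 * m)%:C * dist psi1 chi + dist f1 chi = 0.

Definition bump_test (d r : R) (x y : plane R) : R := bump_ker d (x - y) + (-1) * bump_ker r (x - y).

Lemma test_pairable (f : plane R -> R[i]) chi : loc_int f -> test_fun chi -> pairable f chi.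
Proof. by move=> lf tc; have [B [N hb]] := test_bounded_supp tc; exact: loc_int_pairable lf hb. Qed.

Lemma bump_test_div d r x y : 0 < d -> 0 < r ->
  bump_test d r x y = (- 2^-1) * (pd 0 (grad_test 0 d r x) y + pd 1 (grad_test 1 d r x) y).
Proof.
move=> d0 r0; rewrite !pd_grad_test// /bump_test.
have := hess_ker_trace d (x - y); have := hess_ker_trace r (x - y); lra.
Qed.

Lemma grad_test_curl d r x : 0 < d -> 0 < r -> pd 0 (grad_test 1 d r x) = pd 1 (grad_test 0 d r x).
Proof. by move=> d0 r0; apply/funext => y; rewrite !pd_grad_test// !hess_ker_sym. Qed.

(** The bump difference is minus half the divergence of [grad_test], the
    derivative being taken in the second variable of u = x - y. *)
Lemma dist_bump_test (f : plane R -> R[i]) d r x : loc_int f -> 0 < d -> d <= r ->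
  dist f (bump_test d r x) = (- 2^-1)%:C * (dist f (pd 0 (grad_test 0 d r x)) + dist f (pd 1 (grad_test 1 d r x))).
Proof.
move=> lf d0 dr; have r0 := lt_le_trans d0 dr.
have h j : pairable f (pd j (grad_test j d r x)) by apply: test_pairable => //; apply: test_pd; exact: grad_test_test_fun.
by rewrite (dist_ext f (fun y => bump_test_div x y d0 r0)) distZ ?distD//; exact: pairableD.
Qed.

(** Test the first equation with the two components of [grad_test] and combine:
    the field is curl free, so only its divergence survives. *)
Lemma green_psi1 d r x : 0 < d -> d <= r ->
  dist psi1 (bump_test d r x) = (- 2^-1)%:C * ('i * (dist f0 (grad_test 0 d r x) + 'i * dist f0 (grad_test 1 d r x))).
Proof.
move=> d0 dr; have r0 := lt_le_trans d0 dr.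
have e0 := E0 (grad_test_test_fun 0 x d0 dr); have e1 := E0 (grad_test_test_fun 1 x d0 dr).
rewrite (dist_bump_test x lp1 d0 dr); congr (_ * _).
exact: green_alg1 e0 e1 (congr1 (dist psi1) (grad_test_curl x d0 r0)).
Qed.

(** As for psi1, except that the mass term leaves a pairing of psi1 with the
    gradient of [log_test], which the first equation converts into one of f0
    with [log_test]. *)
Lemma green_psi0 d r x : 0 < d -> d <= r ->
  dist psi0 (bump_test d r x) = m%:C * dist f0 (log_test d r x) +
     (- 2^-1)%:C * ('i * (dist f1 (grad_test 0 d r x) - 'i * dist f1 (grad_test 1 d r x))).
Proof.
move=> d0 dr; have r0 := lt_le_trans d0 dr.
have e0 := E1 (grad_test_test_fun 0 x d0 dr); have e1 := E1 (grad_test_test_fun 1 x d0 dr).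
have eL := E0 (log_test_test_fun x d0 dr).
have lT j : dist psi1 (pd j (log_test d r x)) = - dist psi1 (grad_test j d r x).
  have h : pairable psi1 (grad_test j d r x) by apply: test_pairable => //; exact: grad_test_test_fun.
  have -> : pd j (log_test d r x) = fun y => (-1) * grad_test j d r x y.
    by apply/funext => y; rewrite (pd_log_test j x y d0 r0) mulN1r.
  by rewrite (distZ (-1) h) rmorphN rmorph1 mulN1r.
have m2 : (2 * m)%:C = 2 * m%:C by rewrite rmorphM/= rmorphMn rmorph1.
rewrite (dist_bump_test x lp0 d0 dr).
exact: green_alg0 e0 e1 eL (lT 0) (lT 1) m2 (congr1 (dist psi0) (grad_test_curl x d0 r0)).
Qed.

End RadialIdentities.

(** * Size and mass of the regularised kernels *)

Section RadialBounds. Context {R : realType}.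
Implicit Types (d r : R) (x y u : plane R).

Lemma sqnorm_enorm u : sqnorm u = enorm u ^+ 2. Proof. by rewrite enorm_sqr. Qed.

Lemma sqnormB x y : sqnorm (x - y) = sqnorm (y - x).
Proof. by rewrite !sqnorm_enorm enormB. Qed.

Lemma sqnorm_out d u : 0 <= d -> d <= enorm u -> d ^+ 2 <= sqnorm u.
Proof. by move=> d0 h; rewrite sqnorm_enorm lerXn2r// ?nnegrE// enorm_ge0. Qed.

Lemma grad_ker_le j d u : 0 < d -> `|grad_ker j d u| <= 25 * (enorm u)^-1.
Proof.
move=> d0; have e0 := enorm_ge0 u; have [ez|en] := eqVneq (enorm u) 0.
  have cz : coord j u = 0 by apply/eqP; rewrite -normr_le0 (le_trans (coord_le j u))// ez.
  by rewrite /grad_ker cz mul0r normr0 mulr_ge0// invr_ge0.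
have ep : 0 < enorm u by rewrite lt0r en.
rewrite /grad_ker normrM; apply: (@le_trans _ _ (enorm u * (25 / enorm u ^+ 2))).
  apply: ler_pM => //; first exact: coord_le.
  apply: le_trans (dlog_le d0 (sqnorm_ge0 u)) _; rewrite ler_pM2l// lef_pV2 ?posrE ?rsq_gt0 ?sqnorm_ge0 ?exprn_gt0//.
  by rewrite -sqnorm_enorm; exact: rsq_ge.
by rewrite le_eqVlt; apply/orP; left; apply/eqP; field.
Qed.

Lemma grad_ker_growth j d u : 0 < d -> `|grad_ker j d u| <= 25 * expR 2 / d ^+ 2 * enorm u.
Proof.
move=> d0; have d20 : 0 < d ^+ 2 by rewrite exprn_gt0.
rewrite /grad_ker normrM mulrC; apply: ler_pM => //; last exact: coord_le.
apply: le_trans (dlog_le d0 (sqnorm_ge0 u)) _; rewrite -mulrA ler_pM2l//.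
rewrite -[leRHS]invrK lef_pV2 ?posrE ?rsq_gt0 ?sqnorm_ge0 ?invr_gt0 ?divr_gt0 ?expR_gt0//.
by rewrite invfM invrK -expRN; apply: rsq_ge_sqr => //; exact: sqnorm_ge0.
Qed.

Lemma grad_ker_out j d u : 0 < d -> d <= enorm u -> grad_ker j d u = grad_ln j u.
Proof. by move=> d0 h; rewrite /grad_ker dlog_out ?sqnorm_out ?(ltW d0)// sqnorm_enorm. Qed.

Lemma log_ker_out d u : 0 < d -> d <= enorm u -> log_ker d u = ln_norm u.
Proof.
move=> d0 h; rewrite /log_ker rsq_out ?sqnorm_out ?(ltW d0)// lnkE//.
apply: contraTneq h => ->; rewrite -ltNge.
by rewrite /enorm /= expr0n /= addr0 sqrtr0.
Qed.

Lemma ln_sqnorm_half u : u != 0 -> 2^-1 * ln (sqnorm u) = ln_norm u. Proof. by move=> u0; rewrite lnkE. Qed.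

Lemma sqnorm_gt0 u : u != 0 -> 0 < sqnorm u.
Proof.
move=> u0; rewrite lt0r sqnorm_ge0 andbT sqnorm_enorm sqrf_eq0.
by apply: contra_neq u0 => /enorm0.
Qed.

Lemma half_ln1_le (e : R) : 0 <= e -> 2^-1 * ln (1 + e ^+ 2) <= e.
Proof.
move=> e0; rewrite ler_pdivrMl//; apply: (@le_trans _ _ (ln ((1 + e) ^+ 2))).
  rewrite ler_ln ?posrE ?exprn_gt0 ?ltr_pwDl// ?sqr_ge0//.
  by rewrite sqrrD expr1n mul1r; nra.
have h : ln (1 + e) <= e by apply: le_ln1Dx; lra.
by rewrite lnXn ?ltr_pwDl// mulr2n; lra.
Qed.

(** As s <= rsq <= s + 1, the kernel lies between ln|u| and (1/2) ln(1 +
    |u|^2), and the latter is at most |u|. *)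
Lemma log_ker_le d u : 0 < d -> d <= 1 -> u != 0 -> `|log_ker d u| <= ker_majorant u.
Proof.
move=> d0 d1 u0; have s0 := sqnorm_gt0 u0; have q0 := rsq_gt0 d0 (ltW s0).
have := ln_norm_ker_bound (R := R); case=> _ /(_ u); rewrite mul1r ler_norml => /andP[lb _].
rewrite ler_norml; apply/andP; split.
  apply: le_trans lb _; rewrite -(ln_sqnorm_half u0) /log_ker ler_pM2l// ler_ln ?posrE//.
  exact: rsq_ge.
apply: (@le_trans _ _ (enorm u)); last by rewrite /ker_majorant lerDr addr_ge0 ?sqr_ge0.
have p1 : 0 < 1 + sqnorm u by rewrite ltr_pwDl// ltW.
apply: le_trans (half_ln1_le (enorm_ge0 u)); rewrite -sqnorm_enorm /log_ker ler_pM2l// ler_ln ?posrE//.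
apply: le_trans (rsq_le d0 (ltW s0)) _; rewrite addrC lerD2r expr_le1// ltW//.
Qed.

(** Subtracting ln r leaves a kernel that converges to a constant as r grows,
    with a bound uniform in r >= 1. *)
Definition scaled_log_ker r u : R := 2^-1 * ln (rsq r (sqnorm u) / r ^+ 2).

Lemma log_ker_scaled_log_ker r u : 0 < r -> log_ker r u = ln r + scaled_log_ker r u.
Proof.
move=> r0; have q0 := rsq_gt0 r0 (sqnorm_ge0 u); have r20 : 0 < r ^+ 2 by rewrite exprn_gt0.
rewrite /scaled_log_ker /log_ker ln_div ?posrE// lnXn// mulr2n; by field.
Qed.

Lemma scaled_log_ker_le r u : 0 < r -> `|scaled_log_ker r u| <= 1 + enorm u / r.
Proof.
move=> r0; have q0 := rsq_gt0 r0 (sqnorm_ge0 u); have r20 : 0 < r ^+ 2 by rewrite exprn_gt0.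
have e0 : 0 <= enorm u / r by rewrite divr_ge0 ?enorm_ge0// ltW.
rewrite ler_norml /scaled_log_ker; apply/andP; split.
  apply: (@le_trans _ _ (2^-1 * ln (expR (-2)))); first by rewrite expRK; lra.
  rewrite ler_pM2l// ler_ln ?posrE ?expR_gt0 ?divr_gt0// ler_pdivlMr//.
  by apply: rsq_ge_sqr => //; exact: sqnorm_ge0.
apply: (@le_trans _ _ (enorm u / r)); last by rewrite lerDr.
have p1 : 0 < 1 + (enorm u / r) ^+ 2 by rewrite ltr_pwDl// sqr_ge0.
apply: le_trans (half_ln1_le e0); rewrite ler_pM2l// ler_ln ?posrE ?divr_gt0//.
rewrite ler_pdivrMr//; apply: le_trans (rsq_le r0 (sqnorm_ge0 u)) _.
rewrite sqnorm_enorm le_eqVlt; apply/orP; left; apply/eqP; field; exact: lt0r_neq0.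
Qed.

Lemma bump_cst_ge0 : 0 <= bump_cst :> R.
Proof. by rewrite /bump_cst; have := expR_ge0 (2 : R); lra. Qed.

Lemma bump_ker_box d x y : 0 < d -> `|bump_ker d (x - y)| <= bump_cst / d ^+ 2 * \1_(box x d) y.
Proof.
move=> d0; have [h|h] := ltP (sqnorm (x - y)) (d ^+ 2).
  rewrite indicE mem_set ?mulr1; last exact: sqnorm_box.
  by apply: bump_profile_le => //; exact: sqnorm_ge0.
by rewrite /bump_ker bump_profile_out// normr0 mulr_ge0// divr_ge0 ?sqr_ge0 ?bump_cst_ge0.
Qed.

Lemma bump_kerB d x y : bump_ker d (x - y) = bump_ker d (y - x). Proof. by rewrite /bump_ker sqnormB. Qed.

Lemma elementary_hess_ker i j d x : 0 < d -> elementary (fun y => hess_ker i j d (x - y)).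
Proof.
move=> d0; rewrite (_ : (fun y => _) = fun y => (-1) * pd i (fun y => grad_ker j d (x - y)) y).
  by apply: elementaryM; [exact: elementary_cst|apply: elementary_pd; exact: elementary_grad_ker].
by apply/funext => y; rewrite (pd_grad_ker i j x y d0) mulN1r opprK.
Qed.

Lemma elementary_bump_ker d x : 0 < d -> elementary (fun y => bump_ker d (x - y)).
Proof.
move=> d0; rewrite (_ : (fun y => _) = fun y => 2^-1 * (hess_ker 0 0 d (x - y) + hess_ker 1 1 d (x - y))).
  by apply: elementaryM; [exact: elementary_cst|apply: elementaryD; exact: elementary_hess_ker].
by apply/funext => y; rewrite hess_ker_trace; field.
Qed.

Lemma elementary_measurable (k : plane R -> R) : (forall x, elementary (fun y => k (x - y))) ->
  measurable_fun [set: mplane R] k.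
Proof.
move=> ek; have h : measurable_fun [set: mplane R] (fun y : mplane R => k (0 - y)).
  by apply: continuous_mplane; apply: diff_cont; exact: elementary_diff.
have := measurable_shift 0 h; apply: eq_measurable_fun => y _ /=.
by rewrite !sub0r opprK.
Qed.

Lemma measurable_grad_ker j d : 0 < d -> measurable_fun [set: mplane R] (grad_ker j d).
Proof. by move=> d0; apply: elementary_measurable => x; exact: elementary_grad_ker. Qed.

Lemma measurable_log_ker d : 0 < d -> measurable_fun [set: mplane R] (log_ker d).
Proof. by move=> d0; apply: elementary_measurable => x; exact: elementary_log_ker. Qed.

Lemma measurable_bump_ker d : 0 < d -> measurable_fun [set: mplane R] (bump_ker d).
Proof. by move=> d0; apply: elementary_measurable => x; exact: elementary_bump_ker. Qed.

Lemma measurable_scaled_log_ker r : 0 < r -> measurable_fun [set: mplane R] (scaled_log_ker r).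
Proof.
move=> r0; apply: elementary_measurable => x; apply: elementaryM; first exact: elementary_cst.
apply: elementary_ln => [|y]; last by rewrite divr_gt0 ?exprn_gt0// rsq_gt0// sqnorm_ge0.
by apply: elementaryM; [exact: elementary_rsq|exact: elementary_cst].
Qed.

Lemma bump_ker_mass_le d x : 0 < d -> (\int[mu2 R]_y (`|bump_ker d (x - y)|)%:E <= (4 * bump_cst)%:E)%E.
Proof.
move=> d0; have d20 : 0 < d ^+ 2 by rewrite exprn_gt0.
have c0 : 0 <= bump_cst / d ^+ 2 by rewrite divr_ge0 ?bump_cst_ge0// ltW.
apply: (@le_trans _ _ (\int[mu2 R]_y (bump_cst / d ^+ 2 * \1_(box x d) y)%:E)%E).
  apply: mu2_le => [|||y]; rewrite ?lee_fin ?bump_ker_box//.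
  - apply/measurable_EFinP; apply: measurableT_comp => //.
    by apply: measurable_shift; exact: measurable_bump_ker.
  - apply/measurable_EFinP; apply: measurable_funM => //; apply: measurable_indic; exact: box_measurable.
under eq_integral do rewrite EFinM.
rewrite ge0_integralZl_EFin//; last first.
  by apply/measurable_EFinP; apply: measurable_indic; exact: box_measurable.
rewrite integral_indic ?setIT//; last exact: box_measurable.
rewrite mu2_box ?(ltW d0)// -EFinM lee_fin le_eqVlt; apply/orP; left; apply/eqP.
by field; exact: lt0r_neq0.
Qed.

Definition other_coord (i : 'I_2) (x : plane R) : R := if i == 0 then x.2 else x.1.

(** Both edges of the square lie outside the disc of radius d, where the
    regularised field is u_j/|u|^2. *)
Lemma grad_ker_edge i d (x : plane R) (t : R) (e : R) : 0 < d -> e ^+ 2 = 1 ->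
  grad_ker i d (x - slice i t (coord i x - e * d)) =
  e * d / (d ^+ 2 + (other_coord i x - t) ^+ 2).
Proof.
move=> d0 e1; have d20 : 0 < d ^+ 2 by rewrite exprn_gt0.
have ed : (e * d) ^+ 2 = d ^+ 2 by rewrite exprMn e1 mul1r.
have eq : sqnorm (x - slice i t (coord i x - e * d)) = d ^+ 2 + (other_coord i x - t) ^+ 2.
  by case: (I2_cases i) => ->; rewrite -ed /sqnorm /slice /coord /other_coord /=; ring.
rewrite /grad_ker eq dlog_out// ?lerDl ?sqr_ge0//; congr (_ / _).
by case: (I2_cases i) => ->; rewrite /slice /coord /=; ring.
Qed.

Notation mu := (@lebesgue_measure R).

(** The fundamental theorem of calculus along a line: the second derivative of
    the kernel integrates to the difference of the edge values, which is also
    the integral of the constant 1/(d^2 + t^2) over a segment of length 2 d. *)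
Lemma hess_ker_line i d x t : 0 < d ->
  (\int[mu]_(s in `[(coord i x - d)%R, (coord i x + d)%R])
     (hess_ker i i d (x - slice i t s) - (d ^+ 2 + (other_coord i x - t) ^+ 2)^-1)%:E = 0)%E.
Proof.
move=> d0; set q := _^-1.
pose H (s : R) : R := - grad_ker i d (x - slice i t s) - q * s.
have hd (s : R) : is_derive s 1 H (hess_ker i i d (x - slice i t s) - q).
  (* The sign changes because the kernel is evaluated at x - y and
     differentiated in y. *)
  have h := is_deriveN (slice_derive (elementary_diff (elementary_grad_ker i x d0) (slice i t s))).
  have h2 := is_derive_mul (is_derive_cst q s 1) (is_derive_id s 1).
  apply: (is_derive_eq (is_deriveB h h2)).
  by rewrite (pd_grad_ker i i x _ d0) opprK /= mul0r add0r mulr1.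
have hc : continuous (fun s => hess_ker i i d (x - slice i t s) - q).
  move=> s; apply: cvgB; last exact: cvg_cst.
  apply: (@slice_cont _ (fun y => hess_ker i i d (x - y))); apply: diff_cont; apply: elementary_diff.
  exact: elementary_hess_ker.
have lt : coord i x - d < coord i x + d by lra.
rewrite (ftc_int lt hd hc) /H; have := grad_ker_edge i x t d0 (expr1n R 2); rewrite mul1r => ->.
have m1 : (-1 : R) ^+ 2 = 1 by rewrite sqrrN expr1n.
have := grad_ker_edge i x t d0 m1; rewrite mulN1r opprK => ->.
by congr (_%:E); rewrite -/q; ring.
Qed.

(** The flux of u/|u|^2 through two opposite sides of a square: four times the
    arctangent of 1. *)
Lemma atan_line d (x2 : R) : 0 < d ->
  (\int[mu]_(t in `[(x2 - d)%R, (x2 + d)%R]) (2 * d / (d ^+ 2 + (x2 - t) ^+ 2))%:E = pi%:E)%E.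
Proof.
move=> d0; have dn := lt0r_neq0 d0; have d20 : 0 < d ^+ 2 by rewrite exprn_gt0.
have den t : d ^+ 2 + (x2 - t) ^+ 2 != 0 by rewrite gt_eqF// ltr_pwDl// sqr_ge0.
pose H (t : R) : R := 2 * atan ((t - x2) / d).
have hd (t : R) : is_derive t 1 H (2 * d / (d ^+ 2 + (x2 - t) ^+ 2)).
  have h1 : is_derive t 1 (fun t : R => (t - x2) / d) d^-1.
    have := is_derive_mul (is_deriveB (is_derive_id t 1) (is_derive_cst x2 t 1)) (is_derive_cst d^-1 t 1).
    by move=> h; apply: (is_derive_eq h); rewrite /= mulr0 addr0 subr0 mul1r.
  have h2 := is_derive1_comp (f := atan) (g := fun t : R => (t - x2) / d) (is_derive1_atan _) h1.
  have h3 := is_derive_mul (is_derive_cst (2 : R) t 1) h2.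
  apply: (is_derive_eq h3); rewrite /= mul0r add0r.
  have -> : d ^+ 2 + (x2 - t) ^+ 2 = d ^+ 2 * (1 + ((t - x2) / d) ^+ 2) by field.
  by field; rewrite dn /= gt_eqF// ltr_pwDl// sqr_ge0.
have hc : continuous (fun t => 2 * d / (d ^+ 2 + (x2 - t) ^+ 2)).
  move=> t; apply: cvgM; first exact: cvg_cst.
  apply: cvgV => //; apply: cvgD; first exact: cvg_cst.
  by apply: cvgM; (apply: cvgB; [exact: cvg_cst|exact: cvg_id]).
have lt : x2 - d < x2 + d by lra.
rewrite (ftc_int lt hd hc); congr (_%:E).
rewrite /H (_ : (x2 + d - x2) / d = 1); last by field.
rewrite (_ : (x2 - d - x2) / d = - 1); last by field.
by rewrite atanN atan1; field.
Qed.

Lemma indic_slice i d x (t s : R) : \1_(box x d) (slice i t s) =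
  \1_(`[coord i x - d, coord i x + d]%classic) s * \1_(`[other_coord i x - d, other_coord i x + d]%classic) t :> R.
Proof.
rewrite -(mulr1n (_ * _)) !indicE /box.
by case: (I2_cases i) => ->; rewrite /slice /coord /other_coord/= in_setX/=; case: (s \in _); case: (t \in _);
  rewrite ?mulr1 ?mulr0 ?mul0r.
Qed.

Lemma L1_box x d : 0 <= d -> L1 (\1_(box x d) : mplane R -> R).
Proof.
move=> d0; apply/L1P; split; first by apply: measurable_indic; exact: box_measurable.
under eq_integral do rewrite ger0_norm//.
by rewrite integral_indic ?setIT ?mu2_box ?ltry//; exact: box_measurable.
Qed.

Lemma continuous_box_L1 (g : plane R -> R) x d : 0 <= d -> continuous g ->
  L1 (fun y : mplane R => \1_(box x d) y * g y).
Proof.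
move=> d0 cg; have [B [_ hB]] : bounded_set (g @` box x d).
  apply: compact_bounded; apply: continuous_compact; last exact: box_compact.
  exact: continuous_subspaceT.
apply: (@L1_le _ _ (fun y => (`|B| + 1) * \1_(box x d) y)); last by apply: L1Z; exact: L1_box.
  apply: measurable_funM; first by apply: measurable_indic; exact: box_measurable.
  exact: continuous_mplane.
move=> y; rewrite indicE; have [h|_] := boolP (y \in box x d); last by rewrite mul0r normr0 mulr0.
rewrite mul1r mulr1; apply: (hB (`|B| + 1)).
  by rewrite (le_lt_trans (ler_norm _))// ltrDl.
by exists y => //; rewrite inE in h.
Qed.

Lemma mu2_slices i (F : mplane R -> R) : measurable_fun [set: mplane R] F -> (forall y, 0 <= F y) ->
  (\int[mu2 R]_y (F y)%:E = \int[mu]_t \int[mu]_s (F (slice i t s))%:E)%E.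
Proof.
move=> mF F0; case: (I2_cases i) => ->.
  by rewrite mu2_tonelli'//; exact/measurable_EFinP.
by rewrite mu2_tonelli//; exact/measurable_EFinP.
Qed.

(** Constant along the i-th direction and comparable with a diagonal Hessian
    entry line by line; its integral is explicit. *)
Definition poisson_ker i d x y : R := (d ^+ 2 + (other_coord i x - other_coord i y) ^+ 2)^-1.

Lemma continuous_other_coord i : continuous (other_coord i : plane R -> R).
Proof. by move=> y; rewrite /other_coord; case: (i == 0); [exact: cvg_snd|exact: cvg_fst]. Qed.

Lemma poisson_ker_cont i d x : 0 < d -> continuous (poisson_ker i d x).
Proof.
move=> d0 y; apply: cvgV; first by rewrite gt_eqF// ltr_pwDl ?exprn_gt0// sqr_ge0.
apply: cvgD; first exact: cvg_cst.
by apply: cvgM; (apply: cvgB; [exact: cvg_cst|exact: continuous_other_coord]).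
Qed.

Lemma poisson_ker_mass i d x : 0 < d -> \int[mu2 R]_y (\1_(box x d) y * poisson_ker i d x y) = pi.
Proof.
move=> d0; rewrite /Rintegral; rewrite (@mu2_slices i); last 2 first.
- have := continuous_box_L1 x (ltW d0) (@poisson_ker_cont i d x d0); by case/L1P.
- by move=> y; apply: mulr_ge0 => //; rewrite invr_ge0 addr_ge0// sqr_ge0.
rewrite -[RHS]/(fine pi%:E) -(atan_line (other_coord i x) d0) [in RHS]integral_mkcond; congr fine.
apply: eq_integral => t _; rewrite patchE.
have qs s : poisson_ker i d x (slice i t s) = (d ^+ 2 + (other_coord i x - t) ^+ 2)^-1.
  by rewrite /poisson_ker /other_coord /slice; case: (i == 0).
have [h|h] := boolP (t \in _); last first.
  by apply: integral0_eq => s _; rewrite indic_slice [X in _ * X * _]indicE (negbTE h) mulr0 mul0r.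
under eq_integral do rewrite indic_slice [X in _ * X * _]indicE h mulr1 qs mulrC EFinM.
rewrite ge0_integralZl_EFin//; last 2 first.
- by apply/measurable_EFinP; apply: measurable_indic.
- by rewrite invr_ge0 addr_ge0// sqr_ge0.
rewrite integral_indic// setIT.
have e : mu `[(coord i x - d)%R, (coord i x + d)%R]%classic = (2 * d)%:E.
  by rewrite lebesgue_measure_itv/= lte_fin ifT -?EFinB; [congr (_%:E); lra|lra].
transitivity (((d ^+ 2 + (other_coord i x - t) ^+ 2)^-1)%:E * (2 * d)%:E)%E.
  by congr (_ * _)%E; exact: e.
by rewrite -EFinM mulrC.
Qed.

(** Line by line the integrals of the Hessian entry and of [poisson_ker] agree.
    *)
Lemma hess_ker_mass i d x : 0 < d -> \int[mu2 R]_y (\1_(box x d) y * hess_ker i i d (x - y)) = pi.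
Proof.
move=> d0; have cG : continuous (fun y => hess_ker i i d (x - y)).
  by apply: diff_cont; apply: elementary_diff; exact: elementary_hess_ker.
have i1 := continuous_box_L1 x (ltW d0) cG.
have i2 := continuous_box_L1 x (ltW d0) (@poisson_ker_cont i d x d0).
rewrite -(poisson_ker_mass i x d0); apply/eqP; rewrite -subr_eq0 -RintegralB//; apply/eqP.
apply: (@mu2_slices0 _ i _ 0).
  have -> : (fun y : mplane R => \1_(box x d) y * hess_ker i i d (x - y) - \1_(box x d) y * poisson_ker i d x y) =
    fun y => \1_(box x d) y * hess_ker i i d (x - y) + (-1) * (\1_(box x d) y * poisson_ker i d x y).
    by apply/funext => y; rewrite mulN1r.
  by apply: L1D => //; exact: L1Z.
move=> t _.
have qs s : poisson_ker i d x (slice i t s) = (d ^+ 2 + (other_coord i x - t) ^+ 2)^-1.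
  by rewrite /poisson_ker /other_coord /slice; case: (i == 0).
have [h|h] := boolP (t \in `[other_coord i x - d, other_coord i x + d]%classic); last first.
  apply: integral0_eq => s _.
  have h0 : \1_(`[other_coord i x - d, other_coord i x + d]%classic) t = 0 :> R by rewrite indicE (negbTE h).
  by rewrite indic_slice h0 mulr0 !mul0r subrr.
apply: eq_trans (hess_ker_line i x t d0); rewrite [RHS]integral_mkcond.
have h1 : \1_(`[other_coord i x - d, other_coord i x + d]%classic) t = 1 :> R by rewrite indicE h.
apply: eq_integral => s _; rewrite patchE qs indic_slice h1 mulr1 indicE.
by case: (s \in _); rewrite ?mul1r ?mul0r ?subrr.
Qed.

(** Half the trace of the Hessian: each diagonal entry has integral pi over the
    square of radius d. *)
Lemma bump_ker_mass d x : 0 < d -> \int[mu2 R]_y bump_ker d (x - y) = pi.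
Proof.
move=> d0; have c i : continuous (fun y => hess_ker i i d (x - y)).
  by apply: diff_cont; apply: elementary_diff; exact: elementary_hess_ker.
have ii i := continuous_box_L1 x (ltW d0) (c i).
have e (y : mplane R) : bump_ker d (x - y) = 2^-1 * (\1_(box x d) y * hess_ker 0 0 d (x - y) + \1_(box x d) y * hess_ker 1 1 d (x - y)).
  rewrite -mulrDr hess_ker_trace [RHS](_ : _ = \1_(box x d) y * bump_ker d (x - y)); last by field.
  rewrite indicE; have [h|h] := boolP (y \in box x d); first by rewrite mul1r.
  have := bump_ker_box x y d0; rewrite indicE (negbTE h) mulr0 normr_le0 => /eqP ->.
  by rewrite mulr0.
under eq_Rintegral do rewrite e.
rewrite RintegralZl_total; last by case/L1P: (L1D (ii 0) (ii 1)).
by rewrite RintegralD// !hess_ker_mass//; field.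
Qed.

End RadialBounds.

(** * The outer radius tends to infinity *)

Section FarLimit. Context {R : realType}.
Implicit Types (d r : R) (x y u : plane R) (f g : plane R -> R[i]).

Lemma cvgC0P (u : nat -> R[i]) :
  (forall e : R, 0 < e -> exists N : nat, forall n, (N <= n)%N -> cmod (u n) <= e) -> cvgC u 0.
Proof.
move=> h; split => /=; apply/cvgr0Pnorm_le => e e0; have [N hN] := h _ e0;
  exists N => // n /= Nn; apply: le_trans (hN n Nn); [exact: Re_cmod|exact: Im_cmod].
Qed.

Lemma enormB_growth x y : enorm (x - y) <= (2 * enorm x + 2) * (1 + enorm y).
Proof.
apply: le_trans (enormD x (- y)) _; rewrite enormN.
by have := enorm_ge0 x; have := enorm_ge0 y; nra.
Qed.

Lemma pairable_growth f (k : mplane R -> R) (A B : R) x : moment2 f -> measurable_fun [set: mplane R] k -> 0 <= A -> 0 <= B ->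
  (forall u, `|k u| <= A + B * enorm u) ->
  pairable f (fun y => (A + B * (2 * enorm x + 2)) * (1 + enorm y)) /\
  forall y, `|k (x - y)| <= (A + B * (2 * enorm x + 2)) * (1 + enorm y).
Proof.
move=> sf mk A0 B0 hk; split; first by apply: pairableZ; exact: moment2_pairable1.
move=> y; apply: le_trans (hk _) _; rewrite mulrDl; apply: lerD.
  by rewrite ler_peMr// lerDl enorm_ge0.
by rewrite -mulrA ler_wpM2l// enormB_growth.
Qed.

Lemma growth_pairable f (k : mplane R -> R) (A B : R) x : moment2 f -> measurable_fun [set: mplane R] k -> 0 <= A -> 0 <= B ->
  (forall u, `|k u| <= A + B * enorm u) -> pairable f (fun y => k (x - y)).
Proof.
move=> sf mk A0 B0 hk; have [h1 h2] := pairable_growth x sf mk A0 B0 hk.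
apply: pairable_le h1 _ _; first exact: measurable_shift.
by move=> y; apply: le_trans (h2 y) _; exact: ler_norm.
Qed.

(** One moment of the source dominates kernels of at most linear growth. *)
Lemma growth_cvg f (k_ : nat -> mplane R -> R) (k : mplane R -> R) (A B : R) x : moment2 f ->
  (forall n, measurable_fun [set: mplane R] (k_ n)) -> measurable_fun [set: mplane R] k -> 0 <= A -> 0 <= B ->
  (forall n u, `|k_ n u| <= A + B * enorm u) ->
  (forall u, (fun n => k_ n u) @ \oo --> k u) ->
  cvgC (fun n => dist f (fun y => k_ n (x - y))) (dist f (fun y => k (x - y))).
Proof.
move=> sf mk_ mk A0 B0 hk hc.
have [h1 _] := pairable_growth x sf (mk_ 0) A0 B0 (hk 0).
apply: dist_cvg h1 => [n|||].
- exact: (measurable_shift x (mk_ n)).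
- exact: (measurable_shift x mk).
- by apply: aeW => y; exact: hc.
- by apply: aeW => y n; exact: (pairable_growth x sf (mk_ n) A0 B0 (hk n)).2.
Qed.

Lemma cvg_invn : (fun n => (n.+1%:R : R)^-1) @ \oo --> (0 : R).
Proof. exact: cvg_harmonic. Qed.

Lemma grad_ker_growth1 j (n : nat) u : `|grad_ker j n.+1%:R u| <= 0 + 25 * expR 2 * enorm u.
Proof.
rewrite add0r; apply: le_trans (grad_ker_growth j u (ltr0Sn _ n)) _.
rewrite ler_wpM2r ?enorm_ge0// ler_pdivrMr ?exprn_gt0// ler_peMr ?mulr_ge0 ?expR_ge0//.
by rewrite exprn_ege1// ler1n.
Qed.

Lemma dist0 f : dist f (fun=> 0) = 0.
Proof.
rewrite distE; under eq_Rintegral do rewrite mulr0.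
under [X in _ +i* X]eq_Rintegral do rewrite mulr0.
by rewrite /Rintegral integral0.
Qed.

Lemma grad_ker_lim f j x : moment2 f ->
  cvgC (fun n => dist f (fun y => grad_ker j n.+1%:R (x - y))) 0.
Proof.
move=> sf; rewrite -(dist0 f).
have c0 : 0 <= 25 * expR 2 :> R by rewrite mulr_ge0 ?expR_ge0.
apply: (@growth_cvg f (fun n => grad_ker j n.+1%:R) (fun=> 0) 0 (25 * expR 2) x) => //.
- by move=> n; exact: measurable_grad_ker.
- by move=> n u; exact: grad_ker_growth1.
- move=> u; apply/cvgr0Pnorm_le.
  have h : (fun n => 25 * expR 2 * enorm u * ((n.+1%:R : R)^-1 * (n.+1%:R : R)^-1)) @ \oo --> (0 : R).
    rewrite -[X in _ --> X](mulr0 (25 * expR 2 * enorm u)); apply: cvgM; first exact: cvg_cst.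
    by rewrite -[X in _ --> X](mulr0 0); apply: cvgM; exact: cvg_invn.
  move/cvgr0Pnorm_le : h => h e e0; have := h e e0; apply: filterS => n /= hn.
  apply: le_trans hn; apply: le_trans (grad_ker_growth j u (ltr0Sn _ n)) _.
  rewrite [leRHS]ger0_norm; last by rewrite !mulr_ge0 ?expR_ge0 ?enorm_ge0.
  by rewrite expr2 invfM le_eqVlt; apply/orP; left; apply/eqP; ring.
Qed.

(** What a sum of functions in Lebesgue spaces of finite exponents has in
    common: up to an integrable error it is uniformly as small as desired. *)
Definition vanishing g := cmeasurable g /\ forall tau : R, 0 < tau ->
  exists2 h : mplane R -> R, L1 h & forall x, cmod (g x) <= tau + h x.

(** The bump at radius r has bounded mass and is at most a constant over r^2:
    the small part of g contributes at most a multiple of tau, the integrable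
    part tends to 0. *)
Lemma bump_ker_lim g x : vanishing g -> (forall n : nat, pairable g (fun y => bump_ker n.+1%:R (x - y))) ->
  cvgC (fun n => dist g (fun y => bump_ker n.+1%:R (x - y))) 0.
Proof.
move=> [mg hg] di; apply: cvgC0P => e e0.
have cb1 : 0 < 16 * bump_cst + 1 :> R by have := @bump_cst_ge0 R; lra.
(* The small part contributes at most 2 tau 4 bump_cst, the factor 2 being that
   of dist_bound; this choice of tau makes it at most e/2. *)
have [h ih hh] := hg (e / (16 * bump_cst + 1)) (divr_gt0 e0 cb1).
have [mh Ih] := (L1P _).1 ih.
set I := (\int[mu2 R]_x (`|h x|)%:E)%E in Ih.
have I0 : (0 <= I)%E by apply: integral_ge0 => y _; rewrite lee_fin.
have If : I \is a fin_num by rewrite ge0_fin_numE.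
have [N hN] : exists N : nat, forall n, (N <= n)%N -> 2 * (bump_cst / n.+1%:R ^+ 2 * fine I) <= e / 2.
  have : (fun n => 2 * bump_cst * fine I * ((n.+1%:R : R)^-1 * (n.+1%:R : R)^-1)) @ \oo --> (0 : R).
    rewrite -[X in _ --> X](mulr0 (2 * bump_cst * fine I)); apply: cvgM; first exact: cvg_cst.
    by rewrite -[X in _ --> X](mulr0 0); apply: cvgM; exact: cvg_invn.
  move/cvgr0Pnorm_le => /(_ _ (divr_gt0 e0 (ltr0Sn _ 1))) [N _ hN]; exists N => n Nn.
  apply: le_trans (hN n Nn); apply: le_trans (ler_norm _).
  by rewrite expr2 invfM le_eqVlt; apply/orP; left; apply/eqP; ring.
exists N => n Nn; have r0 : 0 < n.+1%:R :> R by rewrite ltr0n.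
rewrite -lee_fin; apply: le_trans (dist_bound (di n)) _.
pose t := e / (16 * bump_cst + 1); have t0 : 0 <= t by rewrite divr_ge0 ?ltW.
pose q := bump_cst / n.+1%:R ^+ 2 : R; have q0 : 0 <= q by rewrite divr_ge0 ?bump_cst_ge0 ?sqr_ge0.
have mkb : measurable_fun [set: mplane R] (fun y : mplane R => `|bump_ker n.+1%:R (x - y)|).
  by apply: measurableT_comp => //; apply: measurable_shift; exact: measurable_bump_ker.
apply: (@le_trans _ _ (2%:E * \int[mu2 R]_y ((t * `|bump_ker n.+1%:R (x - y)|)%:E + (q * `|h y|)%:E))%E).
  apply: lee_wpmul2l => //; apply: mu2_le.
  - by apply/measurable_EFinP; apply: measurable_funM => //; exact: measurable_cmod.
  - by apply: emeasurable_funD; apply/measurable_EFinP; apply: measurable_funM => //; exact: measurableT_comp.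
  - by move=> y; rewrite lee_fin mulr_ge0 ?cmod_ge0.
  - move=> y; rewrite -EFinD lee_fin.
    apply: (@le_trans _ _ ((t + h y) * `|bump_ker n.+1%:R (x - y)|)); first by rewrite ler_wpM2r.
    rewrite mulrDl lerD2l mulrC; apply: (@le_trans _ _ (`|bump_ker n.+1%:R (x - y)| * `|h y|)).
      by rewrite ler_wpM2l// ler_norm.
    rewrite ler_wpM2r//; apply: le_trans (bump_ker_box x y r0) _.
    by rewrite -[leRHS]mulr1 ler_wpM2l// indicE; case: (_ \in _).
rewrite ge0_integralD//; last 4 first.
- by move=> y _; rewrite lee_fin mulr_ge0.
- by apply/measurable_EFinP; apply: measurable_funM.
- by move=> y _; rewrite lee_fin mulr_ge0.
- by apply/measurable_EFinP; apply: measurable_funM => //; exact: measurableT_comp.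
under eq_integral do rewrite EFinM.
under [X in (_ * (_ + X))%E]eq_integral do rewrite EFinM.
rewrite !ge0_integralZl_EFin//; last 2 first.
- by apply/measurable_EFinP; exact: measurableT_comp.
- by apply/measurable_EFinP.
rewrite -/I -(fineK If).
apply: (@le_trans _ _ (2%:E * (t%:E * (4 * bump_cst)%:E + q%:E * (fine I)%:E))%E).
  by apply: lee_wpmul2l => //; apply: leeD => //; apply: lee_wpmul2l; rewrite ?lee_fin//; exact: bump_ker_mass_le.
have h1 : 2 * (t * (4 * bump_cst)) <= e / 2.
  rewrite /t; move: (@bump_cst_ge0 R) cb1; move: (bump_cst : R) => b b0 b1.
  rewrite (_ : 2 * _ = e * (8 * b) / (16 * b + 1)); last by ring.
  by rewrite ler_pdivrMr//; move: b0 e0; nra.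
move: h1 (hN n Nn); rewrite -/q; move: (4 * bump_cst : R) (fine I) => b z h1 h2.
have e2 : (2%:E * (t%:E * b%:E + q%:E * z%:E))%E = (2 * (t * b) + 2 * (q * z))%:E.
  by rewrite -mulrDr.
by rewrite e2 lee_fin; move: h1 h2; lra.
Qed.

End FarLimit.

Section FarIdentities. Context {R : realType}.
Variables (m : R) (psi0 psi1 f0 f1 : plane R -> R[i]).
Implicit Types (d r : R) (x y u : plane R) (f g : plane R -> R[i]).
Hypotheses (lp0 : loc_int psi0) (lp1 : loc_int psi1).
Hypotheses (sf0 : moment2 f0) (sf1 : moment2 f1).
Hypothesis E0 : forall chi, test_fun chi ->
  'i * dist psi1 (pd 0 chi) + dist psi1 (pd 1 chi) + dist f0 chi = 0.
Hypothesis E1 : forall chi, test_fun chi ->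
  'i * dist psi0 (pd 0 chi) - dist psi0 (pd 1 chi) - (2 * m)%:C * dist psi1 chi + dist f1 chi = 0.
Variables (c : R[i]) (g0 g1 : plane R -> R[i]).
Hypotheses (dg0 : vanishing g0) (dg1 : vanishing g1).
Hypothesis p0 : {ae mu2 R, forall x, psi0 x = c + g0 x}.
Hypothesis p1 : {ae mu2 R, forall x, psi1 x = g1 x}.

Lemma loc_int_ae f g : cmeasurable g -> loc_int f -> {ae mu2 R, forall x, f x = g x} -> loc_int g.
Proof.
move=> mg lf fg; apply/loc_intP; split => // N N0.
have := lf; move/loc_intP => [_ /(_ N N0)] [mf mk lt]; split => //.
apply: le_lt_trans lt; rewrite le_eqVlt; apply/orP; left; apply/eqP.
apply: ae_eq_integral => //.
- by apply/measurable_EFinP; apply: measurable_funM; [exact: measurable_cmod|exact: measurableT_comp].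
- by apply/measurable_EFinP; apply: measurable_funM; [exact: measurable_cmod|exact: measurableT_comp].
- by apply: (ae_imp _ fg) => x fgx _; rewrite fgx.
Qed.

Lemma bump_ker_test_fun d x : 0 < d -> test_fun (fun y => bump_ker d (x - y)).
Proof.
move=> d0; apply: (@elementary_test _ _ x d); first exact: elementary_bump_ker.
move=> y; apply: contra_neqP => ny.
have := bump_ker_box x y d0; rewrite indicE memNset// mulr0 normr_le0 => /eqP ->//.
Qed.

Lemma bump_ker_pairable psi d x : loc_int psi -> 0 < d -> pairable psi (fun y => bump_ker d (x - y)).
Proof. by move=> lp d0; apply: test_pairable => //; exact: bump_ker_test_fun. Qed.

Lemma dist_diff f (k k' : mplane R -> R) : pairable f k -> pairable f k' ->
  dist f (fun y => k y + (-1) * k' y) = dist f k - dist f k'.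
Proof.
move=> h h'; rewrite distD//; last exact: pairableZ.
by rewrite (distZ (-1) h') rmorphN rmorph1 mulN1r.
Qed.

Lemma grad_ker_pairable f j d x : moment2 f -> 0 < d -> pairable f (fun y => grad_ker j d (x - y)).
Proof.
move=> sf d0; apply: (@growth_pairable _ f (grad_ker j d) 0 (25 * expR 2 / d ^+ 2) x) => //.
- exact: measurable_grad_ker.
- by rewrite divr_ge0 ?sqr_ge0// mulr_ge0// expR_ge0.
- by move=> u; rewrite add0r; exact: grad_ker_growth.
Qed.

Lemma scaled_log_ker_pairable f d x : moment2 f -> 0 < d -> pairable f (fun y => scaled_log_ker d (x - y)).
Proof.
move=> sf d0; apply: (@growth_pairable _ f (scaled_log_ker d) 1 d^-1 x) => //.
- exact: measurable_scaled_log_ker.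
- by rewrite invr_ge0 ltW.
- by move=> u; rewrite mulrC; exact: scaled_log_ker_le.
Qed.

(** The logarithm of the radius couples to the total integral of the source. *)
Lemma dist_log_ker f d x : moment2 f -> 0 < d ->
  pairable f (fun y => log_ker d (x - y)) /\
  dist f (fun y => log_ker d (x - y)) = (ln d)%:C * dist f (fun=> 1) + dist f (fun y => scaled_log_ker d (x - y)).
Proof.
move=> sf d0.
have e (y : mplane R) : log_ker d (x - y) = ln d * 1 + scaled_log_ker d (x - y) by rewrite mulr1 log_ker_scaled_log_ker.
have h1 := pairableZ (ln d) (moment2_pairable_const sf).
split; first by rewrite (funext e); apply: pairableD => //; exact: scaled_log_ker_pairable.
by rewrite (dist_ext f e) distD ?(distZ _ (moment2_pairable_const sf))//; exact: scaled_log_ker_pairable.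
Qed.

Lemma cvgCB (u w : nat -> R[i]) l l' : cvgC u l -> cvgC w l' -> cvgC (fun n => u n - w n) (l - l').
Proof.
move=> h1 h2; have := cvgCD h1 (cvgCZ (-1) h2); rewrite mulN1r.
by congr (cvgC _ _); apply/funext => n; rewrite mulN1r.
Qed.

Lemma bump_ker_const d x (z : R[i]) : 0 < d -> dist (fun=> z) (fun y => bump_ker d (x - y)) = z * pi%:C.
Proof.
move=> d0; have mk := measurable_shift x (measurable_bump_ker d0).
by rewrite distE !RintegralZl_total// bump_ker_mass//; apply: complex_ext; rewrite ?Re_mulC ?Im_mulC.
Qed.

Lemma bump_ker_lim1 x : cvgC (fun n => dist psi1 (fun y => bump_ker n.+1%:R (x - y))) 0.
Proof.
have mg := dg1.1; have lg := loc_int_ae mg lp1 p1.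
have := @bump_ker_lim _ g1 x dg1 (fun n => bump_ker_pairable x lg (ltr0Sn _ n)).
congr (cvgC _ _); apply/funext => n; apply/esym/dist_ae => //; first by case: lp1.
exact: measurable_shift (measurable_bump_ker _).
Qed.

(** The constant contributes its value times the mass of the bump, and the
    remainder averages to 0. *)
Lemma bump_ker_lim0 x : cvgC (fun n => dist psi0 (fun y => bump_ker n.+1%:R (x - y))) (c * pi%:C).
Proof.
have mg : cmeasurable (fun x => c + g0 x) by apply: cmeasurableD (cmeasurable_cst c) dg0.1.
have lg := loc_int_ae mg lp0 p0.
have lc : loc_int (fun=> c : R[i]).
  apply/loc_intP; split; first exact: cmeasurable_cst.
  move=> N N0; apply: L1_pairable; [exact: cmeasurable_cst|by apply: measurable_indic; exact: box_measurable|].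
  by apply: L1Z; exact: L1_box.
have l0 : loc_int g0.
  have := loc_intD lg (loc_intZ (-1) lc); congr (loc_int _); apply/funext => y; ring.
have := @bump_ker_lim _ g0 x dg0 (fun n => bump_ker_pairable x l0 (ltr0Sn _ n)).
move/(cvgCD (cvgC_cst (c * pi%:C))); rewrite addr0; congr (cvgC _ _); apply/funext => n.
rewrite -(bump_ker_const x c (ltr0Sn _ n)) -distDf; [|exact: bump_ker_pairable..].
apply/esym/dist_ae => //; first by case: lp0.
exact: measurable_shift (measurable_bump_ker _).
Qed.

Lemma dist_grad_test f j d r x : moment2 f -> 0 < d -> 0 < r ->
  dist f (grad_test j d r x) = dist f (fun y => grad_ker j d (x - y)) - dist f (fun y => grad_ker j r (x - y)).
Proof. by move=> sf d0 r0; rewrite dist_diff//; exact: grad_ker_pairable. Qed.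

Lemma dist_bump_diff f d r x : loc_int f -> 0 < d -> 0 < r ->
  dist f (bump_test d r x) = dist f (fun y => bump_ker d (x - y)) - dist f (fun y => bump_ker r (x - y)).
Proof. by move=> sf d0 r0; rewrite dist_diff//; exact: bump_ker_pairable. Qed.

(** The outer terms of the Green identity tend to 0. *)
Lemma psi1_mean d x : 0 < d -> d <= 1 ->
  dist psi1 (fun y => bump_ker d (x - y)) = (- 2^-1)%:C *
   ('i * (dist f0 (fun y => grad_ker 0 d (x - y)) + 'i * dist f0 (fun y => grad_ker 1 d (x - y)))).
Proof.
move=> d0 d1; set A := dist psi1 _; set T0 := dist f0 _; set T1 := dist f0 _.
have h (n : nat) : A = dist psi1 (fun y => bump_ker n.+1%:R (x - y)) + (- 2^-1)%:C * ('i *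
  ((T0 - dist f0 (fun y => grad_ker 0 n.+1%:R (x - y))) + 'i * (T1 - dist f0 (fun y => grad_ker 1 n.+1%:R (x - y))))).
  have r0 : 0 < n.+1%:R :> R by rewrite ltr0n.
  have dr : d <= n.+1%:R by apply: le_trans d1 _; rewrite ler1n.
  have := green_psi1 lp1 E0 x d0 dr.
  rewrite (dist_bump_diff x lp1 d0 r0) (dist_grad_test 0 x sf0 d0 r0) (dist_grad_test 1 x sf0 d0 r0) => <-.
  by rewrite addrC subrK.
have c1 : cvgC (fun=> A) A by exact: cvgC_cst.
have c2 : cvgC (fun=> A) (0 + (- 2^-1)%:C * ('i * ((T0 - 0) + 'i * (T1 - 0)))).
  rewrite (funext h : (fun=> A) = _).
  apply: cvgCD; first exact: bump_ker_lim1.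
  do 2 apply: cvgCZ; apply: cvgCD; first by apply: cvgCB (cvgC_cst _) (grad_ker_lim 0 x sf0).
  by apply: cvgCZ; apply: cvgCB (cvgC_cst _) (grad_ker_lim 1 x sf0).
by rewrite (cvgC_unique c1 c2) add0r !subr0.
Qed.

Lemma scaled_log_ker_cvg u : (fun n : nat => scaled_log_ker n.+1%:R u) @ \oo --> (- 2^-1 : R).
Proof.
pose z (n : nat) : R := sqnorm u * (n.+1%:R^-1 * n.+1%:R^-1).
have hz : z @ \oo --> (0 : R).
  rewrite -[X in _ --> X](mulr0 (sqnorm u)); apply: cvgM; first exact: cvg_cst.
  by rewrite -[X in _ --> X](mulr0 0); apply: cvgM; exact: cvg_invn.
pose F (t : R) : R := 2^-1 * ln (t + flatexp 0 (1 - t)).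
have e (n : nat) : scaled_log_ker n.+1%:R u = F (z n).
  have r0 : n.+1%:R != 0 :> R by rewrite pnatr_eq0.
  have ez : z n = sqnorm u / n.+1%:R ^+ 2 by rewrite /z expr2 invfM.
  by rewrite /scaled_log_ker /F ez /rsq /cutoff; congr (_ * ln _); field.
have F0 : F 0 = - 2^-1.
  by rewrite /F add0r subr0 /flatexp ltr01 expr0 mul1r invr1 expRK; ring.
rewrite (funext e) -F0; apply: (cvg_comp _ _ hz).
have v0 : 0 < 0 + flatexp 0 (1 - 0) :> R by rewrite add0r subr0 /flatexp ltr01 expr0 mul1r expR_gt0.
apply: cvgM; first exact: cvg_cst.
have c1 : (fun t : R => t + flatexp 0 (1 - t)) @ 0 --> (0 + flatexp 0 (1 - 0) : R).
  apply: cvgD; first exact: cvg_id.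
  have c2 : (fun t : R => 1 - t) @ 0 --> (1 - 0 : R) by apply: cvgB; [exact: cvg_cst|exact: cvg_id].
  exact: (cvg_comp _ _ c2 (@is_derive_continuous _ _ _ (is_derive_flatexp 0) (1 - 0))).
exact: (cvg_comp _ _ c1 (continuous_ln v0)).
Qed.

Lemma scaled_log_ker_lim f x : moment2 f ->
  cvgC (fun n => dist f (fun y => scaled_log_ker n.+1%:R (x - y))) ((- 2^-1)%:C * dist f (fun=> 1)).
Proof.
move=> sf; rewrite -(distZ _ (moment2_pairable_const sf)).
apply: (@growth_cvg _ f (fun n => scaled_log_ker n.+1%:R) (fun=> - 2^-1 * 1) 1 1 x) => //.
- by move=> n; exact: measurable_scaled_log_ker.
- move=> n u; rewrite mul1r; apply: le_trans (scaled_log_ker_le u (ltr0Sn _ n)) _.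
  by rewrite lerD2l ler_pdivrMr// ler_peMr ?enorm_ge0// ler1n.
- by move=> u; rewrite mulr1; exact: scaled_log_ker_cvg.
Qed.

(** A convergent sequence is bounded, and the logarithm is not. *)
Lemma ln_unbounded (z l : R[i]) : cvgC (fun n : nat => (ln n.+1%:R)%:C * z) l -> z = 0.
Proof.
have iv : (fun n : nat => (ln n.+1%:R : R)^-1) @ \oo --> (0 : R).
  apply/cvgr0Pnorm_le => e e0; near=> n.
  have n1 : expR e^-1 <= n.+1%:R.
    near: n; exists (Num.truncn (expR e^-1)) => // n /= hn; apply: ltW.
    apply: lt_le_trans (truncnS_gt _) _; by rewrite ler_nat ltnS.
  have en : e^-1 <= ln n.+1%:R by rewrite -[leLHS]expRK ler_ln ?posrE ?expR_gt0.
  have l0 : 0 < ln n.+1%:R :> R by apply: lt_le_trans en; rewrite invr_gt0.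
  by rewrite ger0_norm ?invr_ge0 ?(ltW l0)// -[leRHS]invrK lef_pV2// posrE invr_gt0.
have key (a b : R) : (fun n : nat => ln n.+1%:R * a) @ \oo --> b -> a = 0.
  move=> h; have := cvgM h iv; rewrite mulr0 => h2.
  have h3 : (fun n : nat => ln n.+1%:R * a * (ln n.+1%:R : R)^-1) @ \oo --> a.
    apply: cvg_near_cst; near=> n; rewrite mulrAC divff ?mul1r//.
    have n1 : (1 < n.+1%:R :> R) by rewrite ltr1n ltnS; near: n; exists 1%N.
    by rewrite gt_eqF// ln_gt0.
  by rewrite -(cvg_lim (@norm_hausdorff _ R) h3); apply: cvg_lim => //; exact: h2.
move=> [h1 h2]; apply: complex_ext => /=.
  by apply: (key _ _ _); move: h1; under eq_fun do rewrite mulrC Re_mulC mulrC; exact.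
by apply: (key _ _ _); move: h2; under eq_fun do rewrite mulrC Im_mulC mulrC; exact.
Unshelve. all: by end_near. Qed.

Lemma dist_log_test f d r x : moment2 f -> 0 < d -> 0 < r ->
  dist f (log_test d r x) = dist f (fun y => log_ker d (x - y)) -
    ((ln r)%:C * dist f (fun=> 1) + dist f (fun y => scaled_log_ker r (x - y))).
Proof.
move=> sf d0 r0; have [hr er] := dist_log_ker x sf r0; have [hd _] := dist_log_ker x sf d0.
by rewrite dist_diff// er.
Qed.

Hypothesis m0 : m != 0.

(** In the Green identity for psi0 every term converges as the outer radius
    grows, except ln r times m times the integral of f0; hence that integral
    vanishes, and the limit of the identity follows. *)
Lemma charge_psi0_mean d x : 0 < d -> d <= 1 -> dist f0 (fun=> 1) = 0 /\
  dist psi0 (fun y => bump_ker d (x - y)) = c * pi%:C + m%:C * dist f0 (fun y => log_ker d (x - y)) +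
   (- 2^-1)%:C * ('i * (dist f1 (fun y => grad_ker 0 d (x - y)) - 'i * dist f1 (fun y => grad_ker 1 d (x - y)))).
Proof.
move=> d0 d1; set A := dist psi0 _; set T0 := dist f1 _; set T1 := dist f1 _.
set D := dist f0 (fun=> 1); set L := dist f0 (fun y => log_ker d (x - y)).
pose X (n : nat) := dist psi0 (fun y => bump_ker n.+1%:R (x - y)) +
  (m%:C * (L - dist f0 (fun y => scaled_log_ker n.+1%:R (x - y))) + (- 2^-1)%:C * ('i *
  ((T0 - dist f1 (fun y => grad_ker 0 n.+1%:R (x - y))) - 'i * (T1 - dist f1 (fun y => grad_ker 1 n.+1%:R (x - y)))))).
have h (n : nat) : A = X n - m%:C * ((ln n.+1%:R)%:C * D).
  have r0 : 0 < n.+1%:R :> R by rewrite ltr0n.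
  have dr : d <= n.+1%:R by apply: le_trans d1 _; rewrite ler1n.
  have := green_psi0 lp0 lp1 E0 E1 x d0 dr.
  rewrite (dist_bump_diff x lp0 d0 r0) (dist_grad_test 0 x sf1 d0 r0) (dist_grad_test 1 x sf1 d0 r0) (dist_log_test x sf0 d0 r0).
  move/eqP; rewrite subr_eq => /eqP; rewrite -/A -/L -/T0 -/T1 -/D => ->; rewrite /X; ring.
have cX : cvgC X (c * pi%:C + (m%:C * (L - (- 2^-1)%:C * D) + (- 2^-1)%:C * ('i * ((T0 - 0) - 'i * (T1 - 0))))).
  apply: cvgCD; first exact: bump_ker_lim0.
  apply: cvgCD; first by apply: cvgCZ; apply: cvgCB (cvgC_cst _) (scaled_log_ker_lim x sf0).
  do 2 apply: cvgCZ; apply: cvgCB; first by apply: cvgCB (cvgC_cst _) (grad_ker_lim 0 x sf1).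
  by apply: cvgCZ; apply: cvgCB (cvgC_cst _) (grad_ker_lim 1 x sf1).
have D0 : D = 0.
  have := cvgCZ m%:C^-1 (cvgCB cX (cvgC_cst A)).
  set l := (X in cvgC _ X) => hl; apply: (@ln_unbounded _ l).
  move: hl; congr (cvgC _ _); apply/funext => n.
  rewrite [X in _ * (_ - X)](h n) opprB addrC subrK mulKf//.
  by apply: contra_neq m0 => /(congr1 (@complex.Re R)).
split=> //; rewrite D0 mulr0 !subr0 in cX.
have eA : (fun=> A) = X by apply/funext => n; rewrite (h n) D0 !mulr0 subr0.
by rewrite -eA addrA in cX; exact: cvgC_unique (cvgC_cst A) cX.
Qed.

End FarIdentities.

(** * The inner radius tends to zero *)

Section NearLimit. Context {R : realType}.
Implicit Types (d r : R) (x y u : plane R) (f g : plane R -> R[i]).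

Lemma dist_ae_ker f (k k' : mplane R -> R) : pairable f k -> measurable_fun [set: mplane R] k' ->
  {ae mu2 R, forall y, k y = k' y} -> dist f k = dist f k'.
Proof.
move=> h mk' kk; have [_ mk _] := h.
have ha : pairable f (fun y => `|k y|).
  by apply: pairable_le h _ _ => [|y]; [exact: measurableT_comp|rewrite normr_id].
have c2 : cvgC (fun=> dist f k) (dist f k').
  apply: (dist_cvg (k_ := fun=> k) (K := fun y => `|k y|)) => //.
    by apply: (ae_imp _ kk) => y ->; exact: cvg_cst.
  by apply: aeW => y n.
exact: cvgC_unique (cvgC_cst _) c2.
Qed.

Lemma grad_ker_cvg j u : (fun n : nat => grad_ker j n.+1%:R^-1 u) @ \oo --> grad_ln j u.
Proof.
have [->|u0] := eqVneq u 0.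
  rewrite (_ : grad_ln j 0 = 0); last by rewrite /grad_ln /coord; case: (j == 0); rewrite /= mul0r.
  rewrite (_ : (fun n : nat => _) = fun=> 0); first exact: cvg_cst.
  by apply/funext => n; rewrite /grad_ker /coord; case: (j == 0); rewrite /= mul0r.
have e0 : 0 < enorm u by rewrite lt0r enorm_ge0 andbT; apply: contra_neq u0; exact: enorm0.
apply: cvg_near_cst; near=> n; apply: grad_ker_out; first by rewrite invr_gt0.
near: n; have := cvg_invn (R := R); move/cvgr0Pnorm_le => /(_ _ e0).
by apply: filterS => n; rewrite ger0_norm.
Unshelve. all: by end_near. Qed.

(** The potentials with kernel [ln_norm] use the value ln 0 = 0 at the origin;
    masking the regularised kernel there makes it converge at every point. *)
Definition masked_log_ker d u : R := if u == 0 then 0 else log_ker d u.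

Lemma log_ker_cvg u : (fun n : nat => masked_log_ker n.+1%:R^-1 u) @ \oo --> ln_norm u.
Proof.
rewrite /masked_log_ker; have [->|u0] := eqVneq u 0.
  rewrite (_ : ln_norm 0 = 0); first exact: cvg_cst.
  by rewrite /ln_norm /enorm /= expr0n /= addr0 sqrtr0 ln0.
have e0 : 0 < enorm u by rewrite lt0r enorm_ge0 andbT; apply: contra_neq u0; exact: enorm0.
apply: cvg_near_cst; near=> n; apply: log_ker_out; first by rewrite invr_gt0.
near: n; have := cvg_invn (R := R); move/cvgr0Pnorm_le => /(_ _ e0).
by apply: filterS => n; rewrite ger0_norm.
Unshelve. all: by end_near. Qed.

Lemma ker_majorant_inv u : (enorm u)^-1 <= ker_majorant u.
Proof. by rewrite /ker_majorant invroot_sqr -addrA lerDl addr_ge0// enorm_ge0. Qed.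

Lemma grad_ker_bound j d : 0 < d -> ker_bound 25 (grad_ker j d).
Proof.
move=> d0; split; first exact: measurable_grad_ker.
by move=> u; apply: le_trans (grad_ker_le j u d0) _; rewrite ler_pM2l// ker_majorant_inv.
Qed.

Lemma grad_ln_ker_bound25 j : ker_bound (25 : R) (grad_ln j).
Proof.
have [mg hg] := grad_ln_ker_bound j (R := R); split => // u; apply: le_trans (hg u) _.
by rewrite mul1r ler_peMl ?ker_majorant_ge0// ler1n.
Qed.

Lemma measurable_masked_log_ker d : 0 < d -> measurable_fun [set: mplane R] (masked_log_ker d).
Proof.
move=> d0; rewrite (_ : masked_log_ker d = fun u : mplane R => log_ker d u - log_ker d 0 * \1_[set (0 : mplane R)] u).
  apply: measurable_funB; first exact: measurable_log_ker.
  apply: measurable_funM => //; apply: measurable_indic.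
  apply: closed_mplane; apply: accessible_closed_set1.
  exact: hausdorff_accessible (@norm_hausdorff _ _).
apply/funext => u; rewrite /masked_log_ker indicE; have [->|u0] := eqVneq u 0.
  by rewrite mem_set// mulr1 subrr.
by rewrite memNset ?mulr0 ?subr0//=; exact/eqP.
Qed.

Lemma masked_log_ker_bound d : 0 < d -> d <= 1 -> ker_bound 1 (masked_log_ker d).
Proof.
move=> d0 d1; split; first exact: measurable_masked_log_ker.
move=> u; rewrite mul1r /masked_log_ker; case: eqVneq => [_|u0]; first by rewrite normr0 ker_majorant_ge0.
exact: log_ker_le.
Qed.

Lemma pot_masked_log_ker f d x : moment2 f -> 0 < d -> pot (masked_log_ker d) f x = dist f (fun y => log_ker d (x - y)).
Proof.
move=> sf d0; apply/esym/dist_ae_ker.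
- by have [] := dist_log_ker x sf d0.
- exact: measurable_shift (measurable_masked_log_ker d0).
- apply: (ae_point (x0 := x)) => y yx; rewrite /masked_log_ker subr_eq0 ifF//.
  by apply/negbTE; rewrite eq_sym.
Qed.

Lemma Rint_le (F : mplane R -> R) (B : R) : measurable_fun [set: mplane R] F ->
  (\int[mu2 R]_x (`|F x|)%:E <= B%:E)%E -> L1 F /\ `|\int[mu2 R]_x F x| <= B.
Proof.
move=> mF hB; have iF : L1 F by apply/L1P; split => //; apply: le_lt_trans hB _; rewrite ltry.
split => //; apply: le_trans (le_normr_Rintegral _ iF) _ => //.
have F0 : (0 <= \int[mu2 R]_x (`|F x|)%:E)%E by apply: integral_ge0 => x _; rewrite lee_fin.
rewrite -lee_fin /Rintegral fineK// ge0_fin_numE//.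
by apply: le_lt_trans hB _; rewrite ltry.
Qed.

Lemma measurable_bump_ker' d y : 0 < d -> measurable_fun [set: mplane R] (fun x : mplane R => bump_ker d (x - y)).
Proof. by move=> d0; exact: (measurable_shift' y (measurable_bump_ker d0)). Qed.

Lemma bump_ker_mass_le' d y : 0 < d -> (\int[mu2 R]_x (`|bump_ker d (x - y)|)%:E <= (4 * bump_cst)%:E)%E.
Proof. by move=> d0; under eq_integral do rewrite bump_kerB; exact: bump_ker_mass_le. Qed.

(** The bump has mass pi, so the difference is an average of chi(x) - chi(y)
    over the square of radius d, with total weight at most 4 [bump_cst]. *)
Lemma mollified_pointwise (chi : mplane R -> R) d y e : measurable_fun [set: mplane R] chi -> 0 < d -> 0 <= e ->
  L1 (fun x : mplane R => chi x * bump_ker d (x - y)) ->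
  (forall x, box y d x -> `|chi x - chi y| <= e) ->
  `|\int[mu2 R]_x (chi x * bump_ker d (x - y)) - pi * chi y| <= e * (4 * bump_cst).
Proof.
move=> mc d0 e0 ic he; have mk := measurable_bump_ker' y d0.
have [ik _] := Rint_le mk (bump_ker_mass_le' y d0).
have -> : pi * chi y = \int[mu2 R]_x (chi y * bump_ker d (x - y)).
  rewrite RintegralZl_total// mulrC; congr (_ * _); under eq_Rintegral do rewrite bump_kerB; exact/esym/bump_ker_mass.
rewrite -RintegralB//; last exact: L1Z.
apply: (Rint_le _ _).2.
  by apply: measurable_funB; exact: measurable_funM.
apply: (@le_trans _ _ (\int[mu2 R]_x (e * `|bump_ker d (x - y)|)%:E)%E).
  apply: mu2_le => [|||x].
  - by apply/measurable_EFinP; apply: measurableT_comp => //; apply: measurable_funB; exact: measurable_funM.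
  - by apply/measurable_EFinP; apply: measurable_funM => //; exact: measurableT_comp.
  - by move=> x; rewrite lee_fin.
  - rewrite lee_fin -mulrBl normrM.
    have [h|h] := boolP (x \in box y d); first by rewrite ler_wpM2r// he//; rewrite inE in h.
    have := bump_ker_box y x d0; rewrite indicE (negbTE h) mulr0 normr_le0 -bump_kerB => /eqP ->.
    by rewrite normr0 !mulr0.
under eq_integral do rewrite EFinM.
rewrite ge0_integralZl_EFin//; last by apply/measurable_EFinP; exact: measurableT_comp.
by rewrite EFinM; apply: lee_wpmul2l; rewrite ?lee_fin//; exact: bump_ker_mass_le'.
Qed.

(** By the symmetry of the bump the average can be moved onto the test
    function, where it converges pointwise, with a common bound and supports in
    a common square. *)
Lemma mollified_dist psi chi : loc_int psi -> test_fun chi ->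
  [/\ forall n : nat, pairable (fun x => dist psi (fun y => bump_ker n.+1%:R^-1 (x - y))) chi &
   cvgC (fun n : nat => dist (fun x => dist psi (fun y => bump_ker n.+1%:R^-1 (x - y))) chi)
     (pi%:C * dist psi chi)].
Proof.
move=> lp tc; have [B [N bs]] := test_bounded_supp tc; have [mc B0 N0 hc] := bs.
have d0 (n : nat) : 0 < (n.+1%:R^-1 : R) by rewrite invr_gt0.
have d1 (n : nat) : (n.+1%:R^-1 : R) <= 1 by rewrite invf_le1// ler1n.
pose Phi (y : mplane R) : R := B * (4 * bump_cst) * \1_(box 0 (N + 1)) y.
have mK (n : nat) : measurable_fun [set: mplane R * mplane R] (fun z : mplane R * mplane R => bump_ker n.+1%:R^-1 (z.1 - z.2)).
  exact: measurable_ker (measurable_bump_ker (d0 n)).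
have dP : pairable psi Phi.
  apply: pairableZ; have := lp; move/loc_intP => [_]; apply; lra.
have hP (n : nat) y : (\int[mu2 R]_x (`|chi x * bump_ker n.+1%:R^-1 (x - y)|)%:E <= (Phi y)%:E)%E.
  have [h|h] := boolP (y \in box 0 (N + 1)); last first.
    rewrite /Phi indicE (negbTE h) mulr0 integral0_eq//= => x _.
    have [hx|hx] := boolP (x \in box 0 N); last first.
      have := hc x; rewrite indicE (negbTE hx) mulr0 normr_le0 => /eqP ->.
      by rewrite mul0r normr0.
    have : y \notin box x n.+1%:R^-1.
      apply: contra h; rewrite !inE in hx *.
      move/boxP: hx => [x1 x2] /boxP[y1 y2]; apply/boxP; move: x1 x2 => /=.
      rewrite !subr0 => x1 x2; split.
        by rewrite -(subrK x.1 y.1); apply: le_trans (ler_normD _ _) _; rewrite addrC lerD// (le_trans y1).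
      by rewrite -(subrK x.2 y.2); apply: le_trans (ler_normD _ _) _; rewrite addrC lerD// (le_trans y2).
    move=> nb; have := bump_ker_box x y (d0 n); rewrite indicE (negbTE nb) mulr0 normr_le0 => /eqP ->.
    by rewrite mulr0 normr0.
  rewrite /Phi indicE h mulr1 EFinM.
  apply: le_trans (lee_wpmul2l _ (bump_ker_mass_le y (d0 n))); last by rewrite lee_fin.
  rewrite -ge0_integralZl_EFin//; last first.
    by apply/measurable_EFinP; apply: measurableT_comp => //; apply: measurable_shift; exact: measurable_bump_ker.
  apply: mu2_le => [|||x].
  - apply/measurable_EFinP; apply: measurableT_comp => //; apply: measurable_funM => //.
    exact: (measurable_shift' y (measurable_bump_ker (d0 n))).
  - apply: measurable_funeM; apply/measurable_EFinP; apply: measurableT_comp => //.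
    by apply: measurable_shift; exact: measurable_bump_ker.
  - by move=> x; rewrite lee_fin.
  - rewrite -EFinM lee_fin normrM bump_kerB ler_wpM2r//; apply: le_trans (hc x) _.
    by rewrite -[leRHS]mulr1 ler_wpM2l// indicE; case: (_ \in _).
have ik y (n : nat) : L1 (fun x : mplane R => chi x * bump_ker n.+1%:R^-1 (x - y)).
  apply/L1P; split; last by apply: le_lt_trans (hP n y) _; rewrite ltry.
  by apply: measurable_funM => //; exact: measurable_bump_ker'.
pose hf (n : nat) := dist_fubini mc (mK n) (hP n) dP.
split=> [n|]; first by have [] := hf n.
rewrite (_ : (fun n => _) = fun n : nat => dist psi (fun y => \int[mu2 R]_x (chi x * bump_ker n.+1%:R^-1 (x - y)))); last first.
  by apply/funext => n; have [_ _ ->] := hf n.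
rewrite -distZ; last exact: test_pairable.
apply: (dist_cvg (K := Phi)) => //.
- by move=> n; have [_ [_ ? _]] := hf n.
- exact: measurable_funM.
- apply: aeW => y; apply/cvgrPdist_le => /= e e0.
  have c0 : 0 < 4 * bump_cst + 1 :> R by have := @bump_cst_ge0 R; lra.
  have ct : continuous (chi : plane R -> R) by exact: test_cont.
  have := ct y; move/cvgrPdist_le => /(_ _ (divr_gt0 e0 c0)) /nbhs_ballP[r /= r0 hr].
  near=> n; have nr : n.+1%:R^-1 < r.
    by near: n; have := cvg_invn (R := R); move/cvgr0Pnorm_lt => /(_ _ r0); apply: filterS => n; rewrite ger0_norm.
  have bd (x : mplane R) : box y n.+1%:R^-1 x -> `|chi x - chi y| <= e / (4 * bump_cst + 1).
    move/boxP => [h1 h2]; rewrite distrC; apply: hr; rewrite -ball_normE /ball_ /= distrC.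
    by rewrite /Num.norm/= gt_max/= !(le_lt_trans _ nr).
  rewrite distrC; apply: le_trans (mollified_pointwise mc (d0 n) _ (ik y n) bd) _; first by rewrite divr_ge0 ?ltW.
  by rewrite mulrAC ler_pdivrMr//; move: e0 c0; nra.
- by apply: aeW => y n; apply: (Rint_le _ _).2; [by have /L1P[] := ik y n|exact: hP].
Unshelve. all: by end_near. Qed.

End NearLimit.

Section Representation. Context {R : realType}.
Variables (m : R) (psi0 psi1 f0 f1 : plane R -> R[i]).
Implicit Types (d r : R) (x y u : plane R) (f g : plane R -> R[i]).
Hypotheses (lp0 : loc_int psi0) (lp1 : loc_int psi1).
Hypotheses (sf0 : moment2 f0) (sf1 : moment2 f1).
Hypothesis E0 : forall chi, test_fun chi ->
  'i * dist psi1 (pd 0 chi) + dist psi1 (pd 1 chi) + dist f0 chi = 0.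
Hypothesis E1 : forall chi, test_fun chi ->
  'i * dist psi0 (pd 0 chi) - dist psi0 (pd 1 chi) - (2 * m)%:C * dist psi1 chi + dist f1 chi = 0.
Variables (c : R[i]) (g0 g1 : plane R -> R[i]).
Hypotheses (dg0 : vanishing g0) (dg1 : vanishing g1).
Hypothesis p0 : {ae mu2 R, forall x, psi0 x = c + g0 x}.
Hypothesis p1 : {ae mu2 R, forall x, psi1 x = g1 x}.
Hypothesis m0 : m != 0.

Let d0 (n : nat) : 0 < (n.+1%:R^-1 : R). Proof. by rewrite invr_gt0. Qed.

Let d1 (n : nat) : (n.+1%:R^-1 : R) <= 1. Proof. by rewrite invf_le1// ler1n. Qed.

Let c25 : 0 <= (25 : R). Proof. by []. Qed.

(** The constant -i/(2 pi) of the Cauchy kernel in these coordinates. *)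
Definition cauchy_cst : R[i] := (- (2 * pi)^-1)%:C * 'i.

Lemma charge0 : dist f0 (fun=> 1) = 0.
Proof. exact: (charge_psi0_mean lp0 lp1 sf0 sf1 E0 E1 dg0 p0 m0 0 ltr01 (lexx _)).1. Qed.

Lemma pi_cancel (A B : R[i]) : pi%:C * A = B -> A = (pi^-1)%:C * B.
Proof.
move=> <-; rewrite mulrA -rmorphM mulVf ?rmorph1 ?mul1r//.
by rewrite gt_eqF// pi_gt0.
Qed.

Lemma half_pi (z : R[i]) : (pi^-1)%:C * ((- 2^-1)%:C * ('i * z)) = cauchy_cst * z.
Proof.
rewrite /cauchy_cst !mulrA -rmorphM; congr (_%:C * _ * _).
by rewrite mulrN mulrC invfM.
Qed.

Lemma pot_pairable f chi B N C kap : moment2 f -> bounded_supp chi B N -> 0 <= C -> ker_bound C kap -> pairable (pot kap f) chi.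
Proof. by move=> sf bs C0 hk; have [] := pot_fubini sf bs C0 hk. Qed.

Lemma dist_comb f chi (z : R[i]) (kap0 kap1 : mplane R -> R) B N C : moment2 f -> bounded_supp chi B N -> 0 <= C ->
  ker_bound C kap0 -> ker_bound C kap1 ->
  pairable (fun x => pot kap0 f x + z * pot kap1 f x) chi /\
  dist (fun x => pot kap0 f x + z * pot kap1 f x) chi =
    dist (pot kap0 f) chi + z * dist (pot kap1 f) chi.
Proof.
move=> sf bs C0 h0 h1; have i0 := pot_pairable sf bs C0 h0; have i1 := pot_pairable sf bs C0 h1.
have iz := pairableZf z i1; split; first exact: pairableDf.
by rewrite distDf// distZf.
Qed.

Lemma comb_loc f (z : R[i]) : moment2 f -> loc_int (fun x => pot (grad_ln 0) f x + z * pot (grad_ln 1) f x).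
Proof.
by move=> sf; apply: loc_intD; [|apply: loc_intZ]; apply: (@pot_loc_int _ f 25) => //; exact: grad_ln_ker_bound25.
Qed.

(** Both sides of [psi1_mean] converge in the sense of distributions as d tends
    to 0, and locally integrable functions with the same distribution agree
    almost everywhere. *)
Lemma psi1_repr : {ae mu2 R, forall x,
  psi1 x = cauchy_cst * (pot (grad_ln 0) f0 x + 'i * pot (grad_ln 1) f0 x)}.
Proof.
apply: dist_inj => //; first by apply: loc_intZ; exact: comb_loc.
move=> chi tc; have [B [N bs]] := test_bounded_supp tc; have [mi mc] := mollified_dist lp1 tc.
have [i1 e1] := dist_comb 'i sf0 bs c25 (grad_ln_ker_bound25 0) (grad_ln_ker_bound25 1).
rewrite distZf// e1 -half_pi; apply: pi_cancel.
apply: cvgC_unique mc _.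
have cc : cvgC (fun n : nat => (- 2^-1)%:C * ('i * (dist (pot (grad_ker 0 n.+1%:R^-1) f0) chi +
   'i * dist (pot (grad_ker 1 n.+1%:R^-1) f0) chi)))
  ((- 2^-1)%:C * ('i * (dist (pot (grad_ln 0) f0) chi + 'i * dist (pot (grad_ln 1) f0) chi))).
  have pc j := pot_cvg sf0 bs c25 (fun n => grad_ker_bound j (d0 n)) (grad_ln_ker_bound25 j) (@grad_ker_cvg R j).
  by do 2 apply: cvgCZ; apply: cvgCD; [exact: pc|apply: cvgCZ; exact: pc].
move: cc; congr (cvgC _ _); apply/funext => n.
have [i2 e2] := dist_comb 'i sf0 bs c25 (grad_ker_bound 0 (d0 n)) (grad_ker_bound 1 (d0 n)).
rewrite -e2 -distZf// -distZf//; last exact: pairableZf.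
by congr dist; apply/funext => x; rewrite (psi1_mean lp1 sf0 E0 dg1 p1 x (d0 n) (d1 n)).
Qed.

(** The same passage to the limit as for psi1; the constant c survives from
    infinity. *)
Lemma psi0_repr : {ae mu2 R, forall x,
  psi0 x = c + (m / pi)%:C * pot ln_norm f0 x + cauchy_cst * (pot (grad_ln 0) f1 x - 'i * pot (grad_ln 1) f1 x)}.
Proof.
have lc : loc_int (fun=> c : R[i]).
  apply/loc_intP; split; first exact: cmeasurable_cst.
  move=> N N0; apply: L1_pairable; [exact: cmeasurable_cst|by apply: measurable_indic; exact: box_measurable|].
  by apply: L1Z; exact: L1_box.
have ll : loc_int (pot ln_norm f0) by apply: (@pot_loc_int _ f0 1) => //; exact: ln_norm_ker_bound.
have eN : (fun x => pot (grad_ln 0) f1 x - 'i * pot (grad_ln 1) f1 x) =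
  fun x => pot (grad_ln 0) f1 x + (- 'i) * pot (grad_ln 1) f1 x by apply/funext => x; rewrite mulNr.
have lg := comb_loc (- 'i) sf1; rewrite -eN in lg.
apply: dist_inj => //.
  by apply: loc_intD; [apply: loc_intD|] => //; exact: loc_intZ.
move=> chi tc; have [B [N bs]] := test_bounded_supp tc; have [mi mc] := mollified_dist lp0 tc.
have [i1 e1] := dist_comb (- 'i) sf1 bs c25 (grad_ln_ker_bound25 0) (grad_ln_ker_bound25 1).
have il := pot_pairable sf0 bs ler01 ln_norm_ker_bound; have ic := test_pairable lc tc.
rewrite -eN in i1 e1.
rewrite distDf//; [|by apply: pairableDf => //; exact: pairableZf|exact: pairableZf].
rewrite distDf//; last exact: pairableZf.
rewrite !distZf// e1 -half_pi.
have -> : dist (fun=> c) chi = (pi^-1)%:C * (pi%:C * dist (fun=> c) chi).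
  by rewrite -(pi_cancel (erefl _)).
rewrite (mulrC m) (rmorphM _ pi^-1) -(mulrA _ m%:C) -!mulrDr; apply: pi_cancel.
apply: cvgC_unique mc _.
set D := dist (fun=> c) chi.
have cc : cvgC (fun n : nat => pi%:C * D + m%:C * dist (pot (masked_log_ker n.+1%:R^-1) f0) chi +
   (- 2^-1)%:C * ('i * (dist (pot (grad_ker 0 n.+1%:R^-1) f1) chi +
   (- 'i) * dist (pot (grad_ker 1 n.+1%:R^-1) f1) chi)))
  (pi%:C * D + m%:C * dist (pot ln_norm f0) chi +
    (- 2^-1)%:C * ('i * (dist (pot (grad_ln 0) f1) chi + (- 'i) * dist (pot (grad_ln 1) f1) chi))).
  have pc j := pot_cvg sf1 bs c25 (fun n => grad_ker_bound j (d0 n)) (grad_ln_ker_bound25 j) (@grad_ker_cvg R j).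
  have pl := pot_cvg sf0 bs ler01 (fun n => masked_log_ker_bound (d0 n) (d1 n)) ln_norm_ker_bound (@log_ker_cvg R).
  apply: cvgCD; first by apply: cvgCD (cvgC_cst _) _; exact: cvgCZ.
  by do 2 apply: cvgCZ; apply: cvgCD; [exact: pc|apply: cvgCZ; exact: pc].
move: cc; congr (cvgC _ _); apply/funext => n.
have [i2 e2] := dist_comb (- 'i) sf1 bs c25 (grad_ker_bound 0 (d0 n)) (grad_ker_bound 1 (d0 n)).
have i3 := pot_pairable sf0 bs ler01 (masked_log_ker_bound (d0 n) (d1 n)).
pose K x := pot (grad_ker 0 n.+1%:R^-1) f1 x + - 'i * pot (grad_ker 1 n.+1%:R^-1) f1 x.
transitivity (dist (fun x => pi%:C * c + m%:C * pot (masked_log_ker n.+1%:R^-1) f0 x + (- 2^-1)%:C * ('i * K x)) chi); last first.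
  congr dist; apply/funext => x.
  rewrite (charge_psi0_mean lp0 lp1 sf0 sf1 E0 E1 dg0 p0 m0 x (d0 n) (d1 n)).2.
  by rewrite (pot_masked_log_ker x sf0 (d0 n)) /K mulNr (mulrC pi%:C).
have i4 := pairableZf 'i i2; have i5 := pairableZf (- 2^-1)%:C i4.
have i6 := pairableZf m%:C i3; have i7 := pairableZf pi%:C ic.
rewrite (distDf (pairableDf i7 i6) i5) (distDf i7 i6) (distZf _ ic) (distZf _ i3) (distZf _ i4) (distZf _ i2).
by rewrite e2.
Qed.

End Representation.

(** * Boundedness and decay of the solution *)

Section Bootstrap. Context {R : realType}.
Variable (e : R).
Hypothesis e0 : 0 < e.
Implicit Types (x y z : mplane R) (a g : mplane R -> R).
Notation w := (weight e).

(** Convolution with 1/|u|, a Riesz potential, for nonnegative g; it may be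
    infinite. *)
Definition riesz g x : \bar R := (\int[mu2 R]_y (invroot (x - y) ^+ 2 * g y)%:E)%E.

Lemma measurable_invroot_shift x : measurable_fun [set: mplane R] (fun y : mplane R => invroot (x - y)).
Proof. exact: measurable_shift measurable_invroot. Qed.

(** The first power is at most the third power plus one. *)
Lemma invroot_sqr_weight : exists2 M : R, 0 <= M & forall x, (riesz w x <= M%:E)%E.
Proof.
have [M3 M30 h3] := invroot3_weight_integral e0; have [M1 M10 h1] := weight_integral e0.
exists (M3 + M1); first by rewrite addr_ge0.
move=> x; apply: (@le_trans _ _ (\int[mu2 R]_y ((invroot (x - y) ^+ 3 * w y)%:E + (w y)%:E))%E).
  apply: mu2_le => [|||y].
  - apply/measurable_EFinP; apply: measurable_funM; last exact: measurable_weight.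
    by apply: measurable_funX; exact: measurable_invroot_shift.
  - apply: emeasurable_funD; apply/measurable_EFinP; last exact: measurable_weight.
    by apply: measurable_funM; [apply: measurable_funX; exact: measurable_invroot_shift|exact: measurable_weight].
  - by move=> y; rewrite lee_fin mulr_ge0 ?sqr_ge0 ?weight_ge0.
  - rewrite -EFinD lee_fin -[X in _ <= _ + X]mul1r -mulrDl ler_wpM2r ?weight_ge0//.
    have := invroot_ge0 (x - y); move: (invroot _) => r r0; have [r1|r1] := leP r 1; first by nra.
    by have := mulr_ge0 (sqr_ge0 r) (ltW (_ : 0 < r - 1)); rewrite subr_gt0 => /(_ r1); nra.
rewrite ge0_integralD//; last 4 first.
- by move=> y _; rewrite lee_fin mulr_ge0 ?exprn_ge0 ?invroot_ge0 ?weight_ge0.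
- by apply/measurable_EFinP; apply: measurable_funM; [apply: measurable_funX; exact: measurable_invroot_shift|exact: measurable_weight].
- by move=> y _; rewrite lee_fin weight_ge0.
- by apply/measurable_EFinP; exact: measurable_weight.
by rewrite EFinD; apply: leeD.
Qed.

Lemma measurable_fst_comp (k : mplane R -> R) : measurable_fun [set: mplane R] k ->
  measurable_fun [set: mplane R * mplane R] (fun z : mplane R * mplane R => k z.1).
Proof. by move=> mk; exact: (measurableT_comp mk measurable_fst). Qed.

Lemma measurable_snd_comp (k : mplane R -> R) : measurable_fun [set: mplane R] k ->
  measurable_fun [set: mplane R * mplane R] (fun z : mplane R * mplane R => k z.2).
Proof. by move=> mk; exact: (measurableT_comp mk measurable_snd). Qed.

Lemma ge0_int_leZ (k : R) (f : mplane R -> R) (M : R) : 0 <= k -> measurable_fun [set: mplane R] f ->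
  (forall x, 0 <= f x) -> (\int[mu2 R]_x (f x)%:E <= M%:E)%E ->
  (\int[mu2 R]_x (k * f x)%:E <= (k * M)%:E)%E.
Proof.
move=> k0 mf f0 h; under eq_integral do rewrite EFinM.
rewrite ge0_integralZl_EFin//; [|by move=> y _; rewrite lee_fin|exact/measurable_EFinP].
by rewrite EFinM; apply: lee_wpmul2l.
Qed.

Lemma ge0_int_leD (f g : mplane R -> R) (A B : R) : measurable_fun [set: mplane R] f -> measurable_fun [set: mplane R] g ->
  (forall x, 0 <= f x) -> (forall x, 0 <= g x) ->
  (\int[mu2 R]_x (f x)%:E <= A%:E)%E -> (\int[mu2 R]_x (g x)%:E <= B%:E)%E ->
  (\int[mu2 R]_x (f x + g x)%:E <= (A + B)%:E)%E.
Proof.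
move=> mf mg f0 g0 hf hg; under eq_integral do rewrite EFinD.
rewrite ge0_integralD//; [|by move=> y _; rewrite lee_fin|exact/measurable_EFinP
  |by move=> y _; rewrite lee_fin|exact/measurable_EFinP].
by rewrite EFinD; exact: leeD.
Qed.

(** Set k = |x-y|^(-1) |y-z|^(-1) and b = a(z). Then k b <= k^(1/2) b^2 +
    k^(3/2). In the first part k^(1/2) is at most half the sum of 1/|x-y| and
    1/|y-z|, which leaves the weighted square integral of a; in the second both
    singularities remain integrable. *)
Lemma riesz_iterated a (A : R) : measurable_fun [set: mplane R] a -> (forall y, 0 <= a y) -> 0 <= A ->
  (\int[mu2 R]_y (w y * a y ^+ 2)%:E <= A%:E)%E ->
  exists2 S : R, 0 <= S & forall x,
   (\int[mu2 R]_y \int[mu2 R]_z (invroot (x - y) ^+ 2 * w y * (invroot (y - z) ^+ 2 * (w z * a z)))%:E <= S%:E)%E.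
Proof.
move=> ma a0 A0 hA; have [M3 M30 h3] := invroot3_weight_integral e0; have [M2 M20 h2] := invroot_sqr_weight.
have mw := measurable_weight e (R := R); have mr := measurable_invroot (R := R).
have mrx x := measurable_invroot_shift x; have mk := measurable_ker mr.
have w0 y := weight_ge0 e y; have r0 := @invroot_ge0 R.
exists (M2 * A + M3 * M3); first by rewrite addr_ge0 ?mulr_ge0.
move=> x.
pose F1 (z : mplane R * mplane R) : R := invroot (x - z.1) * invroot (z.1 - z.2) * w z.1 * (w z.2 * a z.2 ^+ 2).
pose F2 (z : mplane R * mplane R) : R := invroot (x - z.1) ^+ 3 * w z.1 * (invroot (z.1 - z.2) ^+ 3 * w z.2).
have mF1 : measurable_fun [set: mplane R * mplane R] F1.
  apply: measurable_funM; last by apply: measurable_funM; [exact: measurable_snd_comp|exact: (measurable_snd_comp (measurable_funX 2 ma))].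
  apply: measurable_funM; last exact: measurable_fst_comp.
  by apply: measurable_funM => //; exact: (measurable_fst_comp (mrx x)).
have mF2 : measurable_fun [set: mplane R * mplane R] F2.
  apply: measurable_funM; apply: measurable_funM.
  - exact: (measurable_fst_comp (measurable_funX 3 (mrx x))).
  - exact: measurable_fst_comp.
  - exact: measurable_funX.
  - exact: measurable_snd_comp.
have F10 (z : mplane R * mplane R) : 0 <= F1 z by rewrite /F1 !mulr_ge0 ?exprn_ge0.
have F20 (z : mplane R * mplane R) : 0 <= F2 z by rewrite /F2 !mulr_ge0 ?exprn_ge0.
have F1y z : measurable_fun [set: mplane R] (fun y => F1 (y, z)).
  exact: (measurableT_comp mF1 (pair2_measurable (z : mplane R))).
have F1z y : measurable_fun [set: mplane R] (fun z => F1 (y, z)).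
  exact: (measurableT_comp mF1 (pair1_measurable (y : mplane R))).
have F2z y : measurable_fun [set: mplane R] (fun z => F2 (y, z)).
  exact: (measurableT_comp mF2 (pair1_measurable (y : mplane R))).
have i1 : (\int[mu2 R]_y \int[mu2 R]_z (F1 (y, z))%:E <= (M2 * A)%:E)%E.
  rewrite (@tonelli2 R (EFin \o F1)); [|exact/measurable_EFinP|by move=> z; rewrite lee_fin].
  apply: (@le_trans _ _ (\int[mu2 R]_z (M2 * (w z * a z ^+ 2))%:E)%E).
    apply: mu2_le => [|||z].
    - by apply: (@measurable_tonelli' R (EFin \o F1)); [exact/measurable_EFinP|by move=> z; rewrite lee_fin].
    - apply/measurable_EFinP; do 2 apply: measurable_funM => //; exact: measurable_funX.
    - by move=> z; apply: integral_ge0 => y _; rewrite lee_fin.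
    - pose L y := invroot (x - y) ^+ 2 * w y; pose L' y := invroot (z - y) ^+ 2 * w y.
      have mL : measurable_fun [set: mplane R] L by apply: measurable_funM => //; apply: measurable_funX.
      have mL' : measurable_fun [set: mplane R] L' by apply: measurable_funM => //; apply: measurable_funX.
      have L0 y : 0 <= L y by rewrite mulr_ge0 ?sqr_ge0.
      have L'0 y : 0 <= L' y by rewrite mulr_ge0 ?sqr_ge0.
      have c0 : 0 <= w z * a z ^+ 2 by rewrite mulr_ge0 ?sqr_ge0.
      have hL := ge0_int_leD mL mL' L0 L'0 (h2 x) (h2 z).
      have h12 : 0 <= 2^-1 * (w z * a z ^+ 2) by rewrite mulr_ge0.
      have := ge0_int_leZ h12 (measurable_funD mL mL') (fun y => addr_ge0 (L0 y) (L'0 y)) hL.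
      rewrite (_ : 2^-1 * (w z * a z ^+ 2) * (M2 + M2) = M2 * (w z * a z ^+ 2)); last by field.
      apply: le_trans; apply: mu2_le => [|||y].
      + exact/measurable_EFinP.
      + apply/measurable_EFinP; exact: (measurable_funM (measurable_cst _) (measurable_funD mL mL')).
      + by move=> y; rewrite lee_fin.
      + rewrite /= lee_fin /F1 /L /L' /= (invrootB y z).
        move: (w y) (w0 y) (invroot (x - y)) (invroot (z - y)) (w z * a z ^+ 2) c0 => wy wy0 p q t t0.
        (* The product of the two square roots is at most half the sum of the
           kernels 1/|x-y| and 1/|y-z|. *)
        rewrite -subr_ge0 [X in 0 <= X](_ : _ = 2^-1 * t * wy * (p - q) ^+ 2); last by field.
        by apply: mulr_ge0 (sqr_ge0 _); rewrite !mulr_ge0.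
  by apply: ge0_int_leZ => //; [apply: measurable_funM => //; exact: measurable_funX|move=> z; rewrite mulr_ge0 ?sqr_ge0].
have i2 : (\int[mu2 R]_y \int[mu2 R]_z (F2 (y, z))%:E <= (M3 * M3)%:E)%E.
  apply: (@le_trans _ _ (\int[mu2 R]_y (M3 * (invroot (x - y) ^+ 3 * w y))%:E)%E).
    apply: mu2_le => [|||y].
    - by apply: (@measurable_tonelli R (EFin \o F2)); [exact/measurable_EFinP|by move=> z; rewrite lee_fin].
    - by apply/measurable_EFinP; do 2 apply: measurable_funM => //; exact: measurable_funX.
    - by move=> y; apply: integral_ge0 => z _; rewrite lee_fin.
    - rewrite (mulrC M3); apply: (@ge0_int_leZ (invroot (x - y) ^+ 3 * w y) (fun z => invroot (y - z) ^+ 3 * w z) M3) => [|||//].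
      + by rewrite mulr_ge0 ?exprn_ge0.
      + by apply: measurable_funM => //; exact: measurable_funX.
      + by move=> z; rewrite mulr_ge0 ?exprn_ge0.
  by apply: ge0_int_leZ => //; [apply: measurable_funM => //; exact: measurable_funX|move=> z; rewrite mulr_ge0 ?exprn_ge0].
have mI (F : mplane R * mplane R -> R) : measurable_fun [set: mplane R * mplane R] F -> (forall z : mplane R * mplane R, 0 <= F z) ->
  measurable_fun [set: mplane R] (fun y => \int[mu2 R]_z (F (y, z))%:E)%E.
  move=> mF F0; apply: (@measurable_tonelli R (EFin \o F)); first exact/measurable_EFinP.
  by move=> z; rewrite lee_fin.
have I0 (F : mplane R * mplane R -> R) : (forall z : mplane R * mplane R, 0 <= F z) -> forall y, (0 <= \int[mu2 R]_z (F (y, z))%:E)%E.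
  by move=> F0 y; apply: integral_ge0 => z _; rewrite lee_fin.
pose F (z : mplane R * mplane R) : R := invroot (x - z.1) ^+ 2 * w z.1 * (invroot (z.1 - z.2) ^+ 2 * (w z.2 * a z.2)).
have mF : measurable_fun [set: mplane R * mplane R] F.
  apply: measurable_funM; apply: measurable_funM.
  - exact: (measurable_fst_comp (measurable_funX 2 (mrx x))).
  - exact: measurable_fst_comp.
  - exact: measurable_funX.
  - by apply: measurable_funM; exact: measurable_snd_comp.
have F0 (z : mplane R * mplane R) : 0 <= F z by rewrite /F !mulr_ge0 ?exprn_ge0.
apply: (@le_trans _ _ (\int[mu2 R]_y (\int[mu2 R]_z (F1 (y, z))%:E + \int[mu2 R]_z (F2 (y, z))%:E))%E).
  apply: mu2_le => [|||y].
  - exact: (mI F mF F0).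
  - exact: emeasurable_funD (mI F1 mF1 F10) (mI F2 mF2 F20).
  - exact: (I0 F F0).
  - have mE1 : measurable_fun [set: mplane R] (fun z => (F1 (y, z))%:E) by apply/measurable_EFinP; exact: F1z.
    have mE2 : measurable_fun [set: mplane R] (fun z => (F2 (y, z))%:E) by apply/measurable_EFinP; exact: F2z.
    have E10 z : setT z -> (0 <= (F1 (y, z))%:E)%E by rewrite lee_fin.
    have E20 z : setT z -> (0 <= (F2 (y, z))%:E)%E by rewrite lee_fin.
    rewrite -(@ge0_integralD _ _ _ (mu2 R) _ measurableT _ _ E10 mE1 E20 mE2).
    apply: mu2_le => [|||z].
    + by apply/measurable_EFinP; exact: (measurableT_comp mF (pair1_measurable (y : mplane R))).
    + exact: emeasurable_funD mE1 mE2.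
    + by move=> z; rewrite lee_fin; exact: (F0 (y, z)).
    + rewrite -EFinD lee_fin /F1 /F2/=.
      have := r0 (x - y); have := r0 (y - z); have := w0 y; have := w0 z; have := a0 z.
      move: (invroot _) (invroot _) (w _) (w _) (a _) => p q s t b b0 t0 s0 p0 q0.
      (* With c = p q the claim is c^2 b <= c (b^2 + c^2), that is c b <= b^2 +
         c^2. *)
      rewrite [leLHS](_ : _ = s * t * ((p * q) ^+ 2 * b)); last by ring.
      rewrite [leRHS](_ : _ = s * t * ((p * q) * (b ^+ 2 + (p * q) ^+ 2))); last by ring.
      rewrite ler_wpM2l ?mulr_ge0//.
      have pq0 : 0 <= p * q by rewrite mulr_ge0.
      move: (p * q) pq0 => c c0.
      rewrite expr2 -mulrA ler_wpM2l//; have := sqr_ge0 (c - b); nra.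
rewrite ge0_integralD//; [|by move=> y _; exact: (I0 F1 F10)|exact: (mI F1 mF1 F10)
  |by move=> y _; exact: (I0 F2 F20)|exact: (mI F2 mF2 F20)].
by rewrite EFinD; apply: leeD.
Qed.

(** Insert the pointwise bound on a into its own Riesz potential once; the
    iterated potential only needs the weighted square integral of a. *)
Lemma riesz_bounded a (A C : R) : measurable_fun [set: mplane R] a -> (forall y, 0 <= a y) -> 0 <= A ->
  (\int[mu2 R]_y (w y * a y ^+ 2)%:E <= A%:E)%E -> 0 <= C ->
  {ae mu2 R, forall y, ((a y)%:E <= C%:E + C%:E * riesz (fun z => w z * a z)%R y)%E} ->
  exists2 S : R, 0 <= S & forall x, (riesz (fun z => w z * a z)%R x <= S%:E)%E.
Proof.
move=> ma a0 A0 hA C0 hae; have [S2 S20 h2] := riesz_iterated ma a0 A0 hA; have [M2 M20 h1] := invroot_sqr_weight.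
have mw := measurable_weight e (R := R); have w0 y := weight_ge0 e y.
exists (C * M2 + C * S2); first by rewrite addr_ge0 ?mulr_ge0.
move=> x; pose L y : R := invroot (x - y) ^+ 2 * w y.
have mL : measurable_fun [set: mplane R] L.
  by apply: measurable_funM => //; apply: measurable_funX; exact: measurable_invroot_shift.
have L0 y : 0 <= L y by rewrite mulr_ge0 ?sqr_ge0.
pose I y : \bar R := (\int[mu2 R]_z (L y * (invroot (y - z) ^+ 2 * (w z * a z)))%:E)%E.
have mg y : measurable_fun [set: mplane R] (fun z : mplane R => invroot (y - z) ^+ 2 * (w z * a z)).
  by apply: measurable_funM; [apply: measurable_funX; exact: measurable_invroot_shift|exact: measurable_funM].
have g0 y z : 0 <= invroot (y - z) ^+ 2 * (w z * a z) by rewrite !mulr_ge0 ?exprn_ge0 ?invroot_ge0.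
have eI y : I y = ((L y)%:E * riesz (fun z => w z * a z)%R y)%E.
  rewrite /I; under eq_integral do rewrite EFinM.
  by rewrite ge0_integralZl_EFin//; [move=> z _; rewrite lee_fin|exact/measurable_EFinP].
have mI : measurable_fun [set: mplane R] I.
  apply: (@measurable_tonelli R (fun z : mplane R * mplane R => (L z.1 * (invroot (z.1 - z.2) ^+ 2 * (w z.2 * a z.2)))%:E)).
    apply/measurable_EFinP; apply: measurable_funM; first exact: measurable_fst_comp.
    apply: measurable_funM; first exact: (measurable_funX 2 (measurable_ker measurable_invroot)).
    by apply: measurable_funM; exact: measurable_snd_comp.
  by move=> z; rewrite lee_fin !mulr_ge0 ?exprn_ge0 ?invroot_ge0.
have I0 y : (0 <= I y)%E by apply: integral_ge0 => z _; rewrite lee_fin mulr_ge0.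
apply: (@le_trans _ _ (\int[mu2 R]_y ((C * L y)%:E + C%:E * I y))%E).
  apply: ae_ge0_le_integral => //.
  - by move=> y _; rewrite lee_fin.
  - exact/measurable_EFinP.
  - by move=> y _; apply: adde_ge0; [rewrite lee_fin mulr_ge0|apply: mule_ge0].
  - apply: emeasurable_funD; last exact: measurable_funeM.
    by apply/measurable_EFinP; exact: measurable_funM.
  - apply: (ae_imp _ hae) => y hy _; rewrite mulrA -/(L y) EFinM.
    apply: le_trans (lee_wpmul2l _ hy) _; first by rewrite lee_fin.
    rewrite ge0_muleDr//; last by rewrite mule_ge0//; apply: integral_ge0 => z _; rewrite lee_fin.
    by rewrite -EFinM (mulrC C) muleCA -eI.
rewrite ge0_integralD//; [|by move=> y _; rewrite lee_fin mulr_ge0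
  |by apply/measurable_EFinP; exact: measurable_funM|by move=> y _; rewrite mule_ge0|exact: measurable_funeM].
rewrite EFinD; apply: leeD; first exact: (ge0_int_leZ C0 mL L0 (h1 x)).
rewrite ge0_integralZl_EFin//; apply: (@le_trans _ _ (C%:E * S2%:E)%E) => //.
by apply: lee_wpmul2l; rewrite ?lee_fin//; exact: h2.
Qed.

End Bootstrap.

Section PotentialDecay. Context {R : realType}.
Implicit Types (x y z : mplane R) (f : plane R -> R[i]).

Lemma ln_le_sub1 (v : R) : 0 < v -> ln v <= v - 1.
Proof.
move=> v0; have := @le_ln1Dx R (v - 1); rewrite (_ : 1 + (v - 1) = v); last by ring.
by apply; lra.
Qed.

Lemma enorm_shift x y : 1 + enorm x <= 1 + enorm y + enorm (x - y).
Proof. by have := enormD (x - y) y; rewrite subrK; lra. Qed.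

Lemma invroot_sqr_mul (u : plane R) : invroot u ^+ 2 * enorm u <= 1.
Proof.
rewrite invroot_sqr; have [->|h] := eqVneq (enorm u) 0; first by rewrite mulr0.
by rewrite mulVf.
Qed.

Variables (f : plane R -> R[i]) (g : mplane R -> R) (A : R).
Hypotheses (mf : cmeasurable f) (mg : measurable_fun [set: mplane R] g).
Hypothesis fg : forall y, (1 + enorm y) ^+ 2 * cmod (f y) <= g y.
Hypothesis gA : (\int[mu2 R]_y (g y)%:E <= A%:E)%E.

Lemma g_ge0 y : 0 <= g y.
Proof. by apply: le_trans (fg y); rewrite mulr_ge0 ?sqr_ge0 ?cmod_ge0. Qed.

(** The common form of the decay estimates: the factor (1 + |y|)^2 is absorbed
    by g, the singularity by its Riesz potential. *)
Lemma pairable_riesz (k : mplane R -> R) (B S : R) x : measurable_fun [set: mplane R] k -> 0 <= B ->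
  (riesz g x <= S%:E)%E ->
  (forall y, `|k y| <= B * ((invroot (x - y) ^+ 2 + 1) * (1 + enorm y) ^+ 2)) ->
  pairable f k /\ cmod (dist f k) <= 2 * (B * (S + A)).
Proof.
move=> mk B0 hS hk.
have mrg : measurable_fun [set: mplane R] (fun y => invroot (x - y) ^+ 2 * g y).
  by apply: measurable_funM => //; apply: measurable_funX; exact: measurable_invroot_shift.
have rg0 y : 0 <= invroot (x - y) ^+ 2 * g y by rewrite mulr_ge0 ?sqr_ge0 ?g_ge0.
have h : (\int[mu2 R]_y (cmod (f y) * `|k y|)%:E <= (B * (S + A))%:E)%E.
  apply: (@le_trans _ _ (\int[mu2 R]_y (B * (invroot (x - y) ^+ 2 * g y + g y))%:E)%E); last first.
    apply: ge0_int_leZ => //; first exact: measurable_funD.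
      by move=> y; rewrite addr_ge0 ?g_ge0.
    by apply: ge0_int_leD => //; exact: g_ge0.
  apply: mu2_le => [|||y].
  - by apply/measurable_EFinP; apply: measurable_funM; [exact: measurable_cmod|exact: measurableT_comp].
  - by apply/measurable_EFinP; apply: measurable_funM => //; exact: measurable_funD.
  - by move=> y; rewrite lee_fin mulr_ge0 ?cmod_ge0.
  - rewrite lee_fin; apply: (@le_trans _ _ (cmod (f y) * (B * ((invroot (x - y) ^+ 2 + 1) * (1 + enorm y) ^+ 2)))).
      by rewrite ler_wpM2l ?cmod_ge0.
    rewrite mulrCA ler_wpM2l// mulrCA -[X in _ <= _ + X]mul1r -mulrDl ler_wpM2l ?addr_ge0 ?sqr_ge0//.
    by rewrite mulrC.
have d : pairable f k by split => //; apply: le_lt_trans h _; rewrite ltry.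
split=> //; rewrite -lee_fin; apply: le_trans (dist_bound d) _.
rewrite [(2 * _)%:E]EFinM; exact: lee_wpmul2l.
Qed.

(** Multiply by 1 + |x| <= 1 + |y| + |x - y|: the last term cancels the kernel
    1/|x - y|, the others are absorbed by the moments. *)
Lemma pot_grad_ln_decay j (S : R) x : (riesz g x <= S%:E)%E ->
  (1 + enorm x) * cmod (pot (grad_ln j) f x) <= 2 * (S + A).
Proof.
move=> hS; have X0 : 0 < 1 + enorm x by rewrite ltr_pwDl// enorm_ge0.
have [||y|_ h] := @pairable_riesz (fun y => grad_ln j (x - y)) (1 + enorm x)^-1 S x _ _ hS.
- by apply: measurable_shift; have [] := grad_ln_ker_bound j (R := R).
- by rewrite invr_ge0 ltW.
- rewrite mulrC ler_pdivlMr//.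
  apply: (@le_trans _ _ (invroot (x - y) ^+ 2 * (1 + enorm x))).
    by rewrite ler_wpM2r ?(ltW X0)// invroot_sqr; exact: grad_ln_le.
  have := invroot_sqr_mul (x - y); have := enorm_shift x y; have := sqr_ge0 (invroot (x - y)).
  have := enorm_ge0 y; move: (invroot _ ^+ 2) (enorm (x - y)) (enorm y) (enorm x) => r t s q s0 r0 h1 h2.
  apply: (@le_trans _ _ (r * (1 + s + t))); first by rewrite ler_wpM2l.
  by rewrite mulrDr; have : 0 <= r * s; [exact: mulr_ge0|nra].
- by rewrite mulrC -ler_pdivlMr//; apply: le_trans h _; rewrite le_eqVlt; apply/orP; left; apply/eqP; ring.
Qed.

(** As f has integral 0, ln(1 + |x|) may be subtracted from the kernel. By ln v
    <= v - 1 the difference of the logarithms is at most |y| / (1 + |x|) in one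
    direction and (1 + |y|) / |x - y| in the other, which gains the factor 1 +
    |x|. *)
Lemma pot_ln_norm_decay (S : R) x : dist f (fun=> 1) = 0 -> pairable f (fun=> 1) -> (riesz g x <= S%:E)%E ->
  (1 + enorm x) * cmod (pot ln_norm f x) <= 2 * (S + A).
Proof.
move=> f0 d1 hS; have X0 : 0 < 1 + enorm x by rewrite ltr_pwDl// enorm_ge0.
have [ml hl] := ln_norm_ker_bound (R := R); have msl := measurable_shift x ml.
have [||y|dl _] := @pairable_riesz (fun y => ln_norm (x - y)) (1 + enorm x) S x _ _ hS.
- exact: msl.
- exact: ltW.
- apply: le_trans (hl _) _; rewrite mul1r /ker_majorant.
  have := enormD x (- y); rewrite enormN.
  have := sqr_ge0 (invroot (x - y)); have := enorm_ge0 y; have := enorm_ge0 x.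
  move: (invroot _ ^+ 2) (enorm (x - y)) (enorm y) (enorm x) => r t s q q0 s0 r0 h.
  apply: (@le_trans _ _ (r + (1 + q) * (1 + s))).
    by have := mulr_ge0 q0 s0; lra.
  have := mulr_ge0 r0 q0; have := mulr_ge0 r0 s0; have := mulr_ge0 q0 s0; have := mulr_ge0 (mulr_ge0 r0 q0) s0.
  have := mulr_ge0 s0 s0; have := mulr_ge0 r0 (mulr_ge0 s0 s0).
  have := mulr_ge0 q0 (mulr_ge0 s0 s0); have := mulr_ge0 (mulr_ge0 r0 q0) (mulr_ge0 s0 s0); lra.
(* At y = x the kernel 1/|x - y| takes the value 0 and could not bound the
   logarithm; the kernel is therefore masked at this one point. *)
pose L y : R := if y == x then 0 else ln_norm (x - y) - ln (1 + enorm x).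
have eL : pot ln_norm f x = dist f (fun y => ln_norm (x - y) + (- ln (1 + enorm x)) * 1).
  by rewrite distD//; [rewrite distZ// f0 mulr0 addr0|exact: pairableZ].
have mL : measurable_fun [set: mplane R] L.
  rewrite (_ : L = fun y : mplane R => (ln_norm (x - y) - ln (1 + enorm x)) * (1 - \1_[set (x : mplane R)] y)).
    apply: measurable_funM; first exact: measurable_funB.
    apply: measurable_funB => //; apply: measurable_indic.
    by apply: closed_mplane; apply: accessible_closed_set1; exact: hausdorff_accessible (@norm_hausdorff _ _).
  apply/funext => y; rewrite /L indicE; have [->|yx] := eqVneq y x.
    by rewrite mem_set// (subrr 1) mulr0.
  by rewrite memNset ?subr0 ?mulr1//=; exact/eqP.
have -> : pot ln_norm f x = dist f L.
  rewrite eL; apply: dist_ae_ker => //; first by apply: pairableD => //; exact: pairableZ.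
  by apply: (ae_point (x0 := x)) => y yx; rewrite /L (negbTE yx) mulr1.
have Xi : 0 <= (1 + enorm x)^-1 by rewrite invr_ge0 ltW.
have [|_ h] := @pairable_riesz L (1 + enorm x)^-1 S x mL Xi hS; first move=> y.
- rewrite mulrC ler_pdivlMr// /L; case: eqVneq => [_|yx].
    by rewrite normr0 mul0r mulr_ge0 ?sqr_ge0// addr_ge0 ?sqr_ge0.
  have t0 : 0 < enorm (x - y).
    rewrite lt0r enorm_ge0 andbT; apply: contra_neq yx => /enorm0/eqP.
    by rewrite subr_eq0 => /eqP.
  have := enorm_shift x y; have := enormD x (- y); rewrite enormN.
  rewrite invroot_sqr /ln_norm; have := enorm_ge0 y; have := enorm_ge0 x.
  move: (enorm (x - y)) t0 (enorm y) (enorm x) X0 => t t0 s q X0 q0 s0 h1 h2.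
  have ti : 0 < t^-1 by rewrite invr_gt0.
  have e1 : ln t - ln (1 + q) <= t / (1 + q) - 1.
    by rewrite -ln_div ?posrE//; apply: ln_le_sub1; rewrite divr_gt0.
  have e2 : ln (1 + q) - ln t <= (1 + q) / t - 1.
    by rewrite -ln_div ?posrE//; apply: ln_le_sub1; rewrite divr_gt0.
  have u1 : (ln t - ln (1 + q)) * (1 + q) <= s.
    apply: (@le_trans _ _ ((t / (1 + q) - 1) * (1 + q))); first by rewrite ler_wpM2r// ltW.
    by rewrite mulrBl mulfVK ?gt_eqF//; lra.
  have u2 : (ln (1 + q) - ln t) * (1 + q) <= t^-1 * (1 + s) ^+ 2 + (1 + s).
    have z1 : (1 + q) / t - 1 <= (1 + s) / t.
      by rewrite lerBlDr -[X in _ <= _ + X](divff (lt0r_neq0 t0)) -mulrDl ler_pM2r.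
    apply: (@le_trans _ _ ((1 + s) / t * (1 + s + t))).
      by apply: (le_trans (y := (1 + s) / t * (1 + q))); [rewrite ler_wpM2r ?(ltW X0)// (le_trans e2)|
        rewrite ler_wpM2l// divr_ge0 ?addr_ge0// ltW].
    by rewrite le_eqVlt; apply/orP; left; apply/eqP; field; exact: lt0r_neq0.
  have bd : t^-1 * (1 + s) ^+ 2 + (1 + s) <= (t^-1 + 1) * (1 + s) ^+ 2.
    by rewrite mulrDl mul1r lerD2l; nra.
  have bd2 : s <= t^-1 * (1 + s) ^+ 2 + (1 + s).
    by have := mulr_ge0 (ltW ti) (sqr_ge0 (1 + s)); lra.
  rewrite -[X in _ * X](gtr0_norm X0) -normrM ler_norml; apply/andP; split; lra.
- by rewrite mulrC -ler_pdivlMr//; apply: le_trans h _; rewrite le_eqVlt; apply/orP; left; apply/eqP; ring.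
Qed.

End PotentialDecay.

Section Bootstrapping. Context {R : realType}.
Variables (m e K : R) (psi0 psi1 f0 f1 : plane R -> R[i]).
Hypotheses (m0 : 0 < m) (e0 : 0 < e) (K0 : 0 <= K).
Implicit Types (x y z : mplane R).
Notation w := (weight e).
Hypotheses (mp0 : cmeasurable psi0) (mp1 : cmeasurable psi1).
Hypotheses (mf0 : cmeasurable f0) (mf1 : cmeasurable f1).
Let a (y : mplane R) : R := cmod (psi0 y) + cmod (psi1 y).
Hypothesis hf0 : forall y, cmod (f0 y) <= K * (w y * w y * a y).
Hypothesis hf1 : forall y, cmod (f1 y) <= K * (w y * w y * a y).
Hypothesis E0 : forall chi, test_fun chi ->
  'i * dist psi1 (pd 0 chi) + dist psi1 (pd 1 chi) + dist f0 chi = 0.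
Hypothesis E1 : forall chi, test_fun chi ->
  'i * dist psi0 (pd 0 chi) - dist psi0 (pd 1 chi) - (2 * m)%:C * dist psi1 chi + dist f1 chi = 0.
Variables (c : R[i]) (g0 g1 : plane R -> R[i]) (H : mplane R -> R).
Hypotheses (dg0 : vanishing g0) (dg1 : vanishing g1).
Hypothesis p0 : {ae mu2 R, forall x, psi0 x = c + g0 x}.
Hypothesis p1 : {ae mu2 R, forall x, psi1 x = g1 x}.
Hypotheses (mH : measurable_fun [set: mplane R] H) (H0 : forall y, 0 <= H y).
Hypothesis iH : L1 (fun y => H y ^+ 2).
Hypothesis gH0 : forall y, cmod (g0 y) <= 1 + H y.
Hypothesis gH1 : forall y, cmod (g1 y) <= 1 + H y.

Let ma : measurable_fun [set: mplane R] a.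
Proof. by apply: measurable_funD; exact: measurable_cmod. Qed.

Let a0 y : 0 <= a y. Proof. by rewrite addr_ge0 ?cmod_ge0. Qed.

Let w0 y : 0 <= w y. Proof. exact: weight_ge0. Qed.

Let mw : measurable_fun [set: mplane R] w. Proof. exact: measurable_weight. Qed.

Lemma a_le : {ae mu2 R, forall y, a y <= cmod c + 2 + 2 * H y}.
Proof.
apply: (ae_imp2 _ p0 p1) => y h0 h1; rewrite /a h0 h1.
by have := cmodD c (g0 y); have := gH0 y; have := gH1 y; lra.
Qed.

(** The bounded part of psi is integrated against the weight, the remainder H
    is square integrable. *)
Lemma weight_sqr_finite : exists2 A : R, 0 <= A & (\int[mu2 R]_y (w y * a y ^+ 2)%:E <= A%:E)%E.
Proof.
have [M1 M10 h1] := weight_integral e0; have [mH2 lH2] := (L1P _).1 iH.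
set I := (\int[mu2 R]_y (`|H y ^+ 2|)%:E)%E in lH2.
have I0 : (0 <= I)%E by apply: integral_ge0 => y _; rewrite lee_fin.
have If : I \is a fin_num by rewrite ge0_fin_numE.
have hI : (\int[mu2 R]_y (H y ^+ 2)%:E <= (fine I)%:E)%E.
  rewrite fineK// le_eqVlt; apply/orP; left; apply/eqP; apply: eq_integral => y _.
  by rewrite ger0_norm// sqr_ge0.
pose b := cmod c + 2; have b0 : 0 <= b by rewrite addr_ge0 ?cmod_ge0.
exists (2 * b ^+ 2 * M1 + 8 * fine I).
  by rewrite addr_ge0// mulr_ge0// ?fine_ge0// mulr_ge0// sqr_ge0.
have c1 : 0 <= 2 * b ^+ 2 by rewrite mulr_ge0// sqr_ge0.
apply: le_trans (ge0_int_leD (measurable_funM (measurable_cst _) mw) (measurable_funM (measurable_cst _) mH2)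
  (fun y => mulr_ge0 c1 (w0 y)) (fun y => mulr_ge0 (ler0n _ 8) (sqr_ge0 _))
  (ge0_int_leZ c1 mw w0 h1) (ge0_int_leZ (ler0n _ 8) mH2 (fun y => sqr_ge0 _) hI)).
apply: ae_ge0_le_integral => //.
- by move=> y _; rewrite lee_fin mulr_ge0// sqr_ge0.
- by apply/measurable_EFinP; apply: measurable_funM => //; exact: measurable_funX.
- by move=> y _; rewrite lee_fin addr_ge0// mulr_ge0// sqr_ge0.
- by apply/measurable_EFinP; apply: measurable_funD; exact: measurable_funM.
apply: (ae_imp _ a_le) => y hy _; rewrite lee_fin.
have w1 : w y <= 1 by apply: weight_le1; exact: ltW.
have a1 := a0 y; have h0 := H0 y; have ww := w0 y.
have h2 : a y ^+ 2 <= (b + 2 * H y) ^+ 2 by rewrite lerXn2r// nnegrE addr_ge0// mulr_ge0.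
apply: (@le_trans _ _ (w y * (2 * b ^+ 2 + 8 * H y ^+ 2))).
  apply: ler_wpM2l => //; apply: le_trans h2 _; have := sqr_ge0 (b - 2 * H y); lra.
rewrite mulrDr [w y * (2 * _)]mulrC lerD2l mulrCA ler_wpM2l//.
by rewrite ler_piMl// sqr_ge0.
Qed.

(** By 1 + |y| <= 2 <y>; one factor of the weight thus pays for two moments. *)
Lemma japanese_weight y : (1 + enorm y) ^+ 2 * w y <= 4.
Proof.
have j1 := japanese_ge1 y; have j2 := japanese_ge y; have en := enorm_ge0 y.
have jp : 0 < japanese y by apply: lt_le_trans j1.
apply: (@le_trans _ _ (4 * (japanese y ^+ 2 * w y))).
  rewrite mulrA ler_wpM2r//; nra.
rewrite -[leRHS]mulr1 ler_wpM2l// /weight -powR_mulrn ?(ltW jp)// -powRD; last first.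
  by apply/implyP => _; rewrite gt_eqF.
rewrite (_ : 2%:R + (-2 - e) = - e); last by ring.
by rewrite -[leRHS](powRr0 (japanese y)) ler_powR// oppr_le0 ltW.
Qed.

Let g (y : mplane R) : R := 4 * K * (w y * a y).

Let mwa : measurable_fun [set: mplane R] (fun y => w y * a y).
Proof. exact: measurable_funM. Qed.

Let wa0 y : 0 <= w y * a y. Proof. by rewrite mulr_ge0. Qed.

Let mg : measurable_fun [set: mplane R] g.
Proof. exact: measurable_funM. Qed.

Let K4 : 0 <= 4 * K. Proof. by rewrite mulr_ge0. Qed.

Let fg (f : plane R -> R[i]) : (forall y, cmod (f y) <= K * (w y * w y * a y)) ->
  forall y, (1 + enorm y) ^+ 2 * cmod (f y) <= g y.
Proof.
move=> hf y; apply: (@le_trans _ _ ((1 + enorm y) ^+ 2 * (K * (w y * w y * a y)))).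
  by rewrite ler_wpM2l ?sqr_ge0.
rewrite (_ : _ * _ = ((1 + enorm y) ^+ 2 * w y) * (K * (w y * a y))); last by ring.
by rewrite /g -[leRHS]mulrA ler_wpM2r ?japanese_weight// mulr_ge0.
Qed.

(** By a <= 1 + a^2. *)
Lemma g_mass : exists2 A : R, 0 <= A & (\int[mu2 R]_y (g y)%:E <= A%:E)%E.
Proof.
have [M1 M10 h1] := weight_integral e0; have [A A0 hA] := weight_sqr_finite.
exists (4 * K * (M1 + A)); first by rewrite mulr_ge0// addr_ge0.
apply: ge0_int_leZ => //.
have mwa2 : measurable_fun [set: mplane R] (fun y => w y * a y ^+ 2).
  by apply: measurable_funM => //; exact: measurable_funX.
have wa20 y : 0 <= w y * a y ^+ 2 by rewrite mulr_ge0 ?sqr_ge0.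
apply: le_trans (ge0_int_leD mw mwa2 w0 wa20 h1 hA); apply: mu2_le => [|||y].
- exact/measurable_EFinP.
- by apply/measurable_EFinP; exact: measurable_funD.
- by move=> y; rewrite lee_fin.
- rewrite lee_fin -[X in _ <= X + _]mulr1 -mulrDr ler_wpM2l//; have := sqr_ge0 (a y - 1); have := a0 y; nra.
Qed.

Let moment2_le (f : plane R -> R[i]) : cmeasurable f ->
  (forall y, cmod (f y) <= K * (w y * w y * a y)) -> moment2 f.
Proof.
move=> mf hf; have [A A0 hA] := g_mass; split => //.
  by apply: measurable_funX; apply: measurable_funD => //; exact: measurable_enorm.
apply: (@le_lt_trans _ _ A%:E); last by rewrite ltry.
apply: le_trans hA; apply: mu2_le => [|||y].
- apply/measurable_EFinP; apply: measurable_funM; first exact: measurable_cmod.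
  apply: measurableT_comp => //; apply: measurable_funX; apply: measurable_funD => //; exact: measurable_enorm.
- exact/measurable_EFinP.
- by move=> y; rewrite lee_fin mulr_ge0 ?cmod_ge0.
- by rewrite lee_fin ger0_norm ?sqr_ge0// mulrC fg.
Qed.

Lemma moment2_f0 : moment2 f0. Proof. exact: moment2_le. Qed.

Lemma moment2_f1 : moment2 f1. Proof. exact: moment2_le. Qed.

Let loc_int_le (psi h : plane R -> R[i]) (b : R) : cmeasurable psi -> cmeasurable h ->
  (forall y, cmod (h y) <= b + H y) -> {ae mu2 R, forall x, psi x = h x} -> loc_int psi.
Proof.
move=> mpsi mh hh ph; apply: (@loc_int_ae _ h) => //; last by apply: (ae_imp _ ph) => x ->.
apply/loc_intP; split => // N N0; have mb : measurable_fun [set: mplane R] (\1_(box 0 N) : mplane R -> R).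
  by apply: measurable_indic; exact: box_measurable.
apply: L1_pairable => //.
apply: (@L1_le _ _ (fun y => (`|b| + 1) * \1_(box 0 N) y + H y ^+ 2)).
- by apply: measurable_funM => //; exact: measurable_cmod.
- move=> y; rewrite ger0_norm ?mulr_ge0 ?cmod_ge0//.
  rewrite indicE; case: (_ \in _); rewrite ?mulr1 ?mulr0 ?add0r ?sqr_ge0//.
  apply: le_trans (hh y) _; have := ler_norm b; have := H0 y; have := sqr_ge0 (H y - 1); nra.
- by apply: L1D => //; apply: L1Z; exact: L1_box.
Qed.

Lemma loc_psi0 : loc_int psi0.
Proof.
apply: (@loc_int_le _ (fun x => c + g0 x) (cmod c + 1)) => //.
  by apply: cmeasurableD (cmeasurable_cst c) dg0.1.
by move=> y; apply: le_trans (cmodD _ _) _; rewrite -addrA lerD2l.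
Qed.

Lemma loc_psi1 : loc_int psi1.
Proof. by apply: (@loc_int_le _ g1 1) => //; exact: dg1.1. Qed.

Let m_neq0 : m != 0. Proof. exact: lt0r_neq0. Qed.

Lemma charge_f0 : dist f0 (fun=> 1) = 0.
Proof. exact (charge0 loc_psi0 loc_psi1 moment2_f0 moment2_f1 E0 E1 dg0 p0 m_neq0). Qed.

Lemma psi1_pot : {ae mu2 R, forall x,
  psi1 x = cauchy_cst * (pot (grad_ln 0) f0 x + 'i * pot (grad_ln 1) f0 x)}.
Proof. exact (psi1_repr loc_psi1 moment2_f0 E0 dg1 p1). Qed.

Lemma psi0_pot : {ae mu2 R, forall x,
  psi0 x = c + (m / pi)%:C * pot ln_norm f0 x + cauchy_cst * (pot (grad_ln 0) f1 x - 'i * pot (grad_ln 1) f1 x)}.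
Proof. exact (psi0_repr loc_psi0 loc_psi1 moment2_f0 moment2_f1 E0 E1 dg0 p0 m_neq0). Qed.

Lemma pi_ge1 : 1 <= pi :> R.
Proof. by apply: le_trans (pi_ge2 R); rewrite ler1n. Qed.

Lemma cmod_i : cmod ('i : R[i]) = 1.
Proof. by rewrite cmodE /= expr0n /= add0r expr1n sqrtr1. Qed.

Lemma cauchy_cst_le : cmod cauchy_cst <= 1 :> R.
Proof.
rewrite /cauchy_cst cmodM cmod_i mulr1 cmodC normrN ger0_norm ?invr_ge0 ?mulr_ge0 ?(le_trans _ pi_ge1)//.
rewrite invf_le1 ?mulr_gt0 ?(lt_le_trans _ pi_ge1)//; have := pi_ge1; lra.
Qed.

(** The three potentials of the representation formula decay in terms of the
    Riesz potential of g at the same point, wherever that is finite. *)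
Lemma pot_bound (A : R) : (\int[mu2 R]_y (g y)%:E <= A%:E)%E ->
  {ae mu2 R, forall x, forall S : R, (riesz g x <= S%:E)%E ->
    (1 + enorm x) * cmod (psi0 x - c) <= 2 * (m + 2) * (S + A) /\
    (1 + enorm x) * cmod (psi1 x) <= 2 * (m + 2) * (S + A)}.
Proof.
move=> hA; apply: (ae_imp2 _ psi0_pot psi1_pot) => x -> -> S hS.
have X0 : 0 <= 1 + enorm x by rewrite addr_ge0 ?enorm_ge0.
have gk0 j := pot_grad_ln_decay mf0 mg (fg hf0) hA j hS.
have gk1 j := pot_grad_ln_decay mf1 mg (fg hf1) hA j hS.
have gl := pot_ln_norm_decay mf0 mg (fg hf0) hA charge_f0 (moment2_pairable_const moment2_f0) hS.
have SA : 0 <= 2 * (S + A) by apply: le_trans (gk0 0); rewrite mulr_ge0 ?cmod_ge0.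
have comb (u v s : R[i]) : cmod s <= 1 -> (1 + enorm x) * cmod u <= 2 * (S + A) ->
   (1 + enorm x) * cmod v <= 2 * (S + A) ->
   (1 + enorm x) * cmod (cauchy_cst * (u + s * v)) <= 2 * (2 * (S + A)).
  move=> s1 hu hv; apply: (@le_trans _ _ ((1 + enorm x) * (cmod u + cmod v))).
    rewrite ler_wpM2l// cmodM -[leRHS]mul1r ler_pM ?cmod_ge0 ?cauchy_cst_le//.
    apply: le_trans (cmodD _ _) _; rewrite lerD2l cmodM.
    by rewrite -[leRHS]mul1r ler_wpM2r ?cmod_ge0.
  by rewrite mulrDr; lra.
have i1 : cmod ('i : R[i]) <= 1 by rewrite cmod_i.
split; last first.
  apply: le_trans (comb _ _ _ i1 (gk0 0) (gk0 1)) _.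
  by have := mulr_ge0 (ltW m0) SA; lra.
rewrite -[X in cmod (X - c)]addrA [X in cmod (X - c)]addrC addrK -mulNr.
have i2 : cmod (- 'i : R[i]) <= 1 by rewrite cmodN.
have h1 := comb _ _ _ i2 (gk1 0) (gk1 1).
have h2 : (1 + enorm x) * cmod ((m / pi)%:C * pot ln_norm f0 x) <= m * (2 * (S + A)).
  rewrite cmodM cmodC mulrCA; apply: ler_pM => //; first by rewrite mulr_ge0 ?cmod_ge0.
  rewrite ger0_norm ?divr_ge0 ?(ltW m0) ?(le_trans _ pi_ge1)//.
  by rewrite ler_pdivrMr ?(lt_le_trans _ pi_ge1)// ler_peMr ?(ltW m0)// pi_ge1.
apply: (@le_trans _ _ ((1 + enorm x) * (cmod ((m / pi)%:C * pot ln_norm f0 x) +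
   cmod (cauchy_cst * (pot (grad_ln 0) f1 x + - 'i * pot (grad_ln 1) f1 x))))).
  by rewrite ler_wpM2l// cmodD.
by rewrite mulrDr; move: h1 h2; lra.
Qed.

Lemma rieszZ (b : R) (h : mplane R -> R) x : 0 <= b -> measurable_fun [set: mplane R] h -> (forall y, 0 <= h y) ->
  riesz (fun y => b * h y) x = (b%:E * riesz h x)%E.
Proof.
move=> b0 mh h0; rewrite /riesz -ge0_integralZl_EFin//.
- by apply: eq_integral => y _; rewrite -EFinM mulrCA.
- by move=> y _; rewrite lee_fin mulr_ge0 ?sqr_ge0.
- apply/measurable_EFinP; apply: measurable_funM => //; apply: measurable_funX; exact: measurable_invroot_shift.
Qed.

(** The decay estimate at x bounds a by the Riesz potential of w a, which is
    the hypothesis of [riesz_bounded]; where the potential is infinite there is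
    nothing to prove. *)
Lemma riesz_wa_bounded : exists2 S : R, 0 <= S & forall x, (riesz (fun z => w z * a z)%R x <= S%:E)%E.
Proof.
have [A A0 hA] := g_mass; have [A2 A20 hA2] := weight_sqr_finite.
(* The bound |psi| <= |c| + 4 (m + 2) (4 K N + A), with N the Riesz potential
   of w a, is put in the form (C + 1) (1 + N). *)
pose C := cmod c + 4 * (m + 2) * (4 * K + A).
have C4 : 0 <= 4 * (m + 2) by rewrite mulr_ge0// addr_ge0// ltW.
have C0 : 0 <= C by rewrite addr_ge0 ?cmod_ge0// mulr_ge0// addr_ge0.
have C1 : 4 * (m + 2) * (4 * K) <= C + 1.
  rewrite /C (mulrDr _ (4 * K)); have := cmod_ge0 c; have := mulr_ge0 C4 A0; lra.
apply: (riesz_bounded e0 ma a0 A20 hA2 (_ : 0 <= C + 1)); first by rewrite addr_ge0.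
apply: (ae_imp _ (pot_bound hA)) => x hx.
have n0 : (0 <= riesz (fun z => w z * a z)%R x)%E.
  by apply: integral_ge0 => y _; rewrite lee_fin mulr_ge0 ?sqr_ge0.
have [fin|inf] := boolP (riesz (fun z => w z * a z)%R x < +oo)%E; last first.
  move: inf; rewrite ltNge negbK leye_eq => /eqP ->.
  by rewrite gt0_muley ?lte_fin ?ltr_pwDr// addey ?leey.
set s := fine (riesz (fun z => w z * a z)%R x).
have es : riesz (fun z => w z * a z)%R x = s%:E by rewrite fineK// ge0_fin_numE.
have s0 : 0 <= s by rewrite -lee_fin -es.
have [] := hx (4 * K * s); first by rewrite rieszZ// es.
have X1 : 1 <= 1 + enorm x by rewrite lerDl enorm_ge0.
have up (z : R[i]) (B : R) : (1 + enorm x) * cmod z <= B -> cmod z <= B.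
  by apply: le_trans; rewrite ler_peMl ?cmod_ge0.
move=> /up h0 /up h1; rewrite es -EFinM -EFinD lee_fin.
have h2 : cmod (psi0 x) <= cmod c + cmod (psi0 x - c).
  by have := cmodD c (psi0 x - c); rewrite addrC subrK.
rewrite /a; apply: (@le_trans _ _ (cmod c + 4 * (m + 2) * (4 * K * s + A))).
  by move: h0 h1 h2; lra.
have := ler_wpM2r s0 C1; have := mulr_ge0 C4 K4; rewrite /C; lra.
Qed.

Lemma psi_decay : exists2 C : R, 0 <= C & {ae mu2 R, forall x,
  cmod (psi0 x - c) <= C / (1 + enorm x) /\ cmod (psi1 x) <= C / (1 + enorm x)}.
Proof.
have [A A0 hA] := g_mass; have [S S0 hS] := riesz_wa_bounded.
exists (2 * (m + 2) * (4 * K * S + A)).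
  by rewrite mulr_ge0 ?addr_ge0 ?mulr_ge0 ?addr_ge0// ltW.
apply: (ae_imp _ (pot_bound hA)) => x hx.
have X0 : 0 < 1 + enorm x by rewrite ltr_pwDl// enorm_ge0.
have [|h0 h1] := hx (4 * K * S).
  by rewrite rieszZ// [(_ * S)%:E]EFinM; apply: lee_wpmul2l; rewrite ?lee_fin.
by split; rewrite ler_pdivlMr// mulrC.
Qed.

Lemma zero_mode_analysis : [/\ moment2 f0, moment2 f1, dist f0 (fun=> 1) = 0,
  {ae mu2 R, forall x, psi1 x = cauchy_cst * (pot (grad_ln 0) f0 x + 'i * pot (grad_ln 1) f0 x)} &
  {ae mu2 R, forall x, psi0 x =
     c + (m / pi)%:C * pot ln_norm f0 x + cauchy_cst * (pot (grad_ln 0) f1 x - 'i * pot (grad_ln 1) f1 x)} /\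
  exists2 C : R, 0 <= C & {ae mu2 R, forall x,
    cmod (psi0 x - c) <= C / (1 + enorm x) /\ cmod (psi1 x) <= C / (1 + enorm x)}].
Proof.
split; [exact moment2_f0|exact moment2_f1|exact charge_f0|exact psi1_pot|].
by split; [exact psi0_pot|exact psi_decay].
Qed.

End Bootstrapping.

(** * Lebesgue spaces *)

Section LebesgueSpaces. Context {R : realType}.
Implicit Types (x y : mplane R) (G : plane R -> R[i]).

Lemma Lp_L1 G (r : R) : 0 < r -> cLp r%:E G -> L1 (fun x => cmod (G x) `^ r).
Proof.
move=> r0 [mG fG]; apply/L1P; split.
  exact: (measurableT_comp (measurable_powR r) (measurable_cmod mG)).
move: fG; rewrite /finite_norm => h.
have := poweR_lty r h; rewrite poweR_Lnorm ?gt_eqF//.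
congr (_ < _)%E; apply: eq_integral => x _.
by rewrite /= (ger0_norm (cmod_ge0 (G x))) (ger0_norm (powR_ge0 _ _)).
Qed.

Lemma L1_Lp G (r : R) : 0 < r -> cmeasurable G -> L1 (fun x => cmod (G x) `^ r) -> cLp r%:E G.
Proof.
move=> r0 mG /L1P[_ h]; split => //; rewrite /finite_norm.
apply: (@lty_poweRy _ _ r); first by rewrite gt_eqF.
rewrite poweR_Lnorm ?gt_eqF//; move: h; congr (_ < _)%E; apply: eq_integral => x _.
by rewrite /= (ger0_norm (cmod_ge0 (G x))) (ger0_norm (powR_ge0 _ _)).
Qed.

(** Split at the level tau: above it the function is at most tau^(1-r) times
    its r-th power. *)
Lemma Lp_vanishing G (r : R) : 1 <= r -> cLp r%:E G -> vanishing G.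
Proof.
move=> r1 hG; have r0 : 0 < r by apply: lt_le_trans r1.
split; first by case: hG.
move=> tau t0; exists (fun x => tau `^ (1 - r) * cmod (G x) `^ r).
  by apply: L1Z; exact: Lp_L1.
move=> x; have g0 := cmod_ge0 (G x).
have [h|h] := leP (cmod (G x)) tau.
  by apply: le_trans h _; rewrite lerDl mulr_ge0 ?powR_ge0.
have gp : 0 < cmod (G x) by apply: lt_trans h.
rewrite ler_wpDl ?(ltW t0)//.
apply: (@le_trans _ _ (cmod (G x) `^ (1 - r) * cmod (G x) `^ r)).
  rewrite -powRD ?subrK ?powRr1//; by apply/implyP => _; rewrite gt_eqF.
rewrite ler_wpM2r ?powR_ge0// -opprB !powRN lef_pV2 ?posrE ?powR_gt0//.
by rewrite ge0_ler_powR ?subr_ge0 ?nnegrE ?(ltW t0) ?(ltW h).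
Qed.

Lemma vanishingD G1 G2 : vanishing G1 -> vanishing G2 -> vanishing (fun x => G1 x + G2 x).
Proof.
move=> [m1 h1] [m2 h2]; split; first exact: cmeasurableD.
move=> tau t0; have t2 : 0 < tau / 2 by rewrite divr_gt0.
have [u iu hu] := h1 _ t2; have [v iv hv] := h2 _ t2.
exists (fun x => u x + v x); first exact: L1D.
by move=> x; apply: le_trans (cmodD _ _) _; have := hu x; have := hv x; lra.
Qed.

(** For r >= 2 the power r/2 dominates the function where it exceeds 1 and is
    square integrable. *)
Lemma Lp_half G (r : R) : 2 <= r -> cLp r%:E G ->
  [/\ measurable_fun [set: mplane R] (fun x => cmod (G x) `^ (r / 2)),
      L1 (fun x => (cmod (G x) `^ (r / 2)) ^+ 2) &
      forall x, cmod (G x) <= 1 + cmod (G x) `^ (r / 2)].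
Proof.
move=> r2 hG; have r0 : 0 < r by apply: lt_le_trans r2.
split.
- exact: (measurableT_comp (measurable_powR (r / 2)) (measurable_cmod hG.1)).
- rewrite (_ : (fun x => _) = fun x => cmod (G x) `^ r); first exact: Lp_L1.
  apply/funext => x; rewrite -powR_mulrn ?powR_ge0// -powRrM; congr (_ `^ _); by field.
- move=> x; have [h|h] := leP (cmod (G x)) 1; first by rewrite (le_trans h)// lerDl powR_ge0.
  have r1 : 1 <= r / 2 by rewrite ler_pdivlMr// mul1r.
  by have := le1r_powR (ltW h) r1; lra.
Qed.

(** The weight with exponent r - 2 is <x>^(-r), which is integrable exactly in
    the range r > 2 needed here. *)
Lemma decay_weight (r : R) x : 0 < r -> (1 + enorm x)^-1 `^ r <= weight (r - 2) x.
Proof.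
move=> r0; have j1 := japanese_ge1 x; have jp : 0 < japanese x by apply: lt_le_trans j1.
have X0 : 0 < 1 + enorm x by rewrite ltr_pwDl// enorm_ge0.
rewrite /weight (_ : -2 - (r - 2) = - r); last by ring.
rewrite powRN -(powR_inv1 (ltW X0)) -powRrM mulN1r powRN lef_pV2 ?posrE ?powR_gt0//.
by rewrite ge0_ler_powR ?nnegrE ?(ltW r0) ?(ltW jp) ?(ltW X0)// japanese_le.
Qed.

Lemma decay_Lq G C (q : \bar R) : cmeasurable G -> 0 <= C ->
  {ae mu2 R, forall x, cmod (G x) <= C / (1 + enorm x)} -> (2%:E < q)%E -> cLp q G.
Proof.
move=> mG C0 hG; case: q => [r||//] hq.
  have r2 : 2 < r by rewrite -lte_fin.
  have r0 : 0 < r by apply: lt_trans r2.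
  have e0 : 0 < r - 2 by rewrite subr_gt0.
  have mGr : measurable_fun [set: mplane R] (fun x => cmod (G x) `^ r).
    exact: (measurableT_comp (measurable_powR r) (measurable_cmod mG)).
  apply: L1_Lp => //; apply/L1P; split => //.
  have [M M0 hM] := weight_integral e0.
  apply: (@le_lt_trans _ _ (C `^ r * M)%:E); last by rewrite ltry.
  apply: le_trans (ge0_int_leZ (powR_ge0 _ _) (measurable_weight _) (fun x => weight_ge0 _ x) hM).
  apply: ae_ge0_le_integral => //.
  - by apply/measurable_EFinP; exact: measurableT_comp.
  - by move=> x _; rewrite lee_fin mulr_ge0 ?powR_ge0 ?weight_ge0.
  - by apply/measurable_EFinP; apply: measurable_funM => //; exact: measurable_weight.
  apply: (ae_imp _ hG) => x hx _; rewrite lee_fin ger0_norm ?powR_ge0//.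
  have X0 : 0 <= (1 + enorm x)^-1 by rewrite invr_ge0 addr_ge0// enorm_ge0.
  apply: (@le_trans _ _ ((C / (1 + enorm x)) `^ r)).
    by rewrite ge0_ler_powR ?nnegrE ?cmod_ge0 ?(ltW r0)// mulr_ge0.
  by rewrite powRM// ler_wpM2l ?powR_ge0//; exact: decay_weight.
split=> //; rewrite /finite_norm unlock; case: ifPn => // _.
apply: (@le_lt_trans _ _ C%:E); last by rewrite ltry.
apply/ess_sup_inf.ess_supP; apply: (ae_imp _ hG) => x hx.
rewrite /= lee_fin ger0_norm ?cmod_ge0//; apply: le_trans hx _.
by rewrite ler_pdivrMr ?ltr_pwDl ?enorm_ge0// ler_peMr// lerDl enorm_ge0.
Qed.

Lemma cLp0 (q : \bar R) : (1 <= q)%E -> cLp q (fun=> 0 : R[i]).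
Proof.
move=> q1; split; first exact: cmeasurable_cst.
by rewrite (_ : (fun x => _) = cst 0) ?finite_norm_cst0//; apply/funext => x; rewrite cmod0.
Qed.

End LebesgueSpaces.

(** * Spinors, inner products and orthogonal projections *)

Section SpinorCalculus. Context {R : realType}.
Implicit Types (f g : plane R -> R[i]) (F G D : plane R -> spinor R).

Lemma sum2 (V : nmodType) (F : 'I_2 -> V) : \sum_k F k = F 0 + F 1.
Proof.
rewrite big_ord_recl big_ord1; congr (_ + F _); exact: val_inj.
Qed.

Lemma mulmx2 (n : nat) (A : 'M[R[i]]_2) (B : 'M[R[i]]_(2, n)) i j :
  (A *m B) i j = A i 0 * B 0 j + A i 1 * B 1 j.
Proof. by rewrite mxE sum2. Qed.

Lemma spinor_ext (u w : spinor R) : u 0 0 = w 0 0 -> u 1 0 = w 1 0 -> u = w.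
Proof.
move=> h0 h1; apply/matrixP => i j; rewrite (ord1 j).
by case: (I2_cases i) => ->.
Qed.

Lemma rdiagE (d : 'I_2 -> R) i j : rdiag d i j = if i == j then (d i)%:C else 0.
Proof. by rewrite !mxE; case: eqP => [->|]; rewrite ?mulr1n ?mulr0n. Qed.

Lemma rdiag_mul n (d : 'I_2 -> R) (A : 'M[R[i]]_(2, n)) i j : (rdiag d *m A) i j = (d i)%:C * A i j.
Proof. by rewrite mul_diag_mx !mxE. Qed.

Lemma conjCE (z : R[i]) : z^* = complex.Re z -i* complex.Im z.
Proof. by case: z. Qed.

Lemma cmod_conj (z : R[i]) : cmod (z^*) = cmod z.
Proof. by rewrite !cmodE; case: z => a b /=; rewrite sqrrN. Qed.

Lemma conj_mul (z : R[i]) : z^* * z = (cmod z ^+ 2)%:C.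
Proof.
rewrite cmodE sqr_sqrtr ?addr_ge0 ?sqr_ge0//; case: z => a b.
by apply: complex_ext; rewrite /= ; ring.
Qed.

Lemma cmeasurable_conj f : cmeasurable f -> cmeasurable (fun x => (f x)^*).
Proof.
move=> [m1 m2]; split.
  by rewrite (_ : (fun x => _) = fun x => complex.Re (f x))//; apply/funext => x; case: (f x).
rewrite (_ : (fun x => _) = fun x => - complex.Im (f x)); first exact: measurableT_comp.
by apply/funext => x; case: (f x).
Qed.

Lemma cmeasurable_real (h : mplane R -> R) : measurable_fun [set: mplane R] h -> cmeasurable (fun x => (h x)%:C).
Proof. by move=> mh; split => //=; exact: measurable_cst. Qed.

(** Either a weak derivative exists, and is locally integrable, or the
    conventional value 0 is taken. *)
Lemma wpd_measurable j f : cmeasurable (wpd j f).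
Proof.
by rewrite /wpd; case: xgetP => [g _ [_ [] //]|_]; exact: cmeasurable_cst.
Qed.

Lemma cint_dist f : cint f = dist f (fun=> 1).
Proof. by rewrite /dist; congr cint; apply/funext => x; rewrite mulr1. Qed.

Lemma cint_ae f g : cmeasurable f -> cmeasurable g -> {ae mu2 R, forall x, f x = g x} ->
  cint f = cint g.
Proof. by move=> mf mg fg; rewrite !cint_dist; exact: dist_ae. Qed.

Lemma Rint_eq0 (h : mplane R -> R) : L1 h -> (forall x, 0 <= h x) -> \int[mu2 R]_x h x = 0 ->
  {ae mu2 R, forall x, h x = 0}.
Proof.
move=> ih h0 e; have [mh lh] := (L1P _).1 ih.
have e1 : (\int[mu2 R]_x `|(h x)%:E| = 0)%E.
  have eh : (\int[mu2 R]_x `|(h x)%:E| = \int[mu2 R]_x (h x)%:E)%E.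
    by apply: eq_integral => x _; rewrite gee0_abs ?lee_fin.
  rewrite eh -[RHS]/(0%:E) -e /Rintegral fineK// ge0_fin_numE; last by apply: integral_ge0 => x _; rewrite lee_fin.
  by move: lh; congr (_ < _)%E; apply: eq_integral => x _; rewrite ger0_norm.
have mhE : measurable_fun [set: mplane R] (EFin \o h) by exact/measurable_EFinP.
have := (ae_eq_integral_abs (mu2 R) measurableT mhE).1 e1.
by apply: ae_imp => x /(_ I) /= [].
Qed.

Lemma pairable1_le f (h : mplane R -> R) : cmeasurable f -> L1 h -> (forall x, cmod (f x) <= h x) -> pairable f (fun=> 1).
Proof.
move=> mf ih hf; apply: L1_pairable => //; apply: (@L1_le _ _ h) => //.
  by apply: measurable_funM => //; exact: measurable_cmod.
by move=> x; rewrite mulr1 ger0_norm ?cmod_ge0.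
Qed.

Lemma L2_L1 f : cLp 2%:E f -> L1 (fun x => cmod (f x) ^+ 2).
Proof.
move=> hf; have := Lp_L1 (ltr0Sn R 1) hf; congr (_.-integrable _ _); apply/funext => x /=.
by rewrite powR_mulrn ?cmod_ge0.
Qed.

Lemma L1_L2 f : cmeasurable f -> L1 (fun x => cmod (f x) ^+ 2) -> cLp 2%:E f.
Proof.
move=> mf h; apply: L1_Lp => //; move: h; congr (_.-integrable _ _); apply/funext => x /=.
by rewrite powR_mulrn ?cmod_ge0.
Qed.

Lemma L2_mul f g : cLp 2%:E f -> cLp 2%:E g -> pairable (fun x => (f x)^* * g x) (fun=> 1).
Proof.
move=> hf hg; apply: (@pairable1_le _ (fun x => cmod (f x) ^+ 2 + cmod (g x) ^+ 2)).
- by apply: cmeasurableM hg.1; apply: cmeasurable_conj hf.1.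
- by apply: L1D; exact: L2_L1.
- move=> x; rewrite cmodM cmod_conj.
  by have := sqr_ge0 (cmod (f x) - cmod (g x)); have := sqr_ge0 (cmod (f x) + cmod (g x)); lra.
Qed.

Lemma L2_sub f g : cLp 2%:E f -> cLp 2%:E g -> cLp 2%:E (fun x => f x - g x).
Proof.
move=> hf hg; have mfg : cmeasurable (fun x => f x - g x).
  have := cmeasurableD hf.1 (cmeasurableZ (-1) hg.1); congr cmeasurable.
  by apply/funext => x; rewrite mulN1r.
apply: L1_L2 => //.
apply: (@L1_le _ _ (fun x => 2 * cmod (f x) ^+ 2 + 2 * cmod (g x) ^+ 2)).
- by apply: measurable_funX; exact: measurable_cmod.
- move=> x; rewrite ger0_norm ?sqr_ge0//.
  apply: (@le_trans _ _ ((cmod (f x) + cmod (g x)) ^+ 2)).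
    by rewrite lerXn2r ?nnegrE ?cmod_ge0 ?addr_ge0 ?cmod_ge0// (le_trans (cmodD _ _))// cmodN.
  by have := sqr_ge0 (cmod (f x) - cmod (g x)); lra.
- by apply: L1D; apply: L1Z; exact: L2_L1.
Qed.

Lemma Lp2_sub F G : Lp2 2%:E F -> Lp2 2%:E G -> Lp2 2%:E (fun x => F x - G x).
Proof.
move=> hF hG k; have := L2_sub (hF k) (hG k); congr cLp.
by apply/funext => x; rewrite !mxE.
Qed.

Lemma innerE F G : inner F G = cint (fun x => (F x 0 0)^* * G x 0 0 + (F x 1 0)^* * G x 1 0).
Proof. by rewrite /inner; congr cint; apply/funext => x; rewrite sum2. Qed.

Lemma inner_subl F G D : Lp2 2%:E F -> Lp2 2%:E G -> Lp2 2%:E D ->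
  inner (fun x => F x - G x) D = inner F D - inner G D.
Proof.
move=> hF hG hD; rewrite !innerE !cint_dist.
have d k : pairable (fun x => (F x k 0)^* * D x k 0) (fun=> 1) by exact: L2_mul.
have d' k : pairable (fun x => (G x k 0)^* * D x k 0) (fun=> 1) by exact: L2_mul.
have e := distZf (-1) (pairableDf (d' 0) (d' 1)); rewrite mulN1r in e; rewrite -e -distDf.
- by congr dist; apply/funext => x; rewrite !mxE !rmorphB/=; ring.
- exact: pairableDf.
- by apply: pairableZf; exact: pairableDf.
Qed.

Lemma inner_self D : inner D D = (\int[mu2 R]_x (cmod (D x 0 0) ^+ 2 + cmod (D x 1 0) ^+ 2))%:C.
Proof.
rewrite innerE /cint; apply: complex_ext => /=.
  by apply: eq_Rintegral => x _; rewrite !conj_mul.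
rewrite /Rintegral integral0_eq// => x _; by rewrite !conj_mul/= addr0.
Qed.

Lemma inner_self0 D : Lp2 2%:E D -> inner D D = 0 -> {ae mu2 R, forall x, D x = 0}.
Proof.
move=> hD; rewrite inner_self => /(congr1 (@complex.Re R)) /= h.
have i2 := L1D (L2_L1 (hD 0)) (L2_L1 (hD 1)).
have p2 x : 0 <= cmod (D x 0 0) ^+ 2 + cmod (D x 1 0) ^+ 2 by rewrite addr_ge0 ?sqr_ge0.
apply: (ae_imp _ (Rint_eq0 i2 p2 h)) => x /eqP.
rewrite paddr_eq0 ?sqr_ge0// !sqrf_eq0 => /andP[h0 h1].
have z (u : R[i]) : cmod u == 0 -> u = 0 by move=> /eqP; exact: ComplexField.Normc.eq0_normc.
by apply: spinor_ext; rewrite mxE; apply: z.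
Qed.

(** An element of N is its own best approximation, and any other candidate
    differs from it by an element of norm 0. *)
Lemma orthproj_mem (N : set (plane R -> spinor R)) F : Lp2 2%:E F -> N `<=` Lp2 2%:E -> N F ->
  {ae mu2 R, forall x, F x = orthproj N F x}.
Proof.
move=> hF hN NF; rewrite /orthproj; case: xgetP => [g _ [Ng hg]|/(_ F)]; last first.
  case; split => // h _; rewrite innerE cint_dist.
  have -> : (fun x : plane R => (h x 0 0)^* * (F x - F x) 0 0 + (h x 1 0)^* * (F x - F x) 1 0) = fun=> 0.
    by apply/funext => x; rewrite subrr !mxE !mulr0 addr0.
  by rewrite distE; apply: complex_ext => /=; rewrite /Rintegral integral0_eq// => x _; rewrite mul0r.
have hg2 := hN _ Ng; have hD := Lp2_sub hF hg2.
have := inner_subl hF hg2 hD; rewrite (hg _ NF) (hg _ Ng) subrr => /(inner_self0 hD).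
by apply: ae_imp => x /eqP; rewrite subr_eq0 => /eqP.
Qed.

End SpinorCalculus.

Section ColumnProjection. Context {R : realType}.
Implicit Types (f g : plane R -> R[i]) (F G D : plane R -> spinor R).

Lemma L2_ae f g : cmeasurable g -> {ae mu2 R, forall x, f x = g x} -> cLp 2%:E f -> cLp 2%:E g.
Proof.
move=> mg fg hf; have /L1P[mf2 lf] := L2_L1 hf.
have mg2 : measurable_fun [set: mplane R] (fun x => cmod (g x) ^+ 2).
  by apply: measurable_funX; exact: measurable_cmod.
apply: L1_L2 => //; apply/L1P; split => //; apply: le_lt_trans lf.
rewrite le_eqVlt; apply/orP; left; apply/eqP; apply: ae_eq_integral => //.
- by apply/measurable_EFinP; exact: measurableT_comp.
- by apply/measurable_EFinP; exact: measurableT_comp.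
- by apply: (ae_imp _ fg) => x -> _.
Qed.

Variables (v : plane R -> 'M[R[i]]_2).
Hypothesis hc : Lp2 2%:E (first_col v).
Notation col := (first_col v).
Let nrm : R := \int[mu2 R]_x (cmod (col x 0 0) ^+ 2 + cmod (col x 1 0) ^+ 2).

Lemma col_norm : L2norm col ^+ 2 = nrm.
Proof.
rewrite /L2norm sqr_sqrtr; first by apply: eq_Rintegral => x _; rewrite sum2.
by apply: Rintegral_ge0 => // x _; rewrite sum2 addr_ge0 ?sqr_ge0.
Qed.

Lemma col_norm_neq0 : ~ ae_eq2 col (fun=> 0) -> nrm != 0.
Proof.
move=> h; apply/eqP => n0; apply: h; apply: inner_self0 => //.
by rewrite inner_self -/nrm n0.
Qed.

Lemma inner_combo F z z' : Lp2 2%:E F ->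
  inner (fun x => z' *: col x) (fun x => F x - z *: col x) = z'^* * (inner col F - z * nrm%:C).
Proof.
move=> hF; have i1 k := L2_mul (hc k) (hF k); have i2 k := L2_mul (hc k) (hc k).
have e1 : inner col F = dist (fun x => (col x 0 0)^* * F x 0 0 + (col x 1 0)^* * F x 1 0) (fun=> 1).
  by rewrite innerE cint_dist.
have e2 : nrm%:C = dist (fun x => (col x 0 0)^* * col x 0 0 + (col x 1 0)^* * col x 1 0) (fun=> 1).
  by rewrite -cint_dist -innerE inner_self.
have j1 := pairableDf (i1 0) (i1 1); have j2 := pairableDf (i2 0) (i2 1).
rewrite e1 e2 mulrBr mulrA -mulNr -(distZf _ j1) -(distZf _ j2) -distDf; [|exact: pairableZf|exact: pairableZf].
rewrite innerE cint_dist; congr dist; apply/funext => x.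
have zE (b : R[i]) (u : spinor R) k : (b *: u) k 0 = b * u k 0 by rewrite mxE.
have sE (u w : spinor R) k : (u - w) k 0 = u k 0 - w k 0 by rewrite !mxE.
by rewrite !sE !zE !rmorphM /=; ring.
Qed.

(** The line spanned by the column contains exactly one element that makes the
    difference orthogonal to the column; the chosen projection is therefore
    this one, pointwise and not only almost everywhere. *)
Lemma opP_eq F z : nrm != 0 -> Lp2 2%:E F -> inner col F = z * nrm%:C ->
  opP v F = fun x => z *: col x.
Proof.
move=> n0 hF hz; rewrite /opP /orthproj.
have nC : nrm%:C != 0 :> R[i] by apply: contra_neq n0 => /(congr1 (@complex.Re R)).
case: xgetP => [g _ [[z1 ->] hg]|/(_ (fun x => z *: col x))]; last first.
  case; split; first by exists z.
  by move=> h [z' ->]; rewrite inner_combo// hz subrr mulr0.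
have := hg col (ex_intro _ 1 _); rewrite (_ : (fun x => 1 *: col x) = col); last first.
  by apply/funext => x; rewrite scale1r.
move=> /(_ erefl).
have := @inner_combo F z1 1 hF; rewrite (_ : (fun x => 1 *: col x) = col); last first.
  by apply/funext => x; rewrite scale1r.
move=> -> /eqP; rewrite rmorph1 mul1r hz -mulrBl mulf_eq0 (negbTE nC) orbF subr_eq0.
by move=> /eqP ->.
Qed.

End ColumnProjection.

Section Factorisation. Context {R : realType}.
Implicit Types (d : 'I_2 -> R).

Lemma rdiag_adj d : (rdiag d)^t* = rdiag d.
Proof.
apply/matrixP => i j; rewrite !mxE eq_sym; case: eqP => [->|_].
  by rewrite !mulr1n conjCE /= oppr0.
by rewrite !mulr0n rmorph0.
Qed.

Lemma adj_mul (A B : 'M[R[i]]_2) : (A *m B)^t* = B^t* *m A^t*.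
Proof. by rewrite trmx_mul map_mxM. Qed.

Lemma rdiag_rdiag d d' : rdiag d *m rdiag d' = rdiag (fun j => d j * d' j).
Proof.
apply/matrixP => i j; rewrite rdiag_mul !rdiagE; case: eqP => _; last by rewrite mulr0.
by rewrite -rmorphM.
Qed.

Lemma sgn_abs (t : R) : Num.sqrt `|t| * sgn1 t * Num.sqrt `|t| = t.
Proof.
rewrite mulrAC -expr2 sqr_sqrtr// /sgn1; case: ifPn => h; first by rewrite mulr1 ger0_norm.
by rewrite ltr0_norm ?ltNge// mulrN1 opprK.
Qed.

Lemma sgn1_sqr (t : R) : sgn1 t * sgn1 t = 1.
Proof. by rewrite /sgn1; case: ifP => _; rewrite ?mulr1// mulrNN mulr1. Qed.

Lemma norm_sgn1 (t : R) : `|sgn1 t| = 1.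
Proof. by rewrite /sgn1; case: ifP => _; rewrite ?normrN normr1. Qed.

Lemma measurable_sgn1 : measurable_fun [set: R] (@sgn1 R).
Proof.
rewrite (_ : @sgn1 R = fun t => 2 * \1_(`[0, +oo[%classic) t - 1).
  apply: measurable_funB => //; apply: measurable_funM => //; apply: measurable_indic.
apply/funext => t; rewrite /sgn1 indicE; case: ifPn => h.
  by rewrite mem_set/= ?in_itv/= ?h//; ring.
by rewrite memNset/= ?in_itv/= ?andbT; [ring|exact/negP].
Qed.

(** The modulus of an eigenvalue is the square of the diagonal entry of v, and
    its sign is carried by U. *)
Lemma vUv (lam : 'I_2 -> plane R -> R) (B V : plane R -> 'M[R[i]]_2) x :
  V x = (B x)^t* *m rdiag (fun j => lam j x) *m B x ->
  (vmx lam B x)^t* *m Umx lam x *m vmx lam B x = V x.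
Proof.
move=> ->; rewrite /vmx adj_mul rdiag_adj !mulmxA; congr (_ *m _).
rewrite -2!mulmxA; congr (_ *m _); rewrite !rdiag_rdiag; congr rdiag; apply/funext => j.
by rewrite mulrA sgn_abs.
Qed.

Lemma Umx_sqr (lam : 'I_2 -> plane R -> R) x : Umx lam x *m Umx lam x = 1%:M.
Proof.
apply/matrixP => i j; rewrite /Umx rdiag_rdiag rdiagE mxE sgn1_sqr.
by case: eqP.
Qed.

Lemma cint0 : cint (fun=> 0) = 0 :> R[i].
Proof.
rewrite cint_dist distE; apply: complex_ext => /=; rewrite /Rintegral integral0_eq// => x _.
  by rewrite mul0r.
by rewrite mul0r.
Qed.

Lemma addsE (u w : spinor R) k : (u + w) k 0 = u k 0 + w k 0. Proof. by rewrite mxE. Qed.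

Lemma oppsE (u : spinor R) k : (- u) k 0 = - u k 0. Proof. by rewrite mxE. Qed.

Lemma scalesE (z : R[i]) (u : spinor R) k : (z *: u) k 0 = z * u k 0. Proof. by rewrite mxE. Qed.

Lemma colE (F : 'I_2 -> R[i]) k : (\col_j F j) k 0 = F k. Proof. by rewrite mxE. Qed.

Lemma alpha0E (u : spinor R) :
  ((dirac_alpha 0 *m u) 0 0 = u 1 0) * ((dirac_alpha 0 *m u) 1 0 = u 0 0).
Proof. by split; rewrite mulmx2 /dirac_alpha /= !mxE /= ?mul0r ?mul1r ?add0r ?addr0. Qed.

Lemma alpha1E (u : spinor R) :
  ((dirac_alpha 1 *m u) 0 0 = - ('i * u 1 0)) * ((dirac_alpha 1 *m u) 1 0 = 'i * u 0 0).
Proof. by split; rewrite mulmx2 /dirac_alpha /= !mxE /= ?mul0r ?mulNr ?add0r ?addr0. Qed.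

Lemma betaE (u : spinor R) :
  ((dirac_beta *m u) 0 0 = u 0 0) * ((dirac_beta *m u) 1 0 = - u 1 0).
Proof. by split; rewrite mulmx2 /dirac_beta /= !mxE /= ?mul0r ?mul1r ?mulN1r ?add0r ?addr0. Qed.

Lemma I1E (u : spinor R) : ((I1 *m u) 0 0 = u 0 0) * ((I1 *m u) 1 0 = 0).
Proof. by split; rewrite mulmx2 /I1 /= !mxE /= ?mul0r ?mul1r ?addr0. Qed.

Lemma G0_0 (x : plane R) : G0 (fun=> 0 : R[i]) x = 0.
Proof.
rewrite /G0 (_ : (fun y => _) = fun=> 0); last by apply/funext => y; rewrite mulr0.
by rewrite cint0 mulr0.
Qed.

Lemma alpha_combE (s t : R[i]) (u : 'I_2 -> spinor R) (w : spinor R) :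
  ((s *: (\sum_j dirac_alpha j *m u j) + t *: w) 0 0 = s * (u 0 1 0 - 'i * u 1 1 0) + t * w 0 0) *
  ((s *: (\sum_j dirac_alpha j *m u j) + t *: w) 1 0 = s * (u 0 0 0 + 'i * u 1 0 0) + t * w 1 0).
Proof.
rewrite sum2; move: (u 0) (u 1) => u0 u1.
by split; rewrite addsE !scalesE addsE alpha0E alpha1E.
Qed.

(** The components of calG0: the off-diagonal Cauchy-Riemann operators, and the
    logarithmic potential in the upper component only. *)
Lemma calG0E (m : R) (f : plane R -> spinor R) x :
  (calG0 m f x 0 0 = - 'i * (wpd 0 (G0 (fun y => f y 1 0)) x - 'i * wpd 1 (G0 (fun y => f y 1 0)) x)
      + (2 * m)%:C * G0 (fun y => f y 0 0) x) *
  (calG0 m f x 1 0 = - 'i * (wpd 0 (G0 (fun y => f y 0 0)) x + 'i * wpd 1 (G0 (fun y => f y 0 0)) x)).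
Proof.
have eG k : (fun y => G0v f y k 0) = G0 (fun y => f y k 0) by apply/funext => y; rewrite colE.
have eI0 : (fun y => (I1 *m f y) 0 0) = (fun y => f y 0 0) by apply/funext => y; rewrite I1E.
have eI1 : (fun y => (I1 *m f y) 1 0) = (fun=> 0) by apply/funext => y; rewrite I1E.
have eW j k : wpd2 j (G0v f) x k 0 = wpd j (G0 (fun y => f y k 0)) x by rewrite /wpd2 colE eG.
have g0 : G0v (fun y => I1 *m f y) x 0 0 = G0 (fun y => f y 0 0) x by rewrite /G0v colE eI0.
have g1 : G0v (fun y => I1 *m f y) x 1 0 = 0 by rewrite /G0v colE eI1 G0_0.
have [h0 h1] := alpha_combE (- 'i) (2 * m)%:C (fun j => wpd2 j (G0v f) x) (G0v (fun y => I1 *m f y) x).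
split.
  apply: etrans h0 _; congr (_ * (_ - _ * _) + _ * _); [exact: eW|exact: eW|exact: g0].
apply: etrans h1 _; rewrite g1 mulr0 addr0; congr (_ * (_ + _ * _)); exact: eW.
Qed.

Lemma dirac_alg (I A B D X M F G : R[i]) : I * I = -1 ->
  - I * (- A - I * - B) + M * X + F - M * X = I * A + B + F /\
  - I * (- A + I * - B) + M * - D + G - M * D = I * A - B - 2 * M * D + G.
Proof.
move=> hI; split.
  rewrite (_ : - I * (- A - I * - B) + M * X + F - M * X = I * A - (I * I) * B + F); last by ring.
  by rewrite hI; ring.
rewrite (_ : - I * (- A + I * - B) + M * - D + G - M * D = I * A + (I * I) * B - 2 * M * D + G); last by ring.
by rewrite hI; ring.
Qed.

Lemma lincombE (u1 u2 u3 : spinor R) (z : R[i]) k :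
  (u1 + u2 - z *: u3) k 0 = u1 k 0 + u2 k 0 - z * u3 k 0.
Proof. by rewrite !mxE. Qed.

(** Multiplying out the Pauli matrices; the mass terms cancel in the first
    component and add up in the second. *)
Lemma Dirac_components (m : R) (V : plane R -> 'M[R[i]]_2) (psi : plane R -> spinor R) chi :
  Dirac m (dist2 psi) chi + dist2 (fun x => V x *m psi x) chi - m%:C *: dist2 psi chi = 0 ->
  let D k h := dist (fun x => psi x k 0) h in
  let f k := dist (fun x => (V x *m psi x) k 0) chi in
  ('i * D 1 (pd 0 chi) + D 1 (pd 1 chi) + f 0 = 0) /\
  ('i * D 0 (pd 0 chi) - D 0 (pd 1 chi) - (2 * m)%:C * D 1 chi + f 1 = 0).
Proof.
move=> h D f.
pose u j := ddist j (dist2 psi) chi; pose w := dist2 psi chi.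
have [c0 c1] := alpha_combE (- 'i) m%:C u (dirac_beta *m w).
have eu j k : u j k 0 = - D k (pd j chi) by rewrite /u /ddist oppsE /dist2 colE.
have ew k : w k 0 = D k chi by rewrite /w /dist2 colE.
have ef k : dist2 (fun x => V x *m psi x) chi k 0 = f k by rewrite /dist2 colE.
have cmp k : (Dirac m (dist2 psi) chi) k 0 + f k - m%:C * D k chi = 0.
  have e0 : (Dirac m (dist2 psi) chi + dist2 (fun x => V x *m psi x) chi - m%:C *: dist2 psi chi) k 0 = 0.
    by rewrite h mxE.
  apply: etrans e0; apply/esym/(etrans (lincombE _ _ _ _ _)).
  by congr (_ + _ - _ * _); [exact: ef|exact: ew].
have m2 : (2 * m)%:C = 2 * m%:C by rewrite rmorphM/= rmorphMn rmorph1.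
have [a0 _] := dirac_alg (D 1 (pd 0 chi)) (D 1 (pd 1 chi)) 0 (D 0 chi) m%:C (f 0) 0 (@mulii R).
have [_ a1] := dirac_alg (D 0 (pd 0 chi)) (D 0 (pd 1 chi)) (D 1 chi) 0 m%:C 0 (f 1) (@mulii R).
have b0 : (dirac_beta *m w) 0 0 = D 0 chi by rewrite betaE ew.
have b1 : (dirac_beta *m w) 1 0 = - D 1 chi by rewrite betaE ew.
split.
  rewrite -a0 -(cmp 0); congr (_ + _ - _); apply/esym/(etrans c0).
  by congr (_ * (_ - _ * _) + _ * _); [exact: eu|exact: eu|exact: b0].
rewrite m2 -a1 -(cmp 1); congr (_ + _ - _); apply/esym/(etrans c1).
by congr (_ * (_ + _ * _) + _ * _); [exact: eu|exact: eu|exact: b1].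
Qed.

End Factorisation.

Section Spinors. Context {R : realType}.
Variables (lam : 'I_2 -> plane R -> R) (B : plane R -> 'M[R[i]]_2).
Hypothesis hBmeas : forall i j, cmeasurable (fun x => B x i j).
Hypothesis hlam : forall j, measurable_fun (setT : set (mplane R)) (lam j).
Notation v := (vmx lam B).
Notation U := (Umx lam).

Lemma v_measurable i j : cmeasurable (fun x => v x i j).
Proof.
have -> : (fun x => v x i j) = fun x => (Num.sqrt `|lam i x|)%:C * B x i j.
  by apply/funext => x; rewrite /vmx rdiag_mul.
apply: cmeasurableM => //; apply: cmeasurable_real.
apply: (@measurableT_comp _ _ _ _ _ _ (@Num.sqrt R)).
  by apply: continuous_measurable_fun; exact: sqrt_continuous.
exact: measurableT_comp.
Qed.

Variable psi : plane R -> spinor R.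
Hypothesis mpsi : forall k, cmeasurable (fun x => psi x k 0).
Notation phi := (fun x => U x *m v x *m psi x).

Lemma phiE x k : phi x k 0 = (sgn1 (lam k x))%:C * (v x k 0 * psi x 0 0 + v x k 1 * psi x 1 0).
Proof. by rewrite /= -mulmxA /Umx rdiag_mul mulmx2. Qed.

Lemma phi_measurable k : cmeasurable (fun x => phi x k 0).
Proof.
rewrite (funext (fun x => phiE x k)); apply: cmeasurableM.
  by apply: cmeasurable_real; exact: (measurableT_comp measurable_sgn1).
by apply: cmeasurableD; apply: cmeasurableM => //; exact: v_measurable.
Qed.

Lemma adjE (A : 'M[R[i]]_2) i j : A^t* i j = (A j i)^*.
Proof. by rewrite !mxE. Qed.

Notation src_v := (fun x => (v x)^t* *m phi x).

Lemma src_vE x k : src_v x k 0 = (v x 0 k)^* * phi x 0 0 + (v x 1 k)^* * phi x 1 0.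
Proof. by apply: etrans (mulmx2 _ _ _ _) _; rewrite !adjE. Qed.

Lemma src_v_measurable k : cmeasurable (fun x => src_v x k 0).
Proof.
rewrite (funext (fun x => src_vE x k)); apply: cmeasurableD;
  by apply: cmeasurableM; [apply: cmeasurable_conj; exact: v_measurable|exact: phi_measurable].
Qed.

Variables (e K : R).
Hypotheses (K0 : 0 <= K) (hv : forall i j x, cmod (v x i j) <= K * weight e x).

Lemma phi_le x k : cmod (phi x k 0) <= K * weight e x * (cmod (psi x 0 0) + cmod (psi x 1 0)).
Proof.
rewrite phiE cmodM cmodC norm_sgn1 mul1r; apply: le_trans (cmodD _ _) _.
by rewrite mulrDr !cmodM; apply: lerD; rewrite ler_wpM2r ?cmod_ge0.
Qed.

(** Each of the two factors v in V = v^* U v contributes one weight. *)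
Lemma src_v_le x k : cmod (src_v x k 0) <=
  2 * K ^+ 2 * (weight e x * weight e x * (cmod (psi x 0 0) + cmod (psi x 1 0))).
Proof.
rewrite src_vE; apply: le_trans (cmodD _ _) _; rewrite !cmodM !cmod_conj.
have h j : cmod (v x j k) * cmod (phi x j 0) <=
   (K * weight e x) * (K * weight e x * (cmod (psi x 0 0) + cmod (psi x 1 0))).
  by apply: ler_pM; rewrite ?cmod_ge0 ?hv ?phi_le.
apply: le_trans (lerD (h 0) (h 1)) _; rewrite le_eqVlt; apply/orP; left; apply/eqP; ring.
Qed.

(** The square of the weight is at most the weight, which is integrable. *)
Lemma col_L2 : 0 < e -> Lp2 2%:E (first_col v).
Proof.
move=> e0 k; have eq : (fun x => first_col v x k 0) = fun x => v x k 0.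
  by apply/funext => x; rewrite mxE.
rewrite eq; apply: L1_L2; first exact: v_measurable.
apply/L1P; split; first by apply: measurable_funX; apply: measurable_cmod; exact: v_measurable.
have [M M0 hM] := weight_integral e0.
apply: (@le_lt_trans _ _ (K ^+ 2 * M)%:E); last by rewrite ltry.
apply: le_trans (ge0_int_leZ (sqr_ge0 K) (measurable_weight e) (fun x => weight_ge0 e x) hM).
apply: mu2_le => [|||x].
- apply/measurable_EFinP; apply: measurableT_comp => //; apply: measurable_funX.
  by apply: measurable_cmod; exact: v_measurable.
- by apply/measurable_EFinP; apply: measurable_funM => //; exact: measurable_weight.
- by move=> x; rewrite lee_fin.
- have w0 := weight_ge0 e x; have w1 := weight_le1 x (ltW e0).
  rewrite lee_fin ger0_norm ?sqr_ge0//; apply: (@le_trans _ _ ((K * weight e x) ^+ 2)).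
    by rewrite lerXn2r// nnegrE ?cmod_ge0 ?mulr_ge0.
  by rewrite exprMn ler_wpM2l ?sqr_ge0// expr2 ler_piMr.
Qed.

Lemma phi_L2 (C : R) : 0 < e -> 0 <= C ->
  {ae mu2 R, forall x, cmod (psi x 0 0) + cmod (psi x 1 0) <= C} -> Lp2 2%:E phi.
Proof.
move=> e0 C0 hC k; apply: L1_L2; first exact: phi_measurable.
have mp : measurable_fun [set: mplane R] (fun x => cmod (phi x k 0) ^+ 2).
  by apply: measurable_funX; apply: measurable_cmod; exact: phi_measurable.
apply/L1P; split => //.
have [M M0 hM] := weight_integral e0.
apply: (@le_lt_trans _ _ ((K * C) ^+ 2 * M)%:E); last by rewrite ltry.
apply: le_trans (ge0_int_leZ (sqr_ge0 (K * C)) (measurable_weight e) (fun x => weight_ge0 e x) hM).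
apply: ae_ge0_le_integral => //.
- by apply/measurable_EFinP; exact: measurableT_comp.
- by move=> x _; rewrite lee_fin mulr_ge0 ?sqr_ge0 ?weight_ge0.
- by apply/measurable_EFinP; apply: measurable_funM => //; exact: measurable_weight.
apply: (ae_imp _ hC) => x hx _.
have w0 := weight_ge0 e x; have w1 := weight_le1 x (ltW e0).
rewrite lee_fin ger0_norm ?sqr_ge0//; apply: (@le_trans _ _ ((K * weight e x * C) ^+ 2)).
  rewrite lerXn2r ?nnegrE ?cmod_ge0 ?mulr_ge0//.
  by apply: le_trans (phi_le x k) _; rewrite ler_wpM2l// mulr_ge0.
rewrite mulrAC exprMn ler_wpM2l ?sqr_ge0// expr2 ler_piMr//.
Qed.

Lemma calG0_measurable m (f : plane R -> spinor R) : (forall k, moment2 (fun x => f x k 0)) ->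
  forall k, cmeasurable (fun x => calG0 m f x k 0).
Proof.
move=> sf k; have mG j : cmeasurable (G0 (fun x => f x j 0)).
  rewrite (funext (fun x => G0E (fun x => f x j 0) x)); apply: cmeasurableZ.
  by apply: pot_measurable => //; have [] := ln_norm_ker_bound (R := R).
case: (I2_cases k) => ->.
  rewrite (funext (fun x => (calG0E m f x).1)).
  apply: cmeasurableD; last exact: cmeasurableZ.
  apply: cmeasurableZ; have := cmeasurableD (wpd_measurable 0 (G0 (fun x => f x 1 0)))
    (cmeasurableZ (- 'i) (wpd_measurable 1 (G0 (fun x => f x 1 0)))).
  by congr cmeasurable; apply/funext => x; rewrite mulNr.
rewrite (funext (fun x => (calG0E m f x).2)); apply: cmeasurableZ.
by apply: cmeasurableD; [|apply: cmeasurableZ]; exact: wpd_measurable.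
Qed.

Lemma opT_measurable m : (forall k, moment2 (fun x => src_v x k 0)) ->
  forall k, cmeasurable (fun x => opT m U v phi x k 0).
Proof.
move=> sf k; have mG := calG0_measurable m sf.
have e1 : (fun x => opT m U v phi x k 0) = fun x => (sgn1 (lam k x))%:C * phi x k 0 +
   (v x k 0 * calG0 m src_v x 0 0 + v x k 1 * calG0 m src_v x 1 0).
  by apply/funext => x; apply: etrans (addsE _ _ _) _; congr (_ + _); [exact: rdiag_mul|exact: mulmx2].
rewrite e1; apply: cmeasurableD.
  apply: cmeasurableM; last exact: phi_measurable.
  by apply: cmeasurable_real; exact: (measurableT_comp measurable_sgn1).
by apply: cmeasurableD; apply: cmeasurableM => //; exact: v_measurable.
Qed.

(** The first row of v^* is the conjugate of the column (a,c)^T. *)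
Lemma inner_col_phi : inner (first_col v) phi = dist (fun x => src_v x 0 0) (fun=> 1).
Proof.
rewrite innerE cint_dist; congr dist; apply/funext => x; rewrite src_vE.
by rewrite ![first_col _ _ _ _]mxE.
Qed.

End Spinors.

(** * Zero modes at the threshold *)

Section Remainders. Context {R : realType}.

(** The L^p part contributes its p/2-th power to H and the L^2 part its
    modulus; both are square integrable. *)
Lemma remainder_bound (G1 G2 : plane R -> spinor R) (p : R) : 2 < p ->
  Lp2 p%:E G1 -> Lp2 2%:E G2 ->
  (forall k, vanishing (fun x => G1 x k 0 + G2 x k 0)) /\
  exists H : mplane R -> R, [/\ measurable_fun [set: mplane R] H, forall y, 0 <= H y, L1 (fun y => H y ^+ 2) &
    forall k y, cmod (G1 y k 0 + G2 y k 0) <= 1 + H y].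
Proof.
move=> p2 h1 h2; split.
  move=> k; apply: vanishingD; [apply: (Lp_vanishing _ (h1 k)); lra|apply: (Lp_vanishing _ (h2 k)); lra].
have [m10 i10 b10] := Lp_half (ltW p2) (h1 0); have [m11 i11 b11] := Lp_half (ltW p2) (h1 1).
have i20 := L2_L1 (h2 0); have i21 := L2_L1 (h2 1).
pose u k y := cmod (G1 y k 0) `^ (p / 2); pose w k (y : mplane R) := cmod (G2 y k 0).
have mw k : measurable_fun [set: mplane R] (w k) by apply: measurable_cmod; case: (h2 k).
have u0 k y : 0 <= u k y by exact: powR_ge0.
have w0 k y : 0 <= w k y by exact: cmod_ge0.
pose H (y : mplane R) : R := (u 0 y + u 1 y) + (w 0 y + w 1 y).
have mH : measurable_fun [set: mplane R] H by apply: measurable_funD; exact: measurable_funD.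
exists H; split => //.
- by move=> y; rewrite !addr_ge0.
- apply: (@L1_le _ _ (fun y => 4 * ((u 0 y ^+ 2 + u 1 y ^+ 2) + (w 0 y ^+ 2 + w 1 y ^+ 2)))).
  + exact: measurable_funX.
  + move=> y; rewrite ger0_norm ?sqr_ge0// /H.
    move: (u 0 y) (u 1 y) (w 0 y) (w 1 y) => q r s t.
    have := sqr_ge0 (q - r); have := sqr_ge0 (s - t); have := sqr_ge0 (q + r - (s + t)); nra.
  + by apply: L1Z; apply: L1D; exact: L1D.
- move=> k y; apply: le_trans (cmodD _ _) _.
  have := b10 y; have := b11 y; have := u0 0 y; have := u0 1 y; have := w0 0 y; have := w0 1 y.
  rewrite /H /u /w; case: (I2_cases k) => ->; lra.
Qed.

(** Matches the representation formula for psi0 with the upper component of c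
    e0 - calG0 f; the letters stand for the potentials. *)
Lemma calG0_alg0 (m : R) (c A A' L : R[i]) :
  c + (m / pi)%:C * L + cauchy_cst * (A - 'i * A') =
  c - (- 'i * ((- (2 * pi)^-1)%:C * A - 'i * ((- (2 * pi)^-1)%:C * A')) +
       (2 * m)%:C * ((- (2 * pi)^-1)%:C * L)).
Proof.
have e : (m / pi)%:C = - ((2 * m)%:C * (- (2 * pi)^-1)%:C) :> R[i].
  rewrite -rmorphM -rmorphN; congr (_%:C).
  by have := lt0r_neq0 (pi_gt0 R); move: (pi : R) => q q0; field.
rewrite e /cauchy_cst; set I := ('i : R[i]); set z := (- (2 * pi)^-1)%:C; set M := (2 * m)%:C.
ring.
Qed.

Lemma calG0_alg1 (A A' : R[i]) : cauchy_cst * (A + 'i * A') =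
  - (- 'i * ((- (2 * pi)^-1)%:C * A + 'i * ((- (2 * pi)^-1)%:C * A'))).
Proof. by rewrite /cauchy_cst; set I := ('i : R[i]); set z := (- (2 * pi)^-1)%:C; ring. Qed.

Lemma mulmx_invol (A W : 'M[R[i]]_2) (u : spinor R) : A *m A = 1%:M ->
  A *m (A *m W *m u) = W *m u.
Proof. by move=> AA; rewrite !mulmxA AA mul1mx. Qed.

Lemma mul_spin_up (A : 'M[R[i]]_2) (c : R[i]) : A *m (c *: spin_up) = c *: col 0 A.
Proof. by rewrite -scalemxAr /spin_up -matrix.colE. Qed.

End Remainders.

Theorem lemma7p5 (R : realType) (m : R) (hm : 0 < m)
  (V B : plane R -> 'M[R[i]]_2) (lam : 'I_2 -> plane R -> R)
  (hVsa : forall x, (V x)^t* = V x)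
  (hB : forall x, B x \is unitarymx)
  (hV : forall x, V x = (B x)^t* *m rdiag (fun j => lam j x) *m B x)
  (hBmeas : forall i j, cmeasurable (fun x => B x i j))
  (hlammeas : forall j, measurable_fun (setT : set (mplane R)) (lam j))
  (eps : R) (heps : 0 < eps)
  (hdecay : exists K : R, forall i j x,
     cmod (vmx lam B x i j) <= K * japanese x `^ (- 2 - eps))
  (hcol : ~ ae_eq2 (first_col (vmx lam B)) (fun=> 0))
  (psi G1 G2 : plane R -> spinor R) (c : R[i]) (p : R)
  (hp : 2 < p)
  (hG1 : Lp2 p%:E G1) (hG2 : Lp2 2%:E G2)
  (hpsimeas : forall k, cmeasurable (fun x => psi x k 0))
  (hpsi : ae_eq2 psi (fun x => c *: spin_up + G1 x + G2 x))
  (hsol : dist_sol m V psi) :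
  let U := Umx lam in
  let v := vmx lam B in
  let phi := fun x => U x *m v x *m psi x in
  [/\ ranS1 m U v phi,
      ae_eq2 psi (fun x => c *: spin_up - calG0 m (fun y => (v y)^t* *m phi y) x),
      c = c_0 m U v phi &
      (forall q : \bar R, (2%:E < q)%E -> Lp2 q (fun x => G1 x + G2 x)) /\
      exists G1' G2' : plane R -> spinor R,
        [/\ ae_eq2 psi (fun x => c *: spin_up + G1' x + G2' x),
            Lp2 2%:E G2' &
            forall q : \bar R, (2%:E < q)%E -> Lp2 q G1' /\ Lp2 q G2']].
Proof.
move=> U v phi.
have [K [K0 hv]] : exists K : R, 0 <= K /\ forall i j x, cmod (v x i j) <= K * weight eps x.
  have [K hK] := hdecay; exists `|K|; split => // i j x.
  by apply: le_trans (hK i j x) _; rewrite ler_wpM2r ?powR_ge0// ler_norm.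
pose f x := (v x)^t* *m phi x.
have fV : f = fun x => V x *m psi x.
  by apply/funext => x; rewrite -(vUv (hV x)) /f /phi !mulmxA.
have mf k : cmeasurable (fun x => f x k 0) by exact: (src_v_measurable hBmeas hlammeas hpsimeas k).
have hf k x := src_v_le psi hv x k.
have [E0 E1] : (forall chi, test_fun chi ->
    'i * dist (fun x => psi x 1 0) (pd 0 chi) + dist (fun x => psi x 1 0) (pd 1 chi)
      + dist (fun x => f x 0 0) chi = 0) /\
  (forall chi, test_fun chi ->
    'i * dist (fun x => psi x 0 0) (pd 0 chi) - dist (fun x => psi x 0 0) (pd 1 chi)
      - (2 * m)%:C * dist (fun x => psi x 1 0) chi + dist (fun x => f x 1 0) chi = 0).
  by rewrite fV; split=> chi tc; have [] := Dirac_components (hsol chi tc).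
have [dg [H [mH H0 iH gH]]] := remainder_bound hp hG1 hG2.
have up0 : spin_up 0 0 = 1 :> R[i] by rewrite mxE.
have up1 : spin_up 1 0 = 0 :> R[i] by rewrite mxE.
have p0 : {ae mu2 R, forall x, psi x 0 0 = c + (G1 x 0 0 + G2 x 0 0)}.
  by apply: (ae_imp _ hpsi) => x ->; rewrite !addsE scalesE up0 mulr1 addrA.
have p1 : {ae mu2 R, forall x, psi x 1 0 = G1 x 1 0 + G2 x 1 0}.
  by apply: (ae_imp _ hpsi) => x ->; rewrite !addsE scalesE up1 mulr0 add0r.
have K2 : 0 <= 2 * K ^+ 2 by rewrite mulr_ge0 ?sqr_ge0.
(* All the analysis: moments and neutrality of the source, the representation
   of psi by potentials, and its decay. *)
have [sf0 sf1 ch r1 [r0 [C C0 dec]]] := zero_mode_analysis hm heps K2 (hpsimeas 0) (hpsimeas 1)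
  (mf 0) (mf 1) (hf 0) (hf 1) E0 E1 (dg 0) (dg 1) p0 p1 H0 iH (gH 0) (gH 1).
have sf k : moment2 (fun x => f x k 0) by case: (I2_cases k) => ->.
have W k : {ae mu2 R, forall x,
    wpd 0 (G0 (fun y => f y k 0)) x = (- (2 * pi)^-1)%:C * pot (grad_ln 0) (fun y => f y k 0) x /\
    wpd 1 (G0 (fun y => f y k 0)) x = (- (2 * pi)^-1)%:C * pot (grad_ln 1) (fun y => f y k 0) x}.
  by apply: (ae_imp2 _ (wpd_G0 0 (sf k)) (wpd_G0 1 (sf k))) => x.
have repr : ae_eq2 psi (fun x => c *: spin_up - calG0 m f x).
  have q0 : {ae mu2 R, forall x, psi x 0 0 = c - calG0 m f x 0 0}.
    apply: (ae_imp2 _ r0 (W 1)) => x -> [w0 w1].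
    rewrite (calG0E m f x).1 w0 w1 G0E; exact: calG0_alg0.
  have q1 : {ae mu2 R, forall x, psi x 1 0 = - calG0 m f x 1 0}.
    apply: (ae_imp2 _ r1 (W 0)) => x -> [w0 w1].
    by rewrite (calG0E m f x).2 w0 w1; exact: calG0_alg1.
  apply: (ae_imp2 _ q0 q1) => x h0 h1; apply: spinor_ext; rewrite addsE oppsE scalesE ?up0 ?up1.
    by rewrite mulr1.
  by rewrite mulr0 add0r.
have Tphi : ae_eq2 (opT m U v phi) (fun x => c *: first_col v x).
  apply: (ae_imp _ repr) => x hx; rewrite /opT (@mulmx_invol _ _ (v x) (psi x) (Umx_sqr lam x)).
  by rewrite -mulmxDr hx subrK mul_spin_up.
have hc : Lp2 2%:E (first_col v) by exact: (col_L2 hBmeas hlammeas K0 hv heps).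
have n0 := col_norm_neq0 hc hcol.
have psib : {ae mu2 R, forall x, cmod (psi x 0 0) + cmod (psi x 1 0) <= cmod c + 2 * C}.
  apply: (ae_imp _ dec) => x [h0 h1].
  have X1 : C / (1 + enorm x) <= C.
    by rewrite ler_pdivrMr ?ltr_pwDl ?enorm_ge0// ler_peMr// lerDl enorm_ge0.
  have := cmodD c (psi x 0 0 - c); rewrite addrC subrK; lra.
have phi2 : Lp2 2%:E phi.
  apply: (phi_L2 hBmeas hlammeas hpsimeas K0 hv heps _ psib).
  by rewrite addr_ge0 ?cmod_ge0// mulr_ge0.
have Qphi : opQ v phi = phi.
  have ip : inner (first_col v) phi = 0 * (\int[mu2 R]_x (cmod (first_col v x 0 0) ^+ 2 +
     cmod (first_col v x 1 0) ^+ 2))%:C by rewrite mul0r -ch; exact: inner_col_phi.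
  have P0 := opP_eq hc n0 phi2 ip.
  by apply/funext => x; rewrite /opQ P0 scale0r subr0.
have mT k : cmeasurable (fun x => opT m U v phi x k 0) by exact: (opT_measurable hBmeas hlammeas hpsimeas m sf k).
have mcc k : cmeasurable (fun x => (c *: first_col v x) k 0).
  by rewrite (funext (fun x => scalesE c (first_col v x) k)); apply: cmeasurableZ; case: (hc k).
have Lcc : Lp2 2%:E (fun x => c *: first_col v x).
  move=> k; apply: L1_L2 => //; have := L1Z (cmod c ^+ 2) (L2_L1 (hc k)).
  by congr (_.-integrable _ _); apply/funext => x /=; rewrite scalesE cmodM exprMn.
have T2 : Lp2 2%:E (opT m U v phi).
  by move=> k; apply: L2_ae (mT k) _ (Lcc k); apply: (ae_imp _ Tphi) => x ->.
have iT : inner (first_col v) (opT m U v phi) = c * (\int[mu2 R]_x (cmod (first_col v x 0 0) ^+ 2 +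
     cmod (first_col v x 1 0) ^+ 2))%:C.
  have mk (F : plane R -> spinor R) : (forall k, cmeasurable (fun x => F x k 0)) ->
    cmeasurable (fun x => (first_col v x 0 0)^* * F x 0 0 + (first_col v x 1 0)^* * F x 1 0).
    move=> mF; apply: cmeasurableD; apply: cmeasurableM => //; apply: cmeasurable_conj;
      [case: (hc 0)|case: (hc 1)] => //.
  rewrite innerE (cint_ae (mk _ mT) (mk _ mcc)); last by apply: (ae_imp _ Tphi) => x ->.
  rewrite -inner_self innerE !cint_dist -distZf; last first.
    by apply: pairableDf; apply: L2_mul.
  by congr dist; apply/funext => x; rewrite !scalesE; ring.
have QT : ae_eq2 (opQ v (opT m U v (opQ v phi))) (fun=> 0).
  rewrite Qphi; have PT := opP_eq hc n0 T2 iT.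
  by apply: (ae_imp _ Tphi) => x hx; rewrite /opQ PT hx subrr.
have ker : kerQTQ m U v phi.
  split => //; exists phi => //; rewrite Qphi; exact: aeW.
have g_decay k : {ae mu2 R, forall x, cmod ((G1 x + G2 x) k 0) <= C / (1 + enorm x)}.
  case: (I2_cases k) => ->.
    apply: (ae_imp2 _ p0 dec) => x h0 [h1 _]; rewrite addsE.
    by move: h1; rewrite h0 addrC addKr.
  by apply: (ae_imp2 _ p1 dec) => x h0 [_]; rewrite addsE h0.
have g_meas k : cmeasurable (fun x => (G1 x + G2 x) k 0).
  by rewrite (funext (fun x => addsE (G1 x) (G2 x) k)); case: (dg k).
have LG (q : \bar R) : (2%:E < q)%E -> Lp2 q (fun x => G1 x + G2 x).
  by move=> hq k; exact: decay_Lq (g_meas k) C0 (g_decay k) hq.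
have L0 (q : \bar R) : (1 <= q)%E -> Lp2 q (fun=> 0 : spinor R).
  move=> hq k; rewrite (_ : (fun x => _) = fun=> 0); first exact: cLp0.
  by apply/funext => x; rewrite mxE.
split => //.
- split => //; exists phi => //; apply: orthproj_mem => // g [] //.
- have cn := col_norm v; rewrite /c_0 iT cn mulfK//.
  by apply: contra_neq n0 => /(congr1 (@complex.Re R)).
- split => //; exists (fun x => G1 x + G2 x), (fun=> 0); split.
  + by apply: (ae_imp _ hpsi) => x ->; rewrite addr0 addrA.
  + by apply: L0; rewrite lee_fin ler1n.
  + move=> q hq; split; first exact: LG.
    by apply: L0; apply: ltW; apply: le_lt_trans hq; rewrite lee_fin ler1n.
Qed.
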